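(* Let $d\ge2$ be an integer and $1<b<\frac{d+1}{d-1}$. Let $\lambda'\in\operatorname{Arc}[\lambda_0,\lambda_2)$ and $\kappa>1$. Then there exists a positive integer $N$ such that for every $\lambda\in\operatorname{Arc}[\lambda_0,\lambda']$, every $\omega\in\Omega$ and every $z\in J_{\omega,\lambda}$ we have $$\left|\left(\widehat f^{\,N}_{\omega,\lambda}\right)'(z)\right|\ge\kappa .$$
   Context: $\mathbb S^1$ is the unit circle. For $\alpha,\beta\in\mathbb S^1$, $\operatorname{Arc}[\alpha,\beta]$ is the closed circular arc from $\alpha$ to $\beta$ traversed counterclockwise, with analogous notation for open and half-open arcs. For $1\le k\le d$ let $f_{k,\lambda}(z)=\lambda\left(\frac{z+b}{bz+1}\right)^k$. Put $\widehat f_{d,\lambda}=f_{d,\lambda}$ and $\widehat f_{k,\lambda}=f_{1,\lambda}\circ f_{k,\lambda}$ for $1\le k\le d-1$. $\Omega=\{1,\dots,d\}^{\mathbb N}$ is the set of sequences $\omega=(\omega_1,\omega_2,\dots)$, and $\widehat f^{\,n}_{\omega,\lambda}=\widehat f_{\omega_n,\lambda}\circ\cdots\circ\widehat f_{\omega_1,\lambda}$. $J_{\omega,\lambda}$ is the Julia set of the sequence $\{\widehat f^{\,n}_{\omega,\lambda}\}_{n}$, i.e. the set of points of $\widehat{\mathbb C}$ having no neighborhood on which this family is normal (for $\lambda\in \operatorname{Arc}[\lambda_0,\lambda_2)$ it is contained in $\mathbb S^1$). $\lambda_0=e^{i\theta_0}\in\mathbb S^1$ is the parameter with the smallest positive angle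 $\theta_0$ for which $f_{d,\lambda_0}(\lambda_0)=1$; $\lambda_1\in\mathbb S^1$ is the unique parameter with $0<\arg\lambda_1<\pi$ for which $f_{d,\lambda_1}$ has a parabolic fixed point; one has $0<\arg\lambda_0<\arg\lambda_1<\pi$. For $\lambda\in\operatorname{Arc}(\overline{\lambda_1},\lambda_1)$ the map $f_{d,\lambda}$ has a unique attracting fixed point, which lies on $\mathbb S^1$; $I_\lambda$ denotes the connected component of (Fatou set of $f_{d,\lambda}$)$\,\cap\,\mathbb S^1$ containing it. $\lambda_2\in\operatorname{Arc}(\lambda_0,\lambda_1]$ is the parameter of maximal argument such that for every $\lambda\in\operatorname{Arc}[\lambda_0,\lambda_2)$ and every $k\in\{1,\dots,d-1\}$ the closure of $f_{1,\lambda}\circ f_{k,\lambda}(I_\lambda)$ is contained in $I_\lambda$ (such a parameter exists). *)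

(* Defs.v *)
From HB Require Import structures.
From mathcomp Require Import all_boot all_order all_algebra.
From mathcomp Require Import all_classical all_reals all_analysis.
From mathcomp Require Import complex.

Set Implicit Arguments.
Unset Strict Implicit.
Unset Printing Implicit Defensive.

Import Order.TTheory GRing.Theory Num.Theory.
Import numFieldNormedType.Exports ComplexField.Normc.

Local Open Scope classical_set_scope.
Local Open Scope complex_scope.
Local Open Scope ring_scope.

(* The usual topology of the complex numbers, and complex differentiation:
   [R[i]] as a one-dimensional normed space over itself. *)
HB.instance Definition _ (R : rcfType) := NormedModule.copy R[i] R[i]^o.

Section Sphere.
Variable R : realType.

(* [Some z] is the finite point z and [None] is the point at infinity. *)
Definition sphere : Type := one_point_compactification R[i].
HB.instance Definition _ := Topological.on sphere.

Definition expi (t : R) : R[i] := cos t +i* sin t.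

(* Principal argument, for z != 0. *)
Definition Arg (z : R[i]) : R :=
  get [set t : R | - pi < t <= pi /\ z = (normc z)%:C * expi t].

Definition circle : set sphere := [set Some w | w in [set w | normc w = 1]].

(* Arcs of the unit circle run counterclockwise from [a] to [c]; [arc_co] is
   Arc[a, c), and so on. The arc Arc[a, a] is the single point a. *)
Definition arc_cc (a c : R[i]) : set R[i] := [set z | exists s t : R,
  [/\ 0 <= s <= t, t < 2 * pi, z = a * expi s & c = a * expi t]].
Definition arc_co (a c : R[i]) : set R[i] := [set z | exists s t : R,
  [/\ 0 <= s < t, t < 2 * pi, z = a * expi s & c = a * expi t]].
Definition arc_oc (a c : R[i]) : set R[i] := [set z | exists s t : R,
  [/\ 0 < s <= t, t < 2 * pi, z = a * expi s & c = a * expi t]].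

(* Chordal metric. *)
Definition chordal (z w : sphere) : R :=
  match z, w with
  | Some z, Some w => 2 * normc (z - w) /
      (Num.sqrt (1 + normc z ^+ 2) * Num.sqrt (1 + normc w ^+ 2))
  | Some z, None | None, Some z => 2 / Num.sqrt (1 + normc z ^+ 2)
  | None, None => 0
  end.

Definition normal_on (U : set sphere) (G : set (sphere -> sphere)) : Prop :=
  forall u : nat -> sphere -> sphere, (forall n, G (u n)) ->
  exists (phi : nat -> nat) (g : sphere -> sphere),
    {homo phi : m n / (m < n)%N} /\
    forall K : set sphere, compact K -> K `<=` U ->
    forall e : R, 0 < e -> exists n0 : nat, forall n : nat, (n0 <= n)%N ->
    forall z, K z -> chordal (u (phi n) z) (g z) < e.

Definition fatou (G : set (sphere -> sphere)) : set sphere :=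
  [set z | exists U : set sphere, [/\ open U, U z & normal_on U G]].
Definition julia (G : set (sphere -> sphere)) : set sphere := ~` fatou G.

Definition iterates (F : sphere -> sphere) : set (sphere -> sphere) :=
  range (fun n => iter n F).

(* Complex derivative of [F] in the affine coordinate. The value is 0 when this
   derivative does not exist, in particular at infinity and at poles of [F]. *)
Definition sderiv (F : sphere -> sphere) (z : sphere) : R[i] :=
  if z is Some w then derive1 (fun u : R[i] => odflt 0 (F (Some u)) : R[i]) w
  else 0.

(* z |-> 1/z, the coordinate at infinity. *)
Definition sinv (z : sphere) : sphere :=
  if z is Some w then if w == 0 then None else Some w^-1 else Some 0.

(* Multiplier of a holomorphic map [F] at a fixed point. *)
Definition multiplier (F : sphere -> sphere) (z : sphere) : R[i] :=
  if z is Some _ then sderiv F z else sderiv (sinv \o F \o sinv) (Some 0).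

Definition attracting_fixed_point (F : sphere -> sphere) (z : sphere) : Prop :=
  F z = z /\ normc (multiplier F z) < 1.

Definition parabolic_fixed_point (F : sphere -> sphere) (z : sphere) : Prop :=
  F z = z /\ exists2 q : nat, (0 < q)%N & multiplier F z ^+ q = 1.

End Sphere.

Section Family.
Variables (R : realType) (d : nat) (b : R).

(* z |-> (z + b) / (b z + 1); the values at -1/b and at infinity are the right
   ones because b^2 != 1. *)
Definition mobius (z : sphere R) : sphere R :=
  if z is Some w then
    if b%:C * w + 1 == 0 then None else Some ((w + b%:C) / (b%:C * w + 1))
  else Some (b^-1)%:C.

(* f_{k, lambda}, for k > 0 and lambda != 0, so that infinity is fixed by
   u |-> lambda u^k. *)
Definition fpow (k : nat) (lam : R[i]) (z : sphere R) : sphere R :=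
  omap (fun u => lam * u ^+ k) (mobius z).

Definition fhat (k : nat) (lam : R[i]) : sphere R -> sphere R :=
  if k == d then fpow d lam else fpow 1 lam \o fpow k lam.

(* Sequences are indexed from 0: [w n] is omega_(n+1). *)
Definition Omega : set (nat -> nat) := [set w | forall n, (1 <= w n <= d)%N].

Fixpoint fhatn (w : nat -> nat) (lam : R[i]) (n : nat) : sphere R -> sphere R :=
  if n is m.+1 then fhat (w m) lam \o fhatn w lam m else id.

Definition Jset (w : nat -> nat) (lam : R[i]) : set (sphere R) :=
  julia (range (fhatn w lam)).

Definition is_lambda0 (lam0 : R[i]) : Prop := exists theta0 : R,
  [/\ lam0 = expi theta0, 0 < theta0, fpow d lam0 (Some lam0) = Some 1 &
      forall theta : R, 0 < theta ->
        fpow d (expi theta) (Some (expi theta)) = Some 1 -> theta0 <= theta].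

Definition is_lambda1 (lam1 : R[i]) : Prop :=
  [/\ normc lam1 = 1, 0 < Arg lam1 < pi &
      exists z, parabolic_fixed_point (fpow d lam1) z].

(* The component of Fatou set /\ circle containing the attracting fixed point,
   for the parameters lam for which f_{d, lam} has exactly one attracting fixed
   point, lying on the circle. *)
Definition Iarc (lam : R[i]) : set (sphere R) :=
  [set x | exists2 z, attracting_fixed_point (fpow d lam) z &
     connected_component (fatou (iterates (fpow d lam)) `&` @circle R) z x].

Definition trapping_up_to (lam0 mu : R[i]) : Prop :=
  forall lam, arc_co lam0 mu lam -> forall k, (1 <= k <= d.-1)%N ->
  closure ((fpow 1 lam \o fpow k lam) @` Iarc lam) `<=` Iarc lam.

Definition is_lambda2 (lam0 lam1 lam2 : R[i]) : Prop :=
  [/\ arc_oc lam0 lam1 lam2, trapping_up_to lam0 lam2 &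
      forall mu, arc_oc lam0 lam1 mu -> trapping_up_to lam0 mu ->
        Arg mu <= Arg lam2].

End Family.

(* Main.v *)
(** Lift the maps to the angle coordinate.  Two facts about a Blaschke product B
    of the circle drive the proof: B contracts the Hilbert metric of arcs
    [hil], and |B x - B y|^2 <= |B' x| |B' y| |x - y|^2.  The arc I_lambda is
    bounded by a 2-cycle of f_(d, lambda), so the trapping hypothesis provides an
    arc X in I_lambda that all the maps send into its interior, stably in lambda.
    Along the orbit of a point x of X the derivatives then tend to 0
    geometrically, uniformly in omega.  The Julia set lies on the circle and its
    orbits avoid X: near X because X attracts, and off the circle because the
    Poisson kernel with pole at x_n of the n-th image of a point tends to
    infinity.  For z in the Julia set, z_n and x_n stay apart, so the two-point
    inequality forces |(f^n)'(z)| to infinity, uniformly; compactness of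
    Arc[lambda_0, lambda'] ends the proof. *)
Require Import Defs.
From HB Require Import structures.
From mathcomp Require Import all_boot all_order all_algebra.
From mathcomp Require Import all_classical all_reals all_analysis.
From mathcomp Require Import complex ring lra.

Set Implicit Arguments.
Unset Strict Implicit.
Unset Printing Implicit Defensive.

Import Order.TTheory GRing.Theory Num.Theory.
Import numFieldNormedType.Exports ComplexField.Normc.
(* Makes [fatou] the Fatou set again, not Fatou's lemma of measure theory. *)
Import Defs.

Local Open Scope classical_set_scope.
Local Open Scope complex_scope.
Local Open Scope ring_scope.

(** * The Hilbert metric of circular arcs *)

(** The map f_(d, lambda) swaps the endpoints of I_lambda, so I_lambda is invariant without being
    mapped into its interior. This is why a smaller arc X is needed: for k < d the image of the
    closed arc has a positive margin inside the open one, and X only has to be cut within that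
    margin in a way that suits f_d, whose second iterate pushes points near an endpoint inwards. As
    b > 1, the Moebius factor exchanges the disc and its exterior; on the circle f_k reverses
    orientation and f_1 o f_k preserves it. Both facts on Blaschke products are equalities for the
    Moebius factor and only have to be checked for z^k, where they read k cot (k s) <= cot s and
    |sin (k s)| <= k |sin s|. Parameters are governed by the fixed point: e^(i t) is fixed for
    lambda = e^(i (t + d phi t)), where the angle increases with t, and for 0 <= t <= pi it attracts
    until t reaches the parabolic angle. *)

Section Trig.
Variable R : realType.
Implicit Types s t x y u v : R.

Lemma sin_mul2 x : sin (2 * x) = 2 * sin x * cos x.
Proof. by rewrite mulr_natl sin_mulr2n -mulr_natl; ring. Qed.

Lemma cos_mul2 x : cos (2 * x) = 1 - 2 * sin x ^+ 2.
Proof. by rewrite mulr_natl cos_mulr2n -mulr_natl cos2sin2; ring. Qed.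

Lemma cosD_2pi t : cos (t + 2 * pi) = cos t.
Proof. by rewrite mulr_natl cosD2pi. Qed.
Lemma sinD_2pi t : sin (t + 2 * pi) = sin t.
Proof. by rewrite mulr_natl sinD2pi. Qed.

Lemma cosDint t (j : int) : cos (t + 2 * pi * j%:~R) = cos t.
Proof.
case: j => n.
  rewrite -pmulrn mulr_natr; apply: (periodicn cosD_2pi).
rewrite NegzE mulrNz mulrN -pmulrn mulr_natr.
by rewrite -[in RHS](subrK (2 * pi *+ n.+1) t) (periodicn cosD_2pi).
Qed.
Lemma sinDint t (j : int) : sin (t + 2 * pi * j%:~R) = sin t.
Proof.
case: j => n.
  rewrite -pmulrn mulr_natr; apply: (periodicn sinD_2pi).
rewrite NegzE mulrNz mulrN -pmulrn mulr_natr.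
by rewrite -[in RHS](subrK (2 * pi *+ n.+1) t) (periodicn sinD_2pi).
Qed.

Lemma sin_half_sqr x : sin (x / 2) ^+ 2 = (1 - cos x) / 2.
Proof.
have -> : cos x = cos (2 * (x / 2)) by apply: congr1; field.
by rewrite cos_mul2; field.
Qed.

Lemma sin_halfDint_sqr x (j : int) :
  sin ((x + 2 * pi * j%:~R) / 2) ^+ 2 = sin (x / 2) ^+ 2.
Proof. by rewrite !sin_half_sqr cosDint. Qed.

(** On the circle this is |x^k - y^k| <= k |x - y|, the two-point inequality for the power map,
    whose derivative has modulus k. *)
Lemma norm_sin_mul (k : nat) s : `|sin (k%:R * s)| <= k%:R * `|sin s|.
Proof.
elim: k => [|k IH]; first by rewrite !mul0r sin0 normr0.
have -> : k.+1%:R * s = k%:R * s + s by rewrite -natr1; ring.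
rewrite sinD -natr1 mulrDl mul1r; apply: (le_trans (ler_normD _ _)).
rewrite !normrM; apply: lerD.
  apply: le_trans IH; rewrite ler_piMr //; exact: cos_max.
by rewrite ler_piMl // cos_max.
Qed.

Lemma sin_mul_lt (k : nat) s : (2 <= k)%N -> 0 < s < pi ->
  sin (k%:R * s) < k%:R * sin s.
Proof.
move=> k2 /andP[s0 spi].
have ss : 0 < sin s by apply: sin_gt0_pi; rewrite s0.
case: k k2 => // k; rewrite ltnS => k1.
have -> : k.+1%:R * s = k%:R * s + s by rewrite -natr1; ring.
rewrite sinD.
have h1 : sin (k%:R * s) * cos s < k%:R * sin s.
  apply: (le_lt_trans (ler_norm _)); rewrite normrM.
  have h : `|sin (k%:R * s)| <= k%:R * sin s.
    by apply: (le_trans (norm_sin_mul _ _)); rewrite gtr0_norm.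
  apply: (le_lt_trans (ler_wpM2r _ h)) => //.
  rewrite gtr_pMr; last by rewrite mulr_gt0 // ltr0n.
  have := cos2Dsin2 s; have : 0 < sin s ^+ 2 by rewrite exprn_gt0.
  move=> h2 h3; rewrite -(@expr_lt1 _ 2) // real_normK ?num_real //; lra.
have h2 : cos (k%:R * s) * sin s <= sin s.
  by rewrite ler_piMl ?cos_le1 // ltW.
by rewrite -natr1 mulrDl mul1r; apply: ltr_leD.
Qed.

(* k cot (k s) <= cot s, with the denominators cleared. *)
Lemma cot_mul (k : nat) s : (0 < k)%N -> 0 < s -> k%:R * s < pi ->
  (k%:R * cos (k%:R * s) * sin s <= cos s * sin (k%:R * s)) *
  ((2 <= k)%N -> k%:R * cos (k%:R * s) * sin s < cos s * sin (k%:R * s)).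
Proof.
elim: k => // k IH _ s0.
case: (posnP k) => [-> _|k0].
  by split => //; rewrite !mul1r mulrC lexx.
move=> ks.
have kss : k%:R * s < pi.
  by apply: le_lt_trans ks; rewrite ler_pM2r // ler_nat.
have {IH}[IH _] := IH k0 s0 kss.
have E : k.+1%:R * s = k%:R * s + s by rewrite -natr1; ring.
have s2 : s < pi / 2.
  rewrite ltr_pdivlMr // (le_lt_trans _ ks) // mulrC ler_pM2r //.
  by rewrite ler_nat ltnS.
have cs : 0 < cos s by apply: cos_gt0_pihalf; rewrite s2 andbT; lra.
have ss : 0 < sin s by apply: sin_gt0_pihalf; rewrite s2 s0.
have S : 0 < sin (k%:R * s).
  by apply: sin_gt0_pi; rewrite kss andbT mulr_gt0 // ltr0n.
suff H : k.+1%:R * cos (k.+1%:R * s) * sin s < cos s * sin (k.+1%:R * s).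
  by split => //; exact: ltW.
rewrite E cosD sinD -natr1.
have kp : 0 <= k%:R :> R by [].
have := ler_wpM2l (ltW cs) IH.
have h1 : 0 < sin s ^+ 2 * sin (k%:R * s) by rewrite mulr_gt0 // exprn_gt0.
have h2 : 0 <= k%:R * (sin s ^+ 2 * sin (k%:R * s)) by rewrite mulr_ge0 // ltW.
move: (k%:R : R) h1 h2 => K; move: (cos _) (sin (K * s)) (cos s) (sin s) => A B C D.
(* With A, B the cosine and sine of k s and C, D those of s, the difference is C times the induction
   hypothesis plus the positive term (k + 1) D^2 B. *)
move=> h1 h2 h3; rewrite -subr_gt0.
have -> : C * (B * C + A * D) - (K + 1) * (A * C - B * D) * D =
  C * (C * B - K * A * D) + (D ^+ 2 * B + K * (D ^+ 2 * B)) by ring.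
rewrite mulrBr; lra.
Qed.

End Trig.

Section Hilbert.
Variable R : realType.
Implicit Types s t x y u v : R.

(* The density of the Hilbert metric of the circular arc from u to v. *)
Definition hil u v x := sin ((v - u) / 2) / (sin ((x - u) / 2) * sin ((v - x) / 2)).

Lemma sin_half_gt0 x : 0 < x -> x < 2 * pi -> 0 < sin (x / 2).
Proof. by move=> x0 x2; apply: sin_gt0_pi; lra. Qed.

(** The addition formula for the sine splits the density into two cotangents, one per endpoint. Its
    behaviour under scaling and shrinking of the arc then reduces to properties of cot. *)
Lemma hilE u v x : u < x -> x < v -> v - u < 2 * pi ->
  hil u v x = cos ((x - u) / 2) / sin ((x - u) / 2) +
              cos ((v - x) / 2) / sin ((v - x) / 2).
Proof.
move=> ux xv vu.
have h1 : sin ((x - u) / 2) != 0 by rewrite gt_eqF // sin_half_gt0 //; lra.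
have h2 : sin ((v - x) / 2) != 0 by rewrite gt_eqF // sin_half_gt0 //; lra.
rewrite /hil.
have -> : (v - u) / 2 = (x - u) / 2 + (v - x) / 2 by field.
by rewrite sinD; field; apply/andP.
Qed.

Lemma hil_gt0 u v x : u < x -> x < v -> v - u < 2 * pi -> 0 < hil u v x.
Proof.
move=> ux xv vu; rewrite divr_gt0 ?mulr_gt0 //; apply: sin_half_gt0; lra.
Qed.

Lemma hil_ge u v x : u < x -> x < v -> v - u < 2 * pi ->
  sin ((v - u) / 2) <= hil u v x.
Proof.
move=> ux xv vu; rewrite /hil.
have h1 : 0 < sin ((x - u) / 2) by rewrite sin_half_gt0 //; lra.
have h2 : 0 < sin ((v - x) / 2) by rewrite sin_half_gt0 //; lra.
have h3 : 0 < sin ((v - u) / 2) by rewrite sin_half_gt0 //; lra.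
rewrite ler_pdivlMr ?mulr_gt0 // ler_piMr // ?(ltW h3) //.
Qed.

Lemma hilDint u v x (j : int) : hil u v (x + 2 * pi * j%:~R) = hil u v x.
Proof.
rewrite /hil; congr (_ / _).
(* One turn of x changes the sign of both sines in the denominator. Here this is seen from a - c
   moving by [2 * pi * j] while a + c is fixed. *)
have E a c : sin a * sin c = (cos (a - c) - cos (a + c)) / 2 :> R.
  by rewrite cosB cosD; field.
rewrite !E; congr ((_ - _) / 2).
  by rewrite -(cosDint ((x - u) / 2 - (v - x) / 2) j); apply: congr1; field.
by apply: congr1; field.
Qed.

Lemma hil_reflect t u v x : hil (t - v) (t - u) (t - x) = hil u v x.
Proof.
have E a c : t - a - (t - c) = c - a by ring.
by rewrite /hil !E (mulrC (sin ((v - x) / 2))).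
Qed.

(** [cot_mul] applies to each cotangent of [hilE]. The bound on [k%:R * (v - u)] keeps the image arc
    shorter than a full turn. *)
Lemma hil_scale (k : nat) u v x : (0 < k)%N -> u < x -> x < v ->
  k%:R * (v - u) < 2 * pi ->
  (hil (k%:R * u) (k%:R * v) (k%:R * x) * k%:R <= hil u v x) *
  ((2 <= k)%N -> hil (k%:R * u) (k%:R * v) (k%:R * x) * k%:R < hil u v x).
Proof.
move=> k0 ux xv kvu.
have k1 : 1 <= k%:R :> R by rewrite ler1n.
have kp : 0 < k%:R :> R by rewrite ltr0n.
have vu : v - u < 2 * pi by apply: le_lt_trans kvu; rewrite ler_peMl //; lra.
have kx : k%:R * (x - u) < 2 * pi.
  by apply: le_lt_trans kvu; rewrite ler_pM2l //; lra.
have kx' : k%:R * (v - x) < 2 * pi.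
  by apply: le_lt_trans kvu; rewrite ler_pM2l //; lra.
rewrite hilE ?ltr_pM2l //; last by rewrite -mulrBr.
rewrite hilE //.
have E y z : (k%:R * y - k%:R * z) / 2 = k%:R * ((y - z) / 2) :> R by field.
rewrite !E.
have key s : 0 < s -> k%:R * (2 * s) < 2 * pi -> [/\
  0 < sin s, 0 < sin (k%:R * s),
  k%:R * cos (k%:R * s) * sin s <= cos s * sin (k%:R * s) &
  ((2 <= k)%N -> k%:R * cos (k%:R * s) * sin s < cos s * sin (k%:R * s))].
  move=> s0 ks.
  have ks' : k%:R * s < pi.
    have -> : k%:R * s = k%:R * (2 * s) / 2 by field.
    lra.
  have [h1 h2] := cot_mul k0 s0 ks'.
  have ss : s < pi by apply: le_lt_trans ks'; rewrite ler_peMl // ltW.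
  split => //; apply: sin_gt0_pi; rewrite ?s0 ?ss // ks' andbT mulr_gt0 //.
have D y : 2 * (y / 2) = y :> R by field.
have [||a1 a2 a3 a4] := key ((x - u) / 2); [by lra| by rewrite D|].
have [||b1 b2 b3 b4] := key ((v - x) / 2); [by lra| by rewrite D|].
have H s : 0 < sin s -> 0 < sin (k%:R * s) ->
   ((cos (k%:R * s) / sin (k%:R * s) * k%:R <= cos s / sin s) =
     (k%:R * cos (k%:R * s) * sin s <= cos s * sin (k%:R * s))) *
   ((cos (k%:R * s) / sin (k%:R * s) * k%:R < cos s / sin s) =
     (k%:R * cos (k%:R * s) * sin s < cos s * sin (k%:R * s))).
  move=> h1 h2; rewrite ler_pdivlMr // ltr_pdivlMr //.
  have -> : cos (k%:R * s) / sin (k%:R * s) * k%:R * sin s =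
     (k%:R * cos (k%:R * s) * sin s) / sin (k%:R * s) by field; rewrite gt_eqF.
  by rewrite ler_pdivrMr // ltr_pdivrMr.
split => [|k2]; rewrite mulrDl.
  by apply: lerD; rewrite H.
by apply: ltrD; rewrite H // ?a4 ?b4.
Qed.

Lemma hil_le u v e x : u < v -> v - u < 2 * pi -> 0 < e ->
  u + e <= x <= v - e -> hil u v x <= 2 / sin (e / 2).
Proof.
move=> uv vu e0 /andP[ux xv].
have se : 0 < sin (e / 2) by rewrite sin_half_gt0 //; lra.
rewrite hilE //; try lra.
have B y : e <= y -> y < 2 * pi -> cos (y / 2) / sin (y / 2) <= (sin (e / 2))^-1.
  move=> y1 y2.
  have h1 : 0 < sin (y / 2) by rewrite sin_half_gt0 //; lra.
  apply: (@le_trans _ _ (cos (e / 2) / sin (e / 2))); last first.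
    by rewrite ler_piMl ?cos_le1 // invr_ge0 ltW.
  have [->//|ye] := eqVneq y e.
  rewrite ler_pdivrMr // mulrAC ler_pdivlMr // -subr_ge0.
  have -> : cos (e / 2) * sin (y / 2) - cos (y / 2) * sin (e / 2) = sin ((y - e) / 2).
    by rewrite mulrBl sinB; ring.
  by apply: sin_ge0_pi; lra.
rewrite mulr_natl mulr2n; apply: lerD; apply: B; lra.
Qed.

(* Shrinking an arc by e on both sides increases its density by a definite
   amount, since cot is decreasing. *)
Lemma hil_shrink u v e : u < v -> v - u < 2 * pi -> 0 < e ->
  exists q, 0 < q < 1 /\ forall a c x, u + e <= a -> a < x -> x < c -> c <= v - e ->
    hil u v x <= q * hil a c x.
Proof.
move=> uv vu e0.
have [ee|ee] := leP (v - u) e.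
  exists (1 / 2); split; first lra.
  by move=> *; lra.
have se : 0 < sin (e / 2) by rewrite sin_half_gt0 //; lra.
(* [M] bounds h = [hil u v x] at distance e from the endpoints. If s = sin (e / 2) and h + s <= h',
   then h <= M yields h <= M / (M + s) * h'. *)
pose M := 2 / sin (e / 2).
have M0 : 0 < M by rewrite divr_gt0.
exists (M / (M + sin (e / 2))); split.
  rewrite divr_gt0 ?addr_gt0 //= ltr_pdivrMr ?addr_gt0 //; lra.
move=> a c x ua ax xc cv.
have key y z : 0 < z -> z + e <= y -> y < 2 * pi ->
  cos (y / 2) / sin (y / 2) + sin (e / 2) <= cos (z / 2) / sin (z / 2).
  move=> z0 zy y2.
  have h1 : 0 < sin (y / 2) by rewrite sin_half_gt0 //; lra.
  have h2 : 0 < sin (z / 2) by rewrite sin_half_gt0 //; lra.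
  have h3 : 0 < sin ((y - e) / 2) by rewrite sin_half_gt0 //; lra.
  have cotB p q : sin p != 0 -> sin q != 0 ->
      cos q / sin q - cos p / sin p = sin (p - q) / (sin p * sin q) :> R.
    by move=> p0 q0; rewrite sinB; field; apply/andP.
  have A : cos ((y - e) / 2) / sin ((y - e) / 2) <= cos (z / 2) / sin (z / 2).
    rewrite -subr_ge0 cotB ?gt_eqF // divr_ge0 ?mulr_ge0 ?(ltW h2) ?(ltW h3) //.
    by apply: sin_ge0_pi; lra.
  apply: le_trans A; rewrite -lerBrDl cotB ?gt_eqF //.
  have -> : y / 2 - (y - e) / 2 = e / 2 by field.
  rewrite ler_pdivlMr ?mulr_gt0 // ler_piMr // ?(ltW se) //.
have hM : hil u v x <= M by apply: hil_le; lra.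
have h1 : hil u v x + sin (e / 2) <= hil a c x.
  rewrite hilE; [|lra|lra|lra]. rewrite hilE //; last lra.
  have := @key (x - u) (x - a); have := @key (v - x) (c - x) => K1 K2.
  have {}K1 := K1 ltac:(lra) ltac:(lra) ltac:(lra).
  have {}K2 := K2 ltac:(lra) ltac:(lra) ltac:(lra).
  have : 0 < sin (e / 2) by [].
  lra.
apply: (@le_trans _ _ (M / (M + sin (e / 2)) * (hil u v x + sin (e / 2)))).
  rewrite mulrAC ler_pdivlMr ?addr_gt0 //.
  rewrite mulrDr [leRHS]mulrDr [hil _ _ _ * M]mulrC lerD2l.
  by rewrite ler_pM2r.
by rewrite ler_pM2l // divr_gt0 // addr_gt0.
Qed.

End Hilbert.

(** * Lifts of the maps to the angle coordinate *)

Section Lift.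
Variables (R : realType) (b : R).
Hypothesis b1 : 1 < b.
Implicit Types s t x y u v : R.

(** [nrm2], [nrm] and [psi] are the squared modulus, the modulus and the argument of b + e^(i t).
    The arctangent is the argument because b > 1 makes the real part positive. *)
Definition nrm2 t := b ^+ 2 + 1 + 2 * b * cos t.
Definition nrm t := Num.sqrt (nrm2 t).
Definition psi t := atan (sin t / (b + cos t)).
(* The lift of the circle map t |-> - arg of the Moebius map at e^(i t). *)
Definition phi t := t - 2 * psi t.
(** The derivative of [phi]. It is also the modulus at z = e^(i t) of the Moebius derivative (1 -
    b^2) / (b z + 1)^2, since |b z + 1|^2 = [nrm2 t]. *)
Definition gder t := (b ^+ 2 - 1) / nrm2 t.

Lemma bcos_gt0 t : 0 < b + cos t.
Proof. by have := cos_geN1 t; move: b1; lra. Qed.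

Lemma nrm2E t : nrm2 t = (b + cos t) ^+ 2 + sin t ^+ 2.
Proof. by rewrite sin2cos2 /nrm2; ring. Qed.

Lemma nrm2_gt0 t : 0 < nrm2 t.
Proof. by rewrite nrm2E ltr_wpDr ?sqr_ge0 // exprn_gt0 // bcos_gt0. Qed.

Lemma nrm_gt0 t : 0 < nrm t.
Proof. by rewrite sqrtr_gt0 nrm2_gt0. Qed.

Lemma sqr_nrm t : nrm t ^+ 2 = nrm2 t.
Proof. by rewrite sqr_sqrtr // ltW // nrm2_gt0. Qed.

Lemma b2m1_gt0 : 0 < b ^+ 2 - 1.
Proof. by rewrite subr_gt0 expr_gt1 //; move: b1; lra. Qed.

Lemma gder_gt0 t : 0 < gder t.
Proof. by rewrite divr_gt0 ?nrm2_gt0 ?b2m1_gt0. Qed.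

Lemma cos_psi t : cos (psi t) = (b + cos t) / nrm t.
Proof.
have h := bcos_gt0 t.
rewrite cos_atan; have -> : 1 + (sin t / (b + cos t)) ^+ 2 = (nrm t / (b + cos t)) ^+ 2.
  by rewrite !expr_div_n sqr_nrm nrm2E; field; rewrite gt_eqF.
by rewrite sqrtr_sqr gtr0_norm ?invf_div // divr_gt0 // nrm_gt0.
Qed.

Lemma sin_psi t : sin (psi t) = sin t / nrm t.
Proof.
have h := bcos_gt0 t; have n := nrm_gt0 t.
have c0 : cos (psi t) != 0 by rewrite cos_psi gt_eqF // divr_gt0.
have : tan (psi t) = sin t / (b + cos t) by rewrite atanK.
move=> E; rewrite -[LHS](divfK c0) -/(tan (psi t)) E cos_psi; field.
by rewrite !gt_eqF.
Qed.

(** A Moebius map multiplies a chord by the geometric mean of the derivatives at its ends; this form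
    keeps the sign as well. *)
Lemma sin_half_phi x u : sin ((phi x - phi u) / 2) =
  (b ^+ 2 - 1) / (nrm x * nrm u) * sin ((x - u) / 2).
Proof.
have nx := nrm_gt0 x; have nu := nrm_gt0 u.
have -> : (phi x - phi u) / 2 = (x / 2 - psi x) - (u / 2 - psi u).
  by rewrite /phi; field.
(* The product of e^(i y / 2) and the conjugate of b + e^(i y) is b e^(i y / 2) + e^(- i y / 2),
   with real part (b + 1) cos (y / 2) and imaginary part (b - 1) sin (y / 2). *)
have E y : sin (y / 2 - psi y) = (b - 1) * sin (y / 2) / nrm y /\
           cos (y / 2 - psi y) = (b + 1) * cos (y / 2) / nrm y.
  have h := nrm_gt0 y.
  have S : sin y = 2 * sin (y / 2) * cos (y / 2).
    by rewrite -sin_mul2; apply: congr1; field.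
  have C : cos y = 1 - 2 * sin (y / 2) ^+ 2.
    by rewrite -cos_mul2; apply: congr1; field.
  have C' := cos2Dsin2 (y / 2).
  rewrite sinB cosB sin_psi cos_psi S; split.
    transitivity ((b - 1 + 2 * (1 - (cos (y / 2) ^+ 2 + sin (y / 2) ^+ 2))) *
      sin (y / 2) / nrm y); last by rewrite C'; field; rewrite gt_eqF.
    by rewrite C; field; rewrite gt_eqF.
  rewrite (_ : cos y = 2 * cos (y / 2) ^+ 2 - 1); last by rewrite C; move: C'; lra.
  transitivity ((b - 1 + 2 * (cos (y / 2) ^+ 2 + sin (y / 2) ^+ 2)) *
      cos (y / 2) / nrm y); last by rewrite C'; field; rewrite gt_eqF.
  by field; rewrite gt_eqF.
rewrite sinB !(E _).1 !(E _).2 [(x - u) / 2]mulrBl sinB; field.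
by rewrite !gt_eqF.
Qed.

Lemma sin_half_phi_sqr x u : sin ((phi x - phi u) / 2) ^+ 2 =
  gder x * gder u * sin ((x - u) / 2) ^+ 2.
Proof.
rewrite sin_half_phi exprMn expr_div_n exprMn !sqr_nrm /gder; congr (_ * _).
by field; rewrite !gt_eqF // nrm2_gt0.
Qed.

Lemma phiDint t (j : int) : phi (t + 2 * pi * j%:~R) = phi t + 2 * pi * j%:~R.
Proof. by rewrite /phi /psi cosDint sinDint; ring. Qed.

Lemma phiD2pi t : phi (t + 2 * pi) = phi t + 2 * pi.
Proof. by have := phiDint t 1; rewrite mulr1. Qed.

Lemma phiN t : phi (- t) = - phi t.
Proof. by rewrite /phi /psi sinN cosN mulNr atanN; ring. Qed.

Lemma phi0 : phi 0 = 0.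
Proof. by rewrite /phi /psi sin0 mul0r atan0; ring. Qed.

Lemma phipi : phi pi = pi.
Proof. by rewrite /phi /psi sinpi mul0r atan0; ring. Qed.

Lemma gderDint t (j : int) : gder (t + 2 * pi * j%:~R) = gder t.
Proof. by rewrite /gder /nrm2 cosDint. Qed.

Lemma gderN t : gder (- t) = gder t.
Proof. by rewrite /gder /nrm2 cosN. Qed.

(** The sign of the half-angle sine locates the half difference only modulo a turn. As |psi| < pi /
    2, it lies in (- pi, 2 pi), where a positive sine leaves only (0, pi). *)
Lemma phi_lt_aux x u : u < x -> x - u < 2 * pi -> 0 < phi x - phi u < 2 * pi.
Proof.
move=> ux xu.
have h1 := atan_gtNpi2 (sin x / (b + cos x)); have h2 := atan_ltpi2 (sin x / (b + cos x)).
have h3 := atan_gtNpi2 (sin u / (b + cos u)); have h4 := atan_ltpi2 (sin u / (b + cos u)).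
have S : 0 < sin ((phi x - phi u) / 2).
  rewrite sin_half_phi mulr_gt0 ?divr_gt0 ?mulr_gt0 ?nrm_gt0 ?b2m1_gt0 //.
  by apply: sin_half_gt0; lra.
have B1 : - pi < (phi x - phi u) / 2 by rewrite /phi /psi; lra.
have B2 : (phi x - phi u) / 2 < 2 * pi by rewrite /phi /psi; lra.
have C1 : 0 < (phi x - phi u) / 2.
  rewrite ltNge; apply/negP => h.
  have : 0 <= sin (- ((phi x - phi u) / 2)) by apply: sin_ge0_pi; lra.
  by rewrite sinN; lra.
have C2 : (phi x - phi u) / 2 < pi.
  rewrite ltNge; apply/negP => h.
  have : 0 <= sin ((phi x - phi u) / 2 - pi) by apply: sin_ge0_pi; lra.
  by rewrite sinB cospi sinpi; lra.
apply/andP; lra.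
Qed.

Lemma phi_lt : {mono phi : x y / x < y}.
Proof.
suff H : {homo phi : x y / x < y}.
  by move=> x y; apply/idP/idP; [|exact: H]; apply: contraLR; rewrite -!leNgt
     le_eqVlt => /predU1P[->//|/H/ltW].
move=> x y xy.
have p0 := @pi_gt0 R.
pose n := Num.truncn ((y - x) / (2 * pi)).
have : n%:R <= (y - x) / (2 * pi) < n.+1%:R.
  by apply: truncn_itv; rewrite divr_ge0 //; lra.
rewrite ler_pdivlMr ?ltr_pdivrMr; [|lra|lra] => /andP[h1 h2].
have E : phi (y - 2 * pi * n%:R) = phi y - 2 * pi * n%:R.
  by have := phiDint y (- n%:Z); rewrite mulrNz mulrN.
have : phi x <= phi (y - 2 * pi * n%:R).
  have : 0 <= y - 2 * pi * n%:R - x by lra.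
  rewrite le_eqVlt => /predU1P[h|h].
    by have -> : x = y - 2 * pi * n%:R by lra.
  have := @phi_lt_aux (y - 2 * pi * n%:R) x; rewrite -natr1 in h2.
  move=> /(_ ltac:(lra) ltac:(lra)) /andP[]; lra.
rewrite E; have [n0|n0] := posnP n; last first.
  have : 0 < 2 * pi * n%:R :> R by rewrite !mulr_gt0 ?ltr0n.
  lra.
move=> _; have := @phi_lt_aux y x xy; rewrite n0 in h2.
by move=> /(_ ltac:(lra)) /andP[]; lra.
Qed.

Lemma phi_lt2pi x u : (phi x - phi u < 2 * pi) = (x - u < 2 * pi).
Proof. by rewrite ltrBlDl -phiD2pi phi_lt -ltrBlDl. Qed.

Lemma continuous_phi : continuous phi.
Proof.
move=> x; apply: cvgB; first exact: cvg_id.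
apply: cvgM; first exact: cvg_cst.
apply: (@continuous_comp _ _ _ (fun t => sin t / (b + cos t)) atan).
  apply: cvgM; first exact: continuous_sin.
  apply: cvgV; first by rewrite gt_eqF // bcos_gt0.
  by apply: cvgD; [exact: cvg_cst|exact: continuous_cos].
exact: continuous_atan.
Qed.

Lemma continuous_gder : continuous gder.
Proof.
move=> x; apply: cvgM; first exact: cvg_cst.
apply: cvgV; first by rewrite gt_eqF // nrm2_gt0.
apply: cvgD; first exact: cvg_cst.
by apply: cvgM; [exact: cvg_cst|exact: continuous_cos].
Qed.

Lemma gder_lt x y : (gder x < gder y) = (cos y < cos x).
Proof.
rewrite ltr_pM2l ?b2m1_gt0 // ltf_pV2 ?posrE ?nrm2_gt0 //.
rewrite /nrm2 ltrD2l ltr_pM2l //; move: b1; lra.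
Qed.

Lemma gder_le_max t : gder t <= (b + 1) / (b - 1).
Proof.
have b10 : 0 < b - 1 by move: b1; lra.
have := cos_geN1 t => h.
rewrite ler_pdivlMr // mulrAC ler_pdivrMr ?nrm2_gt0 // /nrm2.
have : 0 <= b * (b + 1) * (1 + cos t) by rewrite !mulr_ge0 //; move: b1; lra.
by nra.
Qed.

(** Moebius maps are isometries of the Hilbert metric: the factors that [sin_half_phi] produces at
    u, v and x cancel against [gder x]. *)
Lemma hil_phi u v x : u < x -> x < v -> v - u < 2 * pi ->
  hil (phi u) (phi v) (phi x) * gder x = hil u v x.
Proof.
move=> ux xv vu; rewrite /hil !sin_half_phi /gder -sqr_nrm.
have h1 : 0 < sin ((x - u) / 2) by apply: sin_half_gt0; lra.
have h2 : 0 < sin ((v - x) / 2) by apply: sin_half_gt0; lra.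
have n1 := nrm_gt0 u; have n2 := nrm_gt0 v; have n3 := nrm_gt0 x.
have n4 := b2m1_gt0.
by field; rewrite !gt_eqF.
Qed.

End Lift.

(** * Contraction along random orbits in a trapping arc *)

Section Orbits.
Variables (R : realType) (d : nat) (b : R).
Hypothesis b1 : 1 < b.
Implicit Types s t x y u v th e q : R.

Local Notation phi := (phi b).
Local Notation gder := (gder b).

(** The minus sign is the reversal of orientation by the Moebius factor: for positive k [flift] is
    decreasing, and [hlift] is increasing when k is not d. *)
Definition flift (k : nat) th t := th - k%:R * phi t.
Definition hlift (k : nat) th t :=
  if k == d then flift d th t else flift 1 th (flift k th t).
Definition hder (k : nat) th t :=
  if k == d then d%:R * gder t else gder (flift k th t) * (k%:R * gder t).

Fixpoint hliftn (w : nat -> nat) th n t :=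
  if n is m.+1 then hlift (w m) th (hliftn w th m t) else t.
Fixpoint hdern (w : nat -> nat) th n t :=
  if n is m.+1 then hder (w m) th (hliftn w th m t) * hdern w th m t else 1.

Lemma fliftDint k th t (j : int) :
  flift k th (t + 2 * pi * j%:~R) = flift k th t + 2 * pi * (- (k%:Z * j))%:~R.
Proof. by rewrite /flift phiDint mulrNz intrM; ring. Qed.

Lemma hliftDint k th t (j : int) : exists j' : int,
  hlift k th (t + 2 * pi * j%:~R) = hlift k th t + 2 * pi * j'%:~R.
Proof.
rewrite /hlift; case: eqP => _; first by rewrite fliftDint; eexists.
by rewrite !fliftDint; eexists.
Qed.

Lemma hder_gt0 k th t : (0 < k)%N -> 0 < hder k th t.
Proof.
move=> k0; have kp : 0 < k%:R :> R by rewrite ltr0n.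
have g0 := gder_gt0 b1; rewrite /hder; case: eqP => [<-|_]; first exact: mulr_gt0.
by apply: mulr_gt0 => //; exact: mulr_gt0.
Qed.

Lemma hderDint k th t (j : int) : hder k th (t + 2 * pi * j%:~R) = hder k th t.
Proof. by rewrite /hder fliftDint !gderDint. Qed.

Lemma hdern_gt0 w th n t : (forall m, (0 < w m)%N) -> 0 < hdern w th n t.
Proof. by move=> w0; elim: n => //= n IH; rewrite mulr_gt0 // hder_gt0. Qed.

Lemma flift_chord k th x y : sin ((flift k th x - flift k th y) / 2) ^+ 2 <=
  (k%:R * gder x) * (k%:R * gder y) * sin ((x - y) / 2) ^+ 2.
Proof.
have -> : (flift k th x - flift k th y) / 2 = k%:R * ((phi y - phi x) / 2).
  by rewrite /flift; field.
have := norm_sin_mul k ((phi y - phi x) / 2).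
rewrite -(@ler_pXn2r _ 2) ?nnegrE ?mulr_ge0 // exprMn !real_normK ?num_real //.
move=> /le_trans; apply; rewrite sin_half_phi_sqr //.
rewrite -(opprB x y) mulNr sinN sqrrN le_eqVlt; apply/orP; left; apply/eqP; ring.
Qed.

Lemma hlift_chord k th x y : (0 < k)%N ->
  sin ((hlift k th x - hlift k th y) / 2) ^+ 2 <=
  hder k th x * hder k th y * sin ((x - y) / 2) ^+ 2.
Proof.
move=> k0; rewrite /hlift /hder; case: eqP => _; first exact: flift_chord.
apply: (le_trans (flift_chord _ _ _ _)); rewrite !mul1r.
set G := gder (flift k th x); set G' := gder (flift k th y).
have G0 : 0 <= G * G' by rewrite mulr_ge0 // ltW // gder_gt0.
apply: (le_trans (ler_wpM2l G0 (flift_chord k th x y))).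
rewrite le_eqVlt; apply/orP; left; apply/eqP; ring.
Qed.

(* A two-point form of the positivity of the Schwarzian of a Blaschke product:
   the derivatives at two points of the circle cannot both be small. *)
Lemma hliftn_chord w th n x y : (forall m, (0 < w m)%N) ->
  sin ((hliftn w th n x - hliftn w th n y) / 2) ^+ 2 <=
  hdern w th n x * hdern w th n y * sin ((x - y) / 2) ^+ 2.
Proof.
move=> w0; elim: n => [|n IH] /=; first by rewrite !mul1r.
apply: (le_trans (hlift_chord _ _ _ (w0 n))).
set D := hder _ _ _; set D' := hder _ _ _.
have D0 : 0 <= D * D' by rewrite mulr_ge0 // ltW // hder_gt0.
apply: (le_trans (ler_wpM2l D0 IH)).
rewrite le_eqVlt; apply/orP; left; apply/eqP; ring.
Qed.

Lemma flift_lt k th : (0 < k)%N -> {mono flift k th : x y / x < y >-> y < x}.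
Proof.
by move=> k0 x y; rewrite /flift ltrD2l ltrN2 ltr_pM2l ?ltr0n // phi_lt.
Qed.

Lemma continuous_flift k th : continuous (flift k th).
Proof.
move=> x; apply: cvgB; first exact: cvg_cst.
by apply: cvgM; [exact: cvg_cst|exact: continuous_phi].
Qed.

Lemma continuous_hlift k th : continuous (hlift k th).
Proof.
rewrite /hlift; case: eqP => _; first exact: continuous_flift.
move=> x; apply: (@continuous_comp _ _ _ (flift k th) (flift 1 th)).
  exact: continuous_flift.
exact: continuous_flift.
Qed.

(** [flift] is the Moebius lift followed by a scaling and a reflection: isometry, contraction,
    isometry. The strict form for k >= 2 is what makes the fixed point at lambda_0 attracting. *)
Lemma hil_flift k th u v x : (0 < k)%N -> u < x -> x < v ->
  flift k th u - flift k th v < 2 * pi ->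
  (hil (flift k th v) (flift k th u) (flift k th x) * (k%:R * gder x) <= hil u v x) *
  ((2 <= k)%N ->
   hil (flift k th v) (flift k th u) (flift k th x) * (k%:R * gder x) < hil u v x).
Proof.
move=> k0 ux xv; rewrite /flift.
have -> : th - k%:R * phi u - (th - k%:R * phi v) = k%:R * (phi v - phi u) by ring.
move=> kuv; have uv := lt_trans ux xv.
have pu : phi u < phi x by rewrite phi_lt.
have pv : phi x < phi v by rewrite phi_lt.
have vu : v - u < 2 * pi.
  rewrite -(phi_lt2pi b1); apply: le_lt_trans kuv; rewrite ler_peMl ?ler1n //.
  lra.
rewrite hil_reflect mulrA -(hil_phi b1 ux xv vu).
have g0 := gder_gt0 b1 x.
have [h1 h2] := hil_scale k0 pu pv kuv.
by split => [|k2]; rewrite ?ler_pM2r ?ltr_pM2r //; exact: h2.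
Qed.

Lemma hil_shift u v x s : hil (u - s) (v - s) (x - s) = hil u v x.
Proof.
have E y z : y - s - (z - s) = y - z by ring.
by rewrite /hil !E.
Qed.

(** The maps do not expand from an arc to its image arc, and the definite gain q comes from
    [hil_shrink], the image arc lying in the shrunk one. So q depends on u, v and e only. *)
Lemma hil_hlift u v e : u < v -> v - u < 2 * pi -> 0 < e ->
  exists q, 0 < q < 1 /\ forall th k (j : int), (0 < k)%N ->
    (forall t, u <= t <= v -> u + e <= hlift k th t - 2 * pi * j%:~R <= v - e) ->
    forall x, u < x < v -> hder k th x * hil u v (hlift k th x) <= q * hil u v x.
Proof.
move=> uv vu e0; have [q [q01 Hq]] := hil_shrink uv vu e0.
exists q; split => // th k j k0 T x /andP[ux xv].
have q0 : 0 < q by case/andP: q01.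
have Tu := T u ltac:(lra); have Tv := T v ltac:(lra).
move: Tu Tv; rewrite -[hil u v (hlift _ _ _)](hilDint _ _ _ (- j)) mulrNz mulrN.
rewrite /hlift /hder; case: eqP => [kd|_] /andP[Tu1 Tu2] /andP[Tv1 Tv2].
  have d0 : (0 < d)%N by rewrite -kd.
  have h1 : flift d th v < flift d th x by rewrite flift_lt.
  have h2 : flift d th x < flift d th u by rewrite flift_lt.
  have := Hq (flift d th v - 2 * pi * j%:~R) (flift d th u - 2 * pi * j%:~R)
    (flift d th x - 2 * pi * j%:~R) ltac:(lra) ltac:(lra) ltac:(lra) ltac:(lra).
  rewrite hil_shift => h.
  have G0 : 0 <= d%:R * gder x by rewrite mulr_ge0 // ltW // gder_gt0.
  apply: (le_trans (ler_wpM2l G0 h)); rewrite mulrCA ler_pM2l // mulrC.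
  by apply: (hil_flift d0 ux xv _).1; lra.
have h1 : flift k th v < flift k th x by rewrite flift_lt.
have h2 : flift k th x < flift k th u by rewrite flift_lt.
have h3 : flift 1 th (flift k th u) < flift 1 th (flift k th x) by rewrite flift_lt.
have h4 : flift 1 th (flift k th x) < flift 1 th (flift k th v) by rewrite flift_lt.
(* The intermediate arc is shorter than a turn because its image under f_1 is, a property that [phi]
   preserves in both directions. *)
have h5 : flift k th u - flift k th v < 2 * pi.
  rewrite -(phi_lt2pi b1).
  have -> : phi (flift k th u) - phi (flift k th v) =
    flift 1 th (flift k th v) - flift 1 th (flift k th u).
    by rewrite [flift 1 _ _]/flift [flift 1 _ (flift k th u)]/flift !mul1r; ring.
  lra.
have := Hq (flift 1 th (flift k th u) - 2 * pi * j%:~R)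
    (flift 1 th (flift k th v) - 2 * pi * j%:~R)
    (flift 1 th (flift k th x) - 2 * pi * j%:~R)
    ltac:(lra) ltac:(lra) ltac:(lra) ltac:(lra).
rewrite hil_shift => h.
set G := gder (flift k th x) in h *; set K := k%:R * gder x.
have G0 : 0 < G by rewrite gder_gt0.
have K0 : 0 < K by rewrite mulr_gt0 ?ltr0n // gder_gt0.
have GK0 : 0 <= G * K by rewrite mulr_ge0 // ltW.
apply: (le_trans (ler_wpM2l GK0 h)); rewrite mulrCA ler_pM2l //.
have := (hil_flift k0 ux xv h5).1; rewrite -/K.
have := (@hil_flift 1 th _ _ _ isT h1 h2 _).1; rewrite mul1r -/G.
move=> /(_ ltac:(lra)) A B.
apply: le_trans B; rewrite mulrC mulrA ler_pM2r //.
Qed.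

Definition in_arc u v x := exists j : int, u <= x - 2 * pi * j%:~R <= v.

(** [S] is the set of allowed indices: d alone for the iterates of f_d, and 1, ..., d for the
    sequences of [Omega]. One j serves the whole arc, so its image stays in a single lift of the
    shrunk arc. *)
Definition trapped (S : nat -> Prop) u v e th := forall k, S k -> (0 < k <= d)%N /\
  exists j : int, forall t, u <= t <= v ->
    u + e <= hlift k th t - 2 * pi * j%:~R <= v - e.

Lemma trapped_in_arc S u v e th k x : trapped S u v e th -> S k ->
  in_arc u v x -> in_arc (u + e) (v - e) (hlift k th x).
Proof.
move=> T Sk [j jx]; have [_ [i Ti]] := T _ Sk.
have [j' E] := hliftDint k th (x - 2 * pi * j%:~R) j.
rewrite subrK in E; exists (i + j'); rewrite E intrD.
have -> y : y + 2 * pi * j'%:~R - 2 * pi * (i%:~R + j'%:~R) = y - 2 * pi * i%:~R :> R.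
  by ring.
exact: Ti.
Qed.

Lemma in_arcW u v e x : 0 < e -> in_arc (u + e) (v - e) x -> in_arc u v x.
Proof. by move=> e0 [j /andP[h1 h2]]; exists j; lra. Qed.

Lemma hil_orbit u v e : u < v -> v - u < 2 * pi -> 0 < e ->
  exists q, 0 < q < 1 /\ forall S th w x, trapped S u v e th ->
    (forall n, S (w n)) -> in_arc (u + e) (v - e) x ->
    (forall n, in_arc (u + e) (v - e) (hliftn w th n x)) /\
    (forall n, hder (w n) th (hliftn w th n x) * hil u v (hliftn w th n.+1 x)
       <= q * hil u v (hliftn w th n x)).
Proof.
move=> uv vu e0; have [q [q01 Hq]] := hil_hlift uv vu e0.
exists q; split => // S th w x T Sw ax.
have A n : in_arc (u + e) (v - e) (hliftn w th n x).
  elim: n => [//|n IH] /=; apply: trapped_in_arc T (Sw n) _.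
  exact: in_arcW IH.
split=> // n /=; have [j jA] := A n.
have [/andP[k0 _] [i Ti]] := T _ (Sw n).
have := Hq th (w n) i k0 Ti (hliftn w th n x - 2 * pi * j%:~R) ltac:(lra).
have [j' E] := hliftDint (w n) th (hliftn w th n x) (- j).
move: E; rewrite mulrNz mulrN => ->.
have := hderDint (w n) th (hliftn w th n x) (- j); rewrite mulrNz mulrN => ->.
have := hilDint u v (hliftn w th n x) (- j); rewrite mulrNz mulrN => ->.
by rewrite hilDint.
Qed.

(** The inequalities of [hil_orbit] telescope, so derivative times density is at most q^n times the
    initial density. As the density never drops below sin ((v - u) / 2), the derivative itself
    decays. *)
Lemma hdern_orbit u v e : u < v -> v - u < 2 * pi -> 0 < e ->
  exists q, 0 < q < 1 /\ forall S th w x, trapped S u v e th ->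
    (forall n, S (w n)) -> in_arc (u + e) (v - e) x ->
    forall n, hdern w th n x <= q ^+ n * (hil u v x / sin ((v - u) / 2)).
Proof.
move=> uv vu e0; have [q [q01 Hq]] := hil_orbit uv vu e0.
have q0 : 0 < q by case/andP: q01.
exists q; split => // S th w x T Sw ax n.
have [A B] := Hq S th w x T Sw ax.
have w0 m : (0 < w m)%N by have [/andP[]] := T _ (Sw m).
have s0 : 0 < sin ((v - u) / 2) by rewrite sin_half_gt0 //; lra.
have h m : sin ((v - u) / 2) <= hil u v (hliftn w th m x).
  have [j jA] := A m; rewrite -(hilDint _ _ _ (- j)) mulrNz mulrN.
  by apply: hil_ge; lra.
suff I : hdern w th n x * hil u v (hliftn w th n x) <= q ^+ n * hil u v x.
  rewrite mulrA ler_pdivlMr //; apply: le_trans I.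
  by rewrite ler_pM2l // hdern_gt0.
elim: n => [|n IH]; first by rewrite expr0 !mul1r.
rewrite [hdern _ _ _ _]/=.
have D0 := hdern_gt0 th n x w0.
rewrite mulrAC; apply: (le_trans (ler_wpM2r (ltW D0) (B n))).
by rewrite mulrAC exprS -!mulrA ler_pM2l // mulrC.
Qed.

End Orbits.

(** * The unit circle in the angle coordinate *)

Section Circle.
Variable R : realType.
Implicit Types (s t x y : R) (z w : R[i]).

Lemma sqr_normcE z : normc z ^+ 2 = complex.Re z ^+ 2 + complex.Im z ^+ 2.
Proof. by case: z => x y /=; rewrite sqr_sqrtr // addr_ge0 ?sqr_ge0. Qed.

Lemma normc_ge0 z : 0 <= normc z.
Proof. by case: z => x y /=; exact: sqrtr_ge0. Qed.

Lemma normc_eq0 z : (normc z == 0) = (z == 0).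
Proof.
by apply/eqP/eqP => [/eq0_normc//|->]; rewrite normc0.
Qed.

Lemma normc_gt0 z : (0 < normc z) = (z != 0).
Proof. by rewrite lt0r normc_eq0 normc_ge0 andbT. Qed.

Lemma normcX z n : normc (z ^+ n) = normc z ^+ n.
Proof. by elim: n => [|n IH]; rewrite ?expr0 ?normc1 // !exprS normcM IH. Qed.

Lemma normcR x : normc x%:C = `|x|.
Proof. by rewrite /= expr0n addr0 sqrtr_sqr. Qed.

Lemma normc_distC z w : normc (z - w) = normc (w - z).
Proof. by rewrite -normcN opprB. Qed.

Lemma normc_nat n : normc (n%:R : R[i]) = n%:R.
Proof. by rewrite -[n%:R]/(1 *+ n) normcMn normc1. Qed.

Lemma normc_le_add z w : normc z <= normc (z - w) + normc w.
Proof. by rewrite -[X in normc X <= _](subrK w z) le_normcD. Qed.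

Lemma expiD s t : expi (s + t) = expi s * expi t.
Proof.
by rewrite /expi sinD cosD; apply/eqP; rewrite eq_complex /= eqxx addrC eqxx.
Qed.

Lemma expi0 : expi (0 : R) = 1.
Proof. by rewrite /expi sin0 cos0. Qed.

Lemma normc_expi t : normc (expi t) = 1.
Proof. by rewrite /= cos2Dsin2 sqrtr1. Qed.

Lemma expi_neq0 t : expi t != 0.
Proof. by rewrite -normc_gt0 normc_expi. Qed.

Lemma expiMn t n : expi t ^+ n = expi (n%:R * t).
Proof.
elim: n => [|n IH]; first by rewrite mul0r expi0.
by rewrite exprS IH -expiD -natr1 mulrDl mul1r addrC.
Qed.

Lemma expiDint t (j : int) : expi (t + 2 * pi * j%:~R) = expi t.
Proof. by rewrite /expi cosDint sinDint. Qed.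

Lemma sqr_normc_expiB x y :
  normc (expi x - expi y) ^+ 2 = 4 * sin ((x - y) / 2) ^+ 2.
Proof.
rewrite sqr_normcE /= sin_half_sqr cosB.
have := cos2Dsin2 x; have := cos2Dsin2 y => h1 h2.
have -> : (cos x - cos y) ^+ 2 + (sin x - sin y) ^+ 2 =
  (cos x ^+ 2 + sin x ^+ 2) + (cos y ^+ 2 + sin y ^+ 2)
  - 2 * (cos x * cos y + sin x * sin y) by ring.
by rewrite h1 h2; field.
Qed.

Lemma circle_expi z : normc z = 1 -> exists t, - pi < t <= pi /\ z = expi t.
Proof.
move=> z1; have := sqr_normcE z; rewrite z1 expr1n.
case: z z1 => a c _ /= E.
have p0 := @pi_gt0 R.
have a1 : -1 <= a <= 1.
  by rewrite -ler_norml -(@ler_pXn2r _ 2) ?nnegrE // expr1n real_normK ?num_real //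
     E lerDl sqr_ge0.
have A : acos a \in `[0, pi] by rewrite in_itv /= acos_ge0 // acos_lepi.
have sE : sin (acos a) = `|c|.
  by rewrite sin_acos // -sqrtr_sqr E [a ^+ 2 + _]addrC addrK.
have [c0|c0] := leP 0 c.
  exists (acos a); split.
    by move: A; rewrite in_itv /=; lra.
  by rewrite /expi sE ger0_norm // acosK.
have a2 : acos a < pi.
  rewrite acos_ltpi //; case/andP: a1 => a1 ->; rewrite andbT lt_neqAle a1 andbT.
  apply: contra_ltN c0 => /eqP a0; move: E; rewrite -a0 sqrrN expr1n => E.
  have /eqP : c ^+ 2 = 0 by lra.
  by rewrite sqrf_eq0 => /eqP ->.
exists (- acos a); split.
  by move: A; rewrite in_itv /=; lra.
by rewrite /expi sinN cosN sE ltr0_norm // acosK ?opprK.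
Qed.

Lemma expi_inj s t : expi s = expi t -> exists j : int, s = t + 2 * pi * j%:~R.
Proof.
have p0 := @pi_gt0 R; move=> E.
pose j := Num.floor ((s - t) / (2 * pi)).
have := real_floor_itv (num_real ((s - t) / (2 * pi))).
rewrite -/j ler_pdivlMr ?ltr_pdivrMr; [|lra|lra] => /andP[h1 h2].
exists j; rewrite intrD mulrDl mul1r in h2.
have : normc (expi s - expi (t + 2 * pi * j%:~R)) ^+ 2 = 0.
  by rewrite expiDint E subrr normc0 expr0n.
rewrite sqr_normc_expiB => /eqP.
rewrite mulf_eq0 pnatr_eq0 /= sqrf_eq0 => /eqP S.
apply/eqP; rewrite -subr_eq0; apply/negPn/negP => N.
have : 0 < sin ((s - (t + 2 * pi * j%:~R)) / 2).
  by apply: sin_half_gt0; [rewrite lt0r N /=|]; lra.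
by rewrite S ltxx.
Qed.

End Circle.

Section CircleDynamics.
Variables (R : realType) (d : nat) (b : R).
Hypothesis b1 : 1 < b.
Implicit Types (s t x y th : R) (z w : R[i]).

Lemma mobius_den_expi t : b%:C * expi t + 1 != 0.
Proof.
rewrite -normc_gt0; apply: (@lt_le_trans _ _ (b - 1)); first by move: b1; lra.
have := normc_le_add (b%:C * expi t) (- 1).
rewrite opprK normcM normcR normc_expi normcN normc1 ger0_norm; move: b1; lra.
Qed.

Lemma sqr_normc_den_expi t : normc (b%:C * expi t + 1) ^+ 2 = nrm2 b t.
Proof.
rewrite sqr_normcE /expi /=; simpc => /=.
by rewrite /nrm2 exprMn sin2cos2; ring.
Qed.

(** On the circle b z + 1 is z times the conjugate of z + b, so the image of e^(i t) is e^(- i t)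
    e^(2 i psi t). *)
Lemma mobius_expi t : mobius b (Some (expi t)) = Some (expi (- phi b t)).
Proof.
rewrite /= (negPf (mobius_den_expi t)); congr Some.
apply: (canLR (mulfK (mobius_den_expi t))).
have E y : expi y + b%:C = (nrm b y)%:C * expi (psi b y).
  have n0 : nrm b y != 0 by rewrite gt_eqF // nrm_gt0.
  rewrite /expi cos_psi // sin_psi //; simpc; apply/eqP; rewrite eq_complex /=.
  by apply/andP; split; apply/eqP; field.
have -> : b%:C * expi t + 1 = expi t * (expi (- t) + b%:C).
  by rewrite mulrDr -expiD subrr expi0 mulrC addrC.
have P : psi b (- t) = - psi b t by rewrite /psi sinN cosN mulNr atanN.
rewrite !E P.
have -> : nrm b (- t) = nrm b t by rewrite /nrm /nrm2 cosN.
rewrite mulrA -expiD mulrCA -expiD.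
by congr (_ * expi _); rewrite /phi; ring.
Qed.

End CircleDynamics.

(** * Complex derivatives along the circle *)

Section UniformDerivative.
Variable R : realType.
Implicit Types (s t x y th e : R) (z w u : R[i]).

(* [F] maps the circle to itself by [expi t |-> expi (H t)], with complex
   derivative [D t] at [expi t], uniformly in t. *)
Definition udiff (F : sphere R -> sphere R) (H : R -> R) (D : R -> R[i]) :=
  forall e, 0 < e -> exists r, 0 < r /\ forall t u, normc (u - expi t) <= r ->
    exists v, F (Some u) = Some v /\
      normc (v - expi (H t) - D t * (u - expi t)) <= e * normc (u - expi t).

(** Only the modulus g of the derivative is recorded. Its boundedness is what lets uniform estimates
    compose. *)
Definition has_uderiv F H (g : R -> R) := exists D, udiff F H D /\
  (forall t, normc (D t) = g t) /\ exists M, forall t, g t <= M.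

Lemma udiff_at F H D t : udiff F H D -> F (Some (expi t)) = Some (expi (H t)).
Proof.
move=> /(_ 1 ltr01) [r [r0 /(_ t (expi t))]]; rewrite subrr normc0 mulr0.
move=> /(_ (ltW r0)) [v [-> /=]]; rewrite mulr0 subr0 => h.
by congr Some; apply/eqP; rewrite -subr_eq0 -normc_eq0 eq_le h normc_ge0.
Qed.

Lemma udiff_sderiv F H D t : udiff F H D -> sderiv F (Some (expi t)) = D t.
Proof.
move=> uF; rewrite /sderiv /derive1; apply: cvg_lim => //.
apply/cvgrPdist_le => /= e e0.
(* In the order of [R[i]] a positive number is real. *)
have eR : (complex.Re e)%:C = e by rewrite RRe_real // gtr0_real.
have e0' : 0 < complex.Re e by rewrite -ltcR eR.
have [r [r0 Hr]] := uF _ e0'.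
near=> h.
have h0 : h != 0 by near: h; exact: nbhs_dnbhs_neq.
have hr : normc (h + expi t - expi t) <= r.
  rewrite addrK -lecR; near: h; apply: dnbhs0_le => //.
  by rewrite ltcR.
have [v [-> /=]] := Hr t (h + expi t) hr.
rewrite (udiff_at t uF) /= addrK => hv.
rewrite -eR (_ : `|_| = (normc (D t - h^-1 *: (v - expi (H t))))%:C) // lecR.
have hn : 0 < normc h by rewrite normc_gt0.
have -> : D t - h^-1 *: (v - expi (H t)) = - (h^-1 * (v - expi (H t) - D t * h)).
  by rewrite -[_ *: _]/(h^-1 * _); field.
by rewrite normcN normcM normcV mulrC ler_pdivrMr.
Unshelve. all: by end_near. Qed.

Lemma udiff_comp F G H K D E M N : udiff F H D -> udiff G K E ->
  (forall t, normc (D t) <= M) -> (forall t, normc (E t) <= N) ->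
  udiff (G \o F) (K \o H) (fun t => E (H t) * D t).
Proof.
move=> uF uG DM EN e e0.
have M0 : 0 <= M by apply: le_trans (DM 0); exact: normc_ge0.
have N0 : 0 <= N by apply: le_trans (EN 0); exact: normc_ge0.
(* With n = |u - e^(i t)|, the errors of G and of F contribute at most e2 (M + 1) n and N e1 n, each
   at most e n / 2. The bound e1 <= 1 makes F Lipschitz with constant M + 1. *)
pose e1 := Num.min 1 (e / (2 * (N + 1))).
have e10 : 0 < e1 by rewrite lt_min ltr01 divr_gt0 //; lra.
pose e2 := e / (2 * (M + 1)).
have e20 : 0 < e2 by rewrite divr_gt0 //; lra.
have [r1 [r10 H1]] := uF _ e10; have [r2 [r20 H2]] := uG _ e20.
exists (Num.min r1 (r2 / (M + 1))); split.
  by rewrite lt_min r10 divr_gt0 //; lra.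
move=> t u; rewrite le_min ler_pdivlMr; last lra.
move=> /andP[ur1 ur2]; have [v [Fv hv]] := H1 t u ur1.
set n := normc (u - expi t) in ur1 ur2 hv *.
have n0 : 0 <= n by exact: normc_ge0.
have hv1 : normc (v - expi (H t)) <= (M + 1) * n.
  apply: (le_trans (normc_le_add _ (D t * (u - expi t)))).
  rewrite normcM -/n mulrDl mul1r addrC; apply: lerD; first exact: ler_wpM2r.
  by apply: (le_trans hv); rewrite ler_piMl // ge_min lexx.
have [w [Gw hw]] := H2 (H t) v ltac:(rewrite mulrC in ur2; exact: le_trans hv1 ur2).
exists w; split; first by rewrite /= Fv.
have -> : w - expi ((K \o H) t) - E (H t) * D t * (u - expi t) =
  (w - expi (K (H t)) - E (H t) * (v - expi (H t))) +
  E (H t) * (v - expi (H t) - D t * (u - expi t)) by rewrite /=; ring.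
apply: (le_trans (le_normcD _ _)); rewrite normcM.
have A : e2 * normc (v - expi (H t)) <= e / 2 * n.
  apply: (le_trans (ler_wpM2l (ltW e20) hv1)).
  by rewrite /e2 le_eqVlt; apply/orP; left; apply/eqP; field; lra.
have B : normc (E (H t)) * normc (v - expi (H t) - D t * (u - expi t)) <= e / 2 * n.
  apply: (@le_trans _ _ (N * (e1 * n))).
    by apply: ler_pM; rewrite ?normc_ge0.
  rewrite mulrA ler_wpM2r //; apply: (@le_trans _ _ ((N + 1) * (e / (2 * (N + 1))))).
    apply: ler_pM => //; [exact: ltW|lra|by rewrite ge_min lexx orbT].
  by rewrite le_eqVlt; apply/orP; left; apply/eqP; field; lra.
lra.
Qed.

Lemma has_uderiv_comp F G H K g k : has_uderiv F H g -> has_uderiv G K k ->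
  has_uderiv (G \o F) (K \o H) (fun t => k (H t) * g t).
Proof.
move=> [D [uF [Dg [M gM]]]] [E [uG [Ek [N kN]]]].
exists (fun t => E (H t) * D t); split.
  by apply: (@udiff_comp _ _ _ _ _ _ M N) => // t; rewrite ?Dg ?Ek.
split=> [t|]; first by rewrite normcM Ek Dg.
exists (N * M) => t; apply: ler_pM => //; rewrite -?Ek -?Dg; exact: normc_ge0.
Qed.

Lemma has_uderiv_id : has_uderiv id id (fun=> 1).
Proof.
exists (fun=> 1); split; last by split; [move=> t; exact: normc1|exists 1].
move=> e e0; exists 1; split => // t u _; exists u; split => //.
by rewrite mul1r subrr normc0 mulr_ge0 ?normc_ge0 // ltW.
Qed.

End UniformDerivative.

Section MapsDerivative.
Variables (R : realType) (d : nat) (b : R).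
Hypothesis b1 : 1 < b.
Implicit Types (s t x y th e : R) (z u : R[i]) (w : nat -> nat).

Lemma has_uderiv_mobius : has_uderiv (mobius b) (fun t => - phi b t) (gder b).
Proof.
have b0 : 0 < b - 1 by move: b1; lra.
exists (fun t => (1 - b ^+ 2)%:C / (b%:C * expi t + 1) ^+ 2); split; last first.
  split; last by exists ((b + 1) / (b - 1)) => t; exact: gder_le_max.
  move=> t; rewrite normcM normcV normcX sqr_normc_den_expi // normcR /gder.
  by rewrite ler0_norm ?opprB // -opprB oppr_le0 ltW // b2m1_gt0.
(* With x = e^(i t), the linearization error is - (1 - b^2) b (u - x)^2 / ((b x + 1)^2 (b u + 1)).
   Here |b x + 1| >= b - 1, and |b u + 1| >= (b - 1) / 2 once |u - x| <= (b - 1) / (2 b). *)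
pose M := (b ^+ 2 - 1) * b * 2 / (b - 1) ^+ 3.
have M0 : 0 < M.
  by rewrite divr_gt0 ?exprn_gt0 // !pmulr_lgt0 ?b2m1_gt0 //; move: b1; lra.
move=> e e0; exists (Num.min (e / M) ((b - 1) / (2 * b))); split.
  by rewrite lt_min; apply/andP; split; apply: divr_gt0 => //; move: b1; lra.
move=> t u; rewrite le_min => /andP[].
rewrite ler_pdivlMr // ler_pdivlMr; last by move: b1; lra.
set n := normc _ => h1 h2.
have B1 : b - 1 <= normc (b%:C * expi t + 1).
  have := normc_le_add (b%:C * expi t) (- 1).
  rewrite opprK normcM normcR normc_expi normcN normc1 ger0_norm; move: b1; lra.
have B2 : (b - 1) / 2 <= normc (b%:C * u + 1).
  have := normc_le_add (b%:C * expi t + 1) (b%:C * u + 1).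
  have -> : b%:C * expi t + 1 - (b%:C * u + 1) = - (b%:C * (u - expi t)) by ring.
  rewrite normcN normcM normcR ger0_norm -/n; move: b1; lra.
have N1 : b%:C * expi t + 1 != 0 by exact: mobius_den_expi.
have N2 : b%:C * u + 1 != 0 by rewrite -normc_gt0; lra.
exists ((u + b%:C) / (b%:C * u + 1)); split; first by rewrite /= (negPf N2).
have := mobius_expi b1 t; rewrite /= (negPf N1) => /Some_inj <-.
have -> : (u + b%:C) / (b%:C * u + 1) - (expi t + b%:C) / (b%:C * expi t + 1) -
  (1 - b ^+ 2)%:C / (b%:C * expi t + 1) ^+ 2 * (u - expi t) =
  - ((1 - b ^+ 2)%:C * b%:C * (u - expi t) ^+ 2 /
    ((b%:C * expi t + 1) ^+ 2 * (b%:C * u + 1))).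
  have -> : (1 - b ^+ 2)%:C = 1 - b%:C ^+ 2 by rewrite rmorphB rmorphXn rmorph1.
  move: (expi t) (b%:C) N1 N2 => x c N1 N2.
  by field; apply/andP.
rewrite normcN !(normcX, normcV, normcM) !normcR -/n.
have -> : `|1 - b ^+ 2| = b ^+ 2 - 1.
  by rewrite ler0_norm ?opprB // -opprB oppr_le0 ltW // b2m1_gt0.
rewrite (ger0_norm (_ : 0 <= b)); last by move: b1; lra.
apply: (@le_trans _ _ (M * n * n)); last first.
  by rewrite ler_wpM2r ?normc_ge0 // mulrC.
have -> : M * n * n = (b ^+ 2 - 1) * b * n ^+ 2 / ((b - 1) ^+ 2 * ((b - 1) / 2)).
  by rewrite /M; field; rewrite gt_eqF.
have P : 0 < (b - 1) ^+ 2 * ((b - 1) / 2) by rewrite mulr_gt0 ?exprn_gt0 //; lra.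
apply: ler_wpM2l.
  by apply: mulr_ge0 (sqr_ge0 _); apply: mulr_ge0; [exact: ltW (b2m1_gt0 b1)|move: b1; lra].
rewrite lef_pV2 ?posrE //.
  apply: ler_pM => //; [exact: sqr_ge0|lra|].
  by rewrite ler_pXn2r ?nnegrE ?normc_ge0 // ltW.
by rewrite mulr_gt0 ?exprn_gt0 // normc_gt0.
Qed.

Lemma expr_remainder k : exists C : R, 0 < C /\ forall x u : R[i], normc x = 1 ->
  normc (u - x) <= 1 ->
  normc (u ^+ k - x ^+ k - k%:R * x ^+ k.-1 * (u - x)) <= C * normc (u - x) ^+ 2.
Proof.
elim: k => [|k [C [C0 IH]]].
  exists 1; split => // x u _ _.
  by rewrite !expr0 subrr !mul0r subr0 normc0 mul1r sqr_ge0.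
(* The remainder for k + 1 is u times the one for k, plus k x^(k - 1) (u - x)^2; and |u| <= 2. *)
exists (2 * C + k%:R); split; first by rewrite ltr_pwDl // mulr_gt0.
move=> x u x1 ux.
have -> : u ^+ k.+1 - x ^+ k.+1 - k.+1%:R * x ^+ k.+1.-1 * (u - x) =
  u * (u ^+ k - x ^+ k - k%:R * x ^+ k.-1 * (u - x)) +
  k%:R * x ^+ k.-1 * (u - x) ^+ 2.
  case: k {IH} => [|k] /=; first by rewrite !expr1 !expr0; ring.
  by rewrite !exprS -!natr1; ring.
apply: (le_trans (le_normcD _ _)); rewrite [in leRHS]mulrDl; apply: lerD.
  rewrite normcM -[in leRHS]mulrA; apply: ler_pM (IH _ _ x1 ux); rewrite ?normc_ge0 //.
  by apply: (le_trans (normc_le_add _ x)); rewrite x1; lra.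
by rewrite !normcM !normcX x1 expr1n mulr1 normc_nat.
Qed.

Lemma has_uderiv_pow k th : has_uderiv (omap (fun u => expi th * u ^+ k))
  (fun t => th + k%:R * t) (fun=> k%:R).
Proof.
exists (fun t => expi th * k%:R * expi t ^+ k.-1); split; last first.
  split=> [t|]; last by exists k%:R.
  by rewrite !normcM normcX !normc_expi expr1n mulr1 mul1r normc_nat.
have [C [C0 HC]] := expr_remainder k.
move=> e e0; exists (Num.min 1 (e / C)); split; first by rewrite lt_min ltr01 divr_gt0.
move=> t u; rewrite le_min ler_pdivlMr // => /andP[h1 h2].
exists (expi th * u ^+ k); split => //.
rewrite expiD -expiMn.
have -> : expi th * u ^+ k - expi th * expi t ^+ k -
   expi th * k%:R * expi t ^+ k.-1 * (u - expi t) =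
   expi th * (u ^+ k - expi t ^+ k - k%:R * expi t ^+ k.-1 * (u - expi t)) by ring.
rewrite normcM normc_expi mul1r; apply: (le_trans (HC _ _ (normc_expi t) h1)).
by rewrite expr2 mulrA ler_wpM2r ?normc_ge0 // mulrC.
Qed.

Lemma has_uderiv_fpow k th :
  has_uderiv (fpow b k (expi th)) (flift b k th) (fun t => k%:R * gder b t).
Proof.
have := has_uderiv_comp has_uderiv_mobius (has_uderiv_pow k th).
rewrite (_ : (fun t => th + k%:R * t) \o (fun t => - phi b t) = flift b k th) //.
by apply/funext => t; rewrite /flift /= mulrN.
Qed.

Lemma has_uderiv_fhat k th :
  has_uderiv (fhat d b k (expi th)) (hlift d b k th) (hder d b k th).
Proof.
rewrite /fhat /hlift /hder; case: eqP => _; first exact: has_uderiv_fpow.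
have := has_uderiv_comp (has_uderiv_fpow k th) (has_uderiv_fpow 1 th).
by under [X in has_uderiv _ _ X]eq_fun do rewrite mul1r.
Qed.

Lemma has_uderiv_fhatn w th n :
  has_uderiv (fhatn d b w (expi th) n) (hliftn d b w th n) (hdern d b w th n).
Proof.
elim: n => [|n IH]; first exact: has_uderiv_id.
exact: (has_uderiv_comp IH (has_uderiv_fhat (w n) th)).
Qed.

Lemma fpow_expi k th t :
  fpow b k (expi th) (Some (expi t)) = Some (expi (flift b k th t)).
Proof. by have [D [uF _]] := has_uderiv_fpow k th; exact: udiff_at uF. Qed.

Lemma normc_sderiv_fhatn w th n t :
  normc (sderiv (fhatn d b w (expi th) n) (Some (expi t))) = hdern d b w th n t.
Proof.
have [D [uF [<- _]]] := has_uderiv_fhatn w th n.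
by rewrite (udiff_sderiv t uF).
Qed.

Lemma normc_sderiv_fpow k th t :
  normc (sderiv (fpow b k (expi th)) (Some (expi t))) = k%:R * gder b t.
Proof.
have [D [uF [<- _]]] := has_uderiv_fpow k th.
by rewrite (udiff_sderiv t uF).
Qed.

End MapsDerivative.

(** * Criteria for normality *)

Section SphereTopology.
Variable R : realType.
Implicit Types (s t x y th e r : R) (z u : R[i]).

Lemma nbhs_normc z (A : set R[i]) :
  nbhs z A <-> exists2 r : R, 0 < r & forall u, normc (u - z) < r -> A u.
Proof.
split => [/nbhs_normP[e /= e0 H]|[r r0 H]].
  have eR : (complex.Re e)%:C = e by rewrite RRe_real // gtr0_real.
  exists (complex.Re e); first by rewrite -ltcR eR.
  by move=> u h; apply: H; rewrite /= -eR distrC (_ : `|_| = (normc (u - z))%:C) // ltcR.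
apply/nbhs_normP; exists r%:C; first by rewrite /= ltcR.
move=> u /= h; apply: H; move: h.
by rewrite distrC (_ : `|_| = (normc (u - z))%:C) // ltcR.
Qed.

Lemma sphere_nbhs z (A : set (sphere R)) :
  nbhs (Some z : sphere R) A <->
  exists2 r : R, 0 < r & forall u, normc (u - z) < r -> A (Some u).
Proof. exact: (nbhs_normc z (Some @^-1` A)). Qed.

Lemma open_normc_ball z r : open [set u | normc (u - z) < r].
Proof.
rewrite openE => u /= ur; apply/nbhs_normc; exists (r - normc (u - z)); first lra.
move=> v; rewrite ltrBrDr; apply: le_lt_trans.
have -> : v - z = (v - u) + (u - z) by ring.
exact: le_normcD.
Qed.

Lemma open_sphere_ball z r : open [set (Some u : sphere R) | u in [set u | normc (u - z) < r]].
Proof. exact/one_point_compactification_open_some/open_normc_ball. Qed.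

Lemma normc_expiB x y : normc (expi x - expi y) = 2 * `|sin ((x - y) / 2)|.
Proof.
apply: (@pexpIrn _ 2) => //; rewrite ?nnegrE ?normc_ge0 ?mulr_ge0 //.
by rewrite sqr_normc_expiB exprMn real_normK ?num_real //; ring.
Qed.

Lemma near_expi x e : 0 < e -> \forall t \near x, normc (expi t - expi x) < e.
Proof.
move=> e0.
have C : (fun t => 2 * `|sin ((t - x) / 2)|) t @[t --> x] --> (0 : R).
  have -> : (0 : R) = 2 * `|sin ((x - x) / 2)| by rewrite subrr mul0r sin0 normr0 mulr0.
  apply: cvgM; first exact: cvg_cst.
  apply: cvg_norm; apply: (@continuous_comp _ _ _ (fun t => (t - x) / 2) sin).
    apply: cvgM; last exact: cvg_cst.
    by apply: cvgB; [exact: cvg_id|exact: cvg_cst].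
  exact: continuous_sin.
move/cvgr0Pnorm_lt : C => /(_ e e0); apply: filterS => t.
by rewrite ger0_norm ?mulr_ge0 // normc_expiB.
Qed.

Lemma continuous_expi : continuous (@expi R : R -> R[i]).
Proof.
move=> x A /nbhs_normc[r r0 H]; have := near_expi x r0.
by apply: filterS => t; exact: H.
Qed.

Lemma continuous_Some_expi : continuous (fun t : R => Some (expi t) : sphere R).
Proof. by move=> x A /sphere_nbhs/nbhs_normc h; exact: continuous_expi h. Qed.

Lemma closed_normc_ball r : closed [set u : R[i] | normc u <= r].
Proof.
rewrite -[X in closed X]setCK; apply: open_closedC; rewrite openE => u /= /negP.
rewrite -ltNge => ur; apply/nbhs_normc; exists (normc u - r); first lra.
move=> v h; apply/negP; rewrite -ltNge.
have := normc_le_add u v; rewrite normc_distC; lra.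
Qed.

Lemma compact_normc_ball r : compact [set u : R[i] | normc u <= r].
Proof.
pose f (p : R * R) : R[i] := p.1 +i* p.2.
have cf : continuous f.
  move=> p A /nbhs_normc[e e0 H].
  have : \forall q \near p, ball p (e / 2) q by apply: nbhsx_ballx; lra.
  apply: filterS => q [b1 b2].
  have h1 : `|p.1 - q.1| < e / 2 := b1; have h2 : `|p.2 - q.2| < e / 2 := b2.
  apply: H; rewrite /f; simpc.
  apply: (@le_lt_trans _ _ (`|p.1 - q.1| + `|p.2 - q.2|)); last lra.
  rewrite -(@ler_pXn2r _ 2) ?nnegrE ?normc_ge0 ?addr_ge0 // sqr_normcE /=.
  rewrite -(real_normK (num_real (q.1 - p.1))) -(real_normK (num_real (q.2 - p.2))).
  rewrite !(distrC _ p.1) !(distrC _ p.2).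
  have : 0 <= `|p.1 - q.1| * `|p.2 - q.2| by rewrite mulr_ge0.
  by move: `|p.1 - q.1| `|p.2 - q.2| => a c; nra.
apply: (@subclosed_compact _ _ (f @` (`[- r, r] `*` `[- r, r]))).
- exact: closed_normc_ball.
- apply: continuous_compact; first exact: continuous_subspaceT.
  by apply: compact_setX; exact: segment_compact.
move=> [x y] /= h; exists (x, y) => //=; rewrite !in_itv /= -!ler_norml.
by split; apply: le_trans h; rewrite -sqrtr_sqr ler_wsqrtr // ?lerDl ?lerDr sqr_ge0.
Qed.

(** For 0 < s < 1 these open sets exhaust the complement of the circle, infinity included. The ratio
    is chosen because |1 - |a|| / (1 + |a|) is a lower bound for the Poisson kernel at a, whatever
    the pole. *)
Definition off_circle s : set (sphere R) :=
  [set z | if z is Some a then s * (1 + normc a) < `|1 - normc a| else True].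

Lemma open_off_circle s : 0 < s < 1 -> open (off_circle s).
Proof.
move=> s01; rewrite openE => -[a|] /= h.
  apply/sphere_nbhs; exists ((`|1 - normc a| - s * (1 + normc a)) / 2); first lra.
  move=> u hu /=.
  have h1 : `|normc u - normc a| <= normc (u - a).
    rewrite ler_norml; have := normc_le_add u a; have := normc_le_add a u.
    by rewrite (normc_distC a); lra.
  have h2 : `|1 - normc a| <= `|1 - normc u| + `|normc u - normc a|.
    have -> : 1 - normc a = (1 - normc u) + (normc u - normc a) by ring.
    exact: ler_normD.
  have h3 : normc u - normc a <= normc (u - a) by apply: le_trans h1; exact: ler_norm.
  have : s * (normc u - normc a) <= normc (u - a).
    apply: (@le_trans _ _ (s * normc (u - a))); first by rewrite ler_pM2l //; lra.
    by rewrite ler_piMl ?normc_ge0 //; lra.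
  lra.
exists [set u : R[i] | normc u <= (1 + s) / (1 - s)].
  by split; [exact: compact_normc_ball|exact: closed_normc_ball].
move=> z [[u /= hu <-]|->] //=.
move/negP: hu; rewrite -ltNge ltr_pdivrMr; last lra.
move=> hu; rewrite ler0_norm; last by have := normc_ge0 u; nra.
lra.
Qed.

Lemma off_circleP (z : sphere R) : (forall t, z <> Some (expi t) :> sphere R) ->
  exists2 s, 0 < s < 1 & off_circle s z.
Proof.
case: z => [a|] h; last by exists (1 / 2) => //; lra.
have a1 : normc a != 1.
  by apply/eqP => /circle_expi[t [_ E]]; apply: (h t); rewrite E.
have a0 := normc_ge0 a.
have P : 0 < `|1 - normc a| by rewrite normr_gt0 subr_eq0 eq_sym.
have Q : `|1 - normc a| <= 1 + normc a.
  by rewrite ler_norml; lra.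
exists (`|1 - normc a| / (2 * (1 + normc a))).
  rewrite divr_gt0 //=; last lra.
  by rewrite ltr_pdivrMr; lra.
rewrite /off_circle /= mulrAC ltr_pdivrMr; last lra.
by nra.
Qed.

End SphereTopology.

Section Normality.
Variable R : realType.
Implicit Types (s t x y th e r : R) (z u : R[i]).

Lemma chordal_SomeE z u : normc u = 1 ->
  chordal (Some z) (Some u) ^+ 2 = 2 * normc (z - u) ^+ 2 / (1 + normc z ^+ 2).
Proof.
move=> u1; have h : 0 < 1 + normc z ^+ 2 by rewrite ltr_wpDr ?sqr_ge0.
rewrite /chordal u1 expr1n expr_div_n !exprMn (sqr_sqrtr (ltW h)) sqr_sqrtr //.
by field; rewrite gt_eqF.
Qed.

Lemma chordal_ge0 (z w : sphere R) : 0 <= chordal z w.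
Proof. by case: z w => [z|] [w|] //=; rewrite divr_ge0 ?mulr_ge0 ?normc_ge0 ?sqrtr_ge0. Qed.

Lemma chordal_le_normc z u : normc u = 1 ->
  chordal (Some z) (Some u) <= 2 * normc (z - u).
Proof.
move=> u1; rewrite -(@ler_pXn2r _ 2) ?nnegrE ?chordal_ge0 ?mulr_ge0 ?normc_ge0 //.
rewrite chordal_SomeE // ler_pdivrMr; last by rewrite ltr_wpDr ?sqr_ge0.
have := sqr_ge0 (normc (z - u)); have := sqr_ge0 (normc z).
rewrite exprMn; move: (normc _ ^+ 2) (normc _ ^+ 2) => A B; nra.
Qed.

Lemma chordal_triangle_circle (z : sphere R) u v : normc u = 1 -> normc v = 1 ->
  chordal z (Some v) <= chordal z (Some u) + 2 * normc (u - v).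
Proof.
move=> u1 v1; case: z => [z|]; last first.
  by rewrite /= u1 v1 lerDl mulr_ge0 ?normc_ge0.
have h : 0 < 1 + normc z ^+ 2 by rewrite ltr_wpDr ?sqr_ge0.
rewrite /chordal u1 v1 expr1n.
set A := Num.sqrt _ * Num.sqrt _.
have A1 : 1 <= A.
  rewrite -[1]mulr1; apply: ler_pM => //; rewrite -[leLHS]sqrtr1 ler_wsqrtr //.
    by rewrite lerDl sqr_ge0.
  lra.
have -> : 2 * normc (z - u) / A + 2 * normc (u - v) =
   (2 * normc (z - u) + A * (2 * normc (u - v))) / A by field; lra.
rewrite ler_pM2r ?invr_gt0; last lra.
have -> : z - v = (z - u) + (u - v) by ring.
have := le_normcD (z - u) (u - v); have := normc_ge0 (u - v).
nra.
Qed.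

Lemma subseq_choice (P : nat -> nat -> Prop) :
  (forall j N, exists n, (N <= n)%N /\ P j n) ->
  exists phi : nat -> nat, {homo phi : m n / (m < n)%N} /\ forall j, P j (phi j).
Proof.
move=> H; have /choice[f Hf] : forall p : nat * nat,
    exists n, (p.2 <= n)%N /\ P p.1 n by move=> [j N]; exact: H.
pose phi := fix phi j := if j is i.+1 then f (i.+1, (phi i).+1) else f (0, 0)%N.
exists phi; split.
  apply: homo_ltn; first exact: ltn_trans.
  by move=> i; exact: (Hf (i.+1, (phi i).+1)).1.
by case=> [|j]; [exact: (Hf (0, 0)%N).2|exact: (Hf (j.+1, (phi j).+1)).2].
Qed.

Lemma cluster_angle (a : nat -> R) (r : R) : (forall n, - r <= a n <= r) ->
  exists l, forall e, 0 < e -> forall N, exists n, (N <= n)%N /\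
    normc (expi (a n) - expi l) < e.
Proof.
move=> ar; have := @segment_compact R (- r) r.
move=> /(_ (a @ \oo) _) []; first by exists 0%N => // n _; rewrite /= in_itv; exact: ar.
move=> l [_ cl]; exists l => e e0 N.
have [|x [[n Nn <-] /= h]] := cl (a @` [set n | (N <= n)%N]) _ _ (near_expi l e0).
  by exists N => // n /= Nn; exists n.
by exists n.
Qed.

(** A sequence in the family either repeats one member infinitely often, which gives a constant
    subsequence, or has indices tending to infinity. In that case the points y n subconverge on the
    compact circle and the maps follow them, uniformly on U. *)
Lemma normal_on_contract (F : nat -> sphere R -> sphere R) (U : set (sphere R))
    (y : nat -> R) (e : nat -> R) n0 :
  (forall n (z : sphere R), (n0 <= n)%N -> U z -> chordal (F n z) (Some (expi (y n))) <= e n) ->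
  e @ \oo --> (0 : R) -> normal_on U (range F).
Proof.
move=> HF e0 u uF.
have /choice[nu Hnu] : forall n, exists m, F m = u n.
  by move=> n; have [m _ <-] := uF n; exists m.
have [[m Hm]|Hinf] := pselect (exists m, forall N, exists n, (N <= n)%N /\ nu n = m).
  have [phi [phi1 phi2]] := @subseq_choice (fun _ n => nu n = m) (fun _ => Hm).
  exists phi, (F m); split => // K _ _ r r0; exists 0%N => n _ z _.
  rewrite -Hnu phi2; apply: le_lt_trans r0.
  by case: (F m z) => [w|] //=; rewrite subrr normc0 mulr0 mul0r.
have Hinf' M : exists N, forall n, (N <= n)%N -> (M <= nu n)%N.
  elim: M => [|M [N IH]]; first by exists 0%N.
  have [N' HN'] : exists N', forall n, (N' <= n)%N -> nu n <> M.
    apply/not_existsP => H; apply: Hinf; exists M => N'.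
    have /existsNP[n /not_implyP[h1 /contrapT h2]] := H N'.
    by exists n.
  exists (maxn N N') => n; rewrite geq_max => /andP[h1 h2].
  by rewrite ltn_neqAle IH // andbT; apply/eqP => E; apply: (HN' n h2).
have /choice[a Ha] : forall n, exists t, - pi < t <= pi /\ expi (y (nu n)) = expi t.
  by move=> n; exact: circle_expi (normc_expi _).
have [|l Hl] := @cluster_angle a pi; first by move=> n; have := (Ha n).1; lra.
have [j N|phi [phi1 phi2]] := @subseq_choice (fun j n => (j <= nu n)%N /\
    normc (expi (a n) - expi l) < j.+1%:R^-1).
  have [N' HN'] := Hinf' j.
  have [|n [Nn hn]] := Hl (j.+1%:R^-1) _ (maxn N N'); first by rewrite invr_gt0 ltr0n.
  exists n; move: Nn; rewrite geq_max => /andP[h1 h2]; split => //; split => //.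
  exact: HN'.
exists phi, (fun=> Some (expi l)); split => // K _ KU r r0.
have [N1 _ HN1] : \forall n \near \oo, `|e n| < r / 2.
  by move/cvgr0Pnorm_lt: e0; apply; lra.
have [N2 _ HN2] : \forall n \near \oo, n.+1%:R^-1 < r / 4.
  apply: (near_infty_natSinv_lt (PosNum (_ : 0 < r / 4))); lra.
exists (maxn n0 (maxn N1 N2)) => n; rewrite !geq_max => /and3P[h0 h1 h2] z Kz.
have [p1 p2] := phi2 n.
apply: (le_lt_trans (chordal_triangle_circle _ (normc_expi (a (phi n))) (normc_expi _))).
rewrite -(Ha _).2 -Hnu.
have A := HF (nu (phi n)) z (leq_trans h0 p1) (KU z Kz).
have B := HN1 (nu (phi n)) (leq_trans h1 p1).
have C := HN2 n h2; rewrite /= in B C.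
have := ler_norm (e (nu (phi n))).
rewrite (Ha _).2 in A *.
have D := lt_trans p2 C; lra.
Qed.

End Normality.

(** * Poisson kernels and normality off the circle *)

Section Poisson.
Variables (R : realType) (d : nat) (b : R).
Hypothesis b1 : 1 < b.
Implicit Types (s t x th e r : R) (a u y : R[i]) (z : sphere R).

(* Poisson kernel of the disc, or of its exterior, with pole at the point y of
   the circle; 0 on the circle. *)
Definition pois z (y : R[i]) : R :=
  if z is Some a then `|1 - normc a ^+ 2| / normc (y - a) ^+ 2 else 1.

Lemma mobius_sqr_normc a :
  normc (b%:C * a + 1) ^+ 2 - normc (a + b%:C) ^+ 2 = (b ^+ 2 - 1) * (normc a ^+ 2 - 1).
Proof. by rewrite !sqr_normcE; case: a => p q /=; ring. Qed.

(** Conformal covariance of the Poisson kernel; both sides are in fact equal. The points infinity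
    and - 1/b, sent to 1/b and to infinity, are treated apart. *)
Lemma pois_mobius z t :
  pois z (expi t) <= gder b t * pois (mobius b z) (expi (- phi b t)).
Proof.
have B := b2m1_gt0 b1; have b0 : 0 < b by move: b1; lra.
have N1 := mobius_den_expi b1 t; set y := expi t in N1 *.
have Em : expi (- phi b t) = (y + b%:C) / (b%:C * y + 1).
  by apply: Some_inj; rewrite -mobius_expi //= (negPf N1).
have g : gder b t = (b ^+ 2 - 1) / normc (b%:C * y + 1) ^+ 2.
  by rewrite /gder sqr_normc_den_expi.
have D0 : 0 < normc (b%:C * y + 1) by rewrite normc_gt0.
have bC : b%:C != 0 :> R[i] by rewrite -normc_gt0 normcR gtr0_norm.
have nB : normc (1 - b%:C ^+ 2 : R[i]) = b ^+ 2 - 1.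
  rewrite -[1]/(1%:C) -rmorphXn -rmorphB normcR ler0_norm ?opprB //.
  by rewrite -opprB oppr_le0 ltW.
rewrite g Em; case: z => [a|]; last first.
  rewrite -[pois None y]/(1 : R) -[pois _ _]/(`|1 - normc (b^-1)%:C ^+ 2| /
    normc ((y + b%:C) / (b%:C * y + 1) - (b^-1)%:C) ^+ 2).
  have -> : (y + b%:C) / (b%:C * y + 1) - (b^-1)%:C =
     - ((1 - b%:C ^+ 2) / (b%:C * (b%:C * y + 1))).
    by rewrite fmorphV; field; apply/andP.
  rewrite normcN !(normcX, normcV, normcM) nB !normcR.
  rewrite (gtr0_norm b0) (gtr0_norm (_ : 0 < b^-1)) ?invr_gt0 //.
  have -> : `|1 - b^-1 ^+ 2| = (b ^+ 2 - 1) / b ^+ 2.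
    rewrite ger0_norm; first by field; rewrite gt_eqF.
    have -> : 1 - b^-1 ^+ 2 = (b ^+ 2 - 1) / b ^+ 2 by field; rewrite gt_eqF.
    by rewrite divr_ge0 ?sqr_ge0 ?ltW.
  rewrite le_eqVlt; apply/orP; left; apply/eqP; field.
  by rewrite !gt_eqF.
rewrite -[mobius b _]/(if b%:C * a + 1 == 0 then None
  else Some ((a + b%:C) / (b%:C * a + 1))).
case: eqP => [Ea|/eqP Na]; rewrite /pois.
  have -> : a = - (b%:C)^-1.
    by apply: (mulfI bC); rewrite mulrN divff //; apply/eqP; rewrite -addr_eq0 Ea.
  have -> : y - - (b%:C)^-1 = (b%:C * y + 1) / b%:C by field.
  rewrite !(normcX, normcN, normcV, normcM) normcR (gtr0_norm b0).
  have -> : `|1 - b^-1 ^+ 2| = (b ^+ 2 - 1) / b ^+ 2.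
    have -> : 1 - b^-1 ^+ 2 = (b ^+ 2 - 1) / b ^+ 2 by field; rewrite gt_eqF.
    by rewrite ger0_norm // divr_ge0 ?sqr_ge0 ?ltW.
  rewrite le_eqVlt; apply/orP; left; apply/eqP; field.
  by rewrite !gt_eqF.
have [->|ya] := eqVneq y a.
  by rewrite subrr normc0 expr0n invr0 mulr0 mulr_ge0 ?divr_ge0 ?sqr_ge0 // ltW.
have F0 : 0 < normc (y - a) by rewrite normc_gt0 subr_eq0.
have G0 : 0 < normc (b%:C * a + 1) by rewrite normc_gt0.
have -> : (y + b%:C) / (b%:C * y + 1) - (a + b%:C) / (b%:C * a + 1) =
  (1 - b%:C ^+ 2) * (y - a) / ((b%:C * y + 1) * (b%:C * a + 1)).
  by field; apply/andP.
rewrite !(normcX, normcV, normcM) nB.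
have -> : 1 - (normc (a + b%:C) / normc (b%:C * a + 1)) ^+ 2 =
  (b ^+ 2 - 1) * (normc a ^+ 2 - 1) / normc (b%:C * a + 1) ^+ 2.
  by rewrite -mobius_sqr_normc; field; rewrite gt_eqF.
rewrite !normrM (gtr0_norm B) normfV (ger0_norm (sqr_ge0 _)) distrC.
rewrite le_eqVlt; apply/orP; left; apply/eqP; field.
by rewrite !gt_eqF.
Qed.

Lemma sqr_sum_le (k : nat) (f : nat -> R) :
  (\sum_(i < k) f i) ^+ 2 <= k%:R * \sum_(i < k) f i ^+ 2.
Proof.
(* The sum of the (f i - y)^2 is nonnegative; y will be the mean of the f i. *)
have H (y : R) : 2 * y * \sum_(i < k) f i <= \sum_(i < k) f i ^+ 2 + k%:R * y ^+ 2.
  elim: k => [|k IH]; first by rewrite !big_ord0 !mul0r mulr0 addr0.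
  rewrite !big_ord_recr /= -natr1; have := sqr_ge0 (f k - y); nra.
case: k H => [|k] H; first by rewrite !big_ord0 expr0n mul0r.
have k0 : 0 < k.+1%:R :> R by rewrite ltr0n.
set S := \sum_(i < _) f i in H *; set Q := \sum_(i < _) _ in H *.
have := H (S / k.+1%:R); move: (k.+1%:R : R) k0 => K K0 h.
have : 2 * (S / K) * S * K <= (Q + K * (S / K) ^+ 2) * K by rewrite ler_pM2r.
have -> : 2 * (S / K) * S * K = 2 * S ^+ 2 by field; rewrite gt_eqF.
have -> : (Q + K * (S / K) ^+ 2) * K = K * Q + S ^+ 2 by field; rewrite gt_eqF.
lra.
Qed.

(** With r = |a|, |1 - r^(2k)| is |1 - r^2| times the sum of the r^(2i), and |y^k - a^k| is at most
    |y - a| times the sum of the r^i. Cauchy-Schwarz compares the two sums. *)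
Lemma pois_pow k th z y : (0 < k)%N -> normc y = 1 ->
  pois z y <= k%:R * pois (omap (fun u => expi th * u ^+ k) z) (expi th * y ^+ k).
Proof.
move=> k0 y1; case: z => [a|] /=; last by rewrite mulr1 ler1n.
have kp : 0 < k%:R :> R by rewrite ltr0n.
rewrite -mulrBr !normcM normc_expi !mul1r normcX.
set r := normc a; have r0 : 0 <= r by exact: normc_ge0.
(* If the powers agree, then |a| = 1 and both kernels vanish. *)
have [E|E] := eqVneq (y ^+ k) (a ^+ k).
  have : r ^+ k = 1 by rewrite -normcX -E normcX y1 expr1n.
  move/eqP; rewrite pexpr_eq1 // => /eqP ->.
  by rewrite !expr1n subrr normr0 !mul0r mulr0.
have ya : y != a by apply: contra_neq E => ->.
have F0 : 0 < normc (y - a) by rewrite normc_gt0 subr_eq0.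
have G0 : 0 < normc (y ^+ k - a ^+ k) by rewrite normc_gt0 subr_eq0.
rewrite ler_pdivrMr ?exprn_gt0 //.
rewrite [k%:R * (_ / _)]mulrA [_ / _ * _]mulrAC ler_pdivlMr ?exprn_gt0 //.
pose S := \sum_(i < k) r ^+ i; pose Q := \sum_(i < k) r ^+ i ^+ 2.
have hS : normc (y ^+ k - a ^+ k) <= normc (y - a) * S.
  rewrite subrXX normcM; apply: ler_wpM2l; first exact: normc_ge0.
  rewrite /S; elim/big_rec2: _ => [|i s1 s2 _ IH]; first by rewrite normc0.
  apply: (le_trans (le_normcD _ _)); apply: lerD IH.
  by rewrite normcM !normcX y1 expr1n mul1r.
have S0 : 0 <= S by apply: sumr_ge0 => i _; rewrite exprn_ge0.
have hQ : 1 - r ^+ k ^+ 2 = (1 - r ^+ 2) * Q.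
  rewrite -exprM mulnC exprM -[X in X - _](expr1n _ k) subrXX; congr (_ * _).
  by apply: eq_bigr => i _; rewrite expr1n mul1r -!exprM mulnC.
have Q0 : 0 <= Q by apply: sumr_ge0 => i _; exact: sqr_ge0.
rewrite hQ normrM (ger0_norm Q0).
apply: (@le_trans _ _ (`|1 - r ^+ 2| * ((normc (y - a) * S) ^+ 2))).
  by apply: ler_wpM2l => //; rewrite ler_pXn2r ?nnegrE ?normc_ge0 ?mulr_ge0 ?normc_ge0.
rewrite exprMn.
have -> : k%:R * (`|1 - r ^+ 2| * Q) * normc (y - a) ^+ 2 =
  `|1 - r ^+ 2| * (normc (y - a) ^+ 2 * (k%:R * Q)) by ring.
by rewrite !ler_wpM2l ?sqr_ge0 // sqr_sum_le.
Qed.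

Lemma pois_fpow k th z t : (0 < k)%N ->
  pois z (expi t) <= k%:R * gder b t * pois (fpow b k (expi th) z) (expi (flift b k th t)).
Proof.
move=> k0; apply: (le_trans (pois_mobius z t)).
rewrite [leRHS](_ : _ = gder b t * (k%:R *
  pois (fpow b k (expi th) z) (expi (flift b k th t)))); last by ring.
apply: ler_wpM2l; first exact: ltW (gder_gt0 b1 _).
have := pois_pow th (mobius b z) k0 (normc_expi (- phi b t)).
by rewrite expiMn -expiD /flift mulrN.
Qed.

Lemma pois_fhat k th z t : (0 < k)%N ->
  pois z (expi t) <= hder d b k th t * pois (fhat d b k (expi th) z) (expi (hlift d b k th t)).
Proof.
move=> k0; rewrite /fhat /hder /hlift; case: eqP => [kd|_].
  by apply: pois_fpow; rewrite -kd.
apply: (le_trans (pois_fpow th z t k0)).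
rewrite [leRHS](_ : _ = k%:R * gder b t * (gder b (flift b k th t) *
  pois ((fpow b 1 (expi th) \o fpow b k (expi th)) z)
    (expi (flift b 1 th (flift b k th t))))); last by ring.
apply: ler_wpM2l; first by apply: mulr_ge0 => //; exact: ltW (gder_gt0 b1 _).
by have := pois_fpow th (fpow b k (expi th) z) (flift b k th t) (isT : 0 < 1)%N; rewrite mul1r.
Qed.

Lemma pois_fhatn w th n z t : (forall m, (0 < w m)%N) ->
  pois z (expi t) <= hdern d b w th n t *
    pois (fhatn d b w (expi th) n z) (expi (hliftn d b w th n t)).
Proof.
move=> w0; elim: n => [|n IH]; first by rewrite /= mul1r.
apply: (le_trans IH); set D := hdern _ _ _ _ _ _; set P := pois _ _.
rewrite [leRHS](_ : _ = D * (hder d b (w n) th (hliftn d b w th n t) *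
  pois (fhatn d b w (expi th) n.+1 z) (expi (hliftn d b w th n.+1 t)))); last first.
  by rewrite /= -/D; ring.
apply: ler_wpM2l; first by apply: ltW; exact: hdern_gt0.
exact: pois_fhat.
Qed.

(** A large kernel means that z is close to the pole: for finite z the squared distance is 2 |z -
    y|^2 / (1 + |z|^2), and |1 - |z|^2| <= 1 + |z|^2. *)
Lemma sqr_chordal_pois z y : normc y = 1 -> 0 < pois z y ->
  chordal z (Some y) ^+ 2 <= 2 / pois z y.
Proof.
move=> y1; case: z => [a|] /= P; last first.
  by rewrite y1 expr1n expr_div_n sqr_sqrtr // divr1 ler_pdivrMr //; lra.
rewrite chordal_SomeE // normc_distC.
have F0 : 0 < normc (y - a).
  rewrite lt_neqAle normc_ge0 andbT eq_sym; apply/eqP => E; move: P.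
  by rewrite E expr0n invr0 mulr0 ltxx.
have N0 : 0 < `|1 - normc a ^+ 2| by rewrite -(pmulr_lgt0 _ (_ : 0 < (normc (y - a) ^+ 2)^-1)) // invr_gt0 exprn_gt0.
rewrite [leRHS](_ : _ = 2 * normc (y - a) ^+ 2 / `|1 - normc a ^+ 2|); last first.
  by field; rewrite !gt_eqF.
apply: ler_wpM2l; first by rewrite mulr_ge0 // sqr_ge0.
rewrite lef_pV2 ?posrE //; last by rewrite ltr_wpDr ?sqr_ge0.
have := sqr_ge0 (normc a); rewrite ler_norml; lra.
Qed.

Lemma pois_off_circle s z t : 0 < s < 1 -> off_circle s z -> s <= pois z (expi t).
Proof.
move=> s01; case: z => [a|] /= h; last lra.
have a0 := normc_ge0 a.
have F0 : 0 < normc (expi t - a).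
  rewrite normc_gt0 subr_eq0; apply/eqP => E; move: h.
  by rewrite -E normc_expi subrr normr0; lra.
have F1 : normc (expi t - a) <= 1 + normc a.
  by have := le_normcD (expi t) (- a); rewrite normcN normc_expi.
rewrite ler_pdivlMr ?exprn_gt0 //.
have -> : 1 - normc a ^+ 2 = (1 - normc a) * (1 + normc a) by ring.
rewrite normrM [X in _ <= _ * X]ger0_norm; last lra.
apply: (@le_trans _ _ (s * (1 + normc a) ^+ 2)).
  apply: ler_wpM2l; first lra.
  by apply: lerXn2r; rewrite ?nnegrE //; lra.
by rewrite expr2 mulrA ler_pM2r; lra.
Qed.

(* Off the circle, the orbit of z follows that of a circle point x along which
   the derivatives tend to 0. *)
Lemma fatou_off_circle w th x (q C : R) z : (forall m, (0 < w m)%N) ->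
  0 < q < 1 -> (forall n, hdern d b w th n x <= q ^+ n * C) ->
  (forall t, z <> Some (expi t)) -> fatou (range (fhatn d b w (expi th))) z.
Proof.
move=> w0 q01 HC /off_circleP[s s01 zs].
exists (off_circle s); split => //; first exact: open_off_circle.
(* With D the derivative at x and P the kernel at the n-th image, s <= D P <= q^n C P, while the
   squared distance is at most 2 / P. *)
apply: (@normal_on_contract _ _ _ (fun n => hliftn d b w th n x)
  (fun n => Num.sqrt (2 * C / s * q ^+ n)) 0%N); last first.
  have E : (fun n => 2 * C / s * q ^+ n) @ \oo --> (0 : R).
    rewrite -(mulr0 (2 * C / s)); apply: cvgM; first exact: cvg_cst.
    by apply: cvg_expr; rewrite gtr0_norm; lra.
  rewrite -(sqrtr0 R); apply: (@continuous_cvg _ _ _ _ _ _ (@Num.sqrt R)) E.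
  exact: sqrt_continuous.
move=> n z' _ Uz.
have D0 := hdern_gt0 d b1 th n x w0.
have P0 := pois_off_circle x s01 Uz.
have P1 := le_trans P0 (pois_fhatn th n z' x w0).
set P := pois _ _ in P1.
have P2 : 0 < P by rewrite -(pmulr_rgt0 _ D0); lra.
rewrite -[leLHS](ger0_norm (chordal_ge0 _ _)) -sqrtr_sqr ler_wsqrtr //.
apply: (le_trans (sqr_chordal_pois (normc_expi _) P2)); rewrite -/P.
have s0 : 0 < s by lra.
have P3 : 1 <= hdern d b w th n x * P / s by rewrite ler_pdivlMr // mul1r.
apply: (@le_trans _ _ (2 / s * hdern d b w th n x)).
  rewrite ler_pdivrMr //; apply: (@le_trans _ _ (2 * (hdern d b w th n x * P / s))).
    by lra.
  by rewrite le_eqVlt; apply/orP; left; apply/eqP; ring.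
have -> : 2 * C / s * q ^+ n = 2 / s * (q ^+ n * C) by ring.
by rewrite ler_pM2l ?divr_gt0.
Qed.

End Poisson.

(** * Trapping arcs: location of the Julia set and expansion on it *)

Section Trapping.
Variables (R : realType) (d : nat) (b : R).
Hypothesis b1 : 1 < b.
Implicit Types (s t x y th e r q : R) (z : sphere R) (w : nat -> nat).

Lemma has_uderiv_lip F H g e : has_uderiv F H g -> 0 < e ->
  exists r, 0 < r /\ forall t (a : R[i]), normc (a - expi t) <= r ->
    exists v, F (Some a) = Some v /\
      normc (v - expi (H t)) <= (g t + e) * normc (a - expi t).
Proof.
move=> [D [uF [Dg _]]] e0; have [r [r0 Hr]] := uF e e0.
exists r; split => // t a ar; have [v [Fv hv]] := Hr t a ar.
exists v; split => //.
apply: (le_trans (normc_le_add _ (D t * (a - expi t)))).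
by rewrite normcM Dg mulrDl addrC lerD2l.
Qed.

Lemma fhat_lip th (K : nat) e : 0 < e ->
  exists r, 0 < r /\ forall k, (k <= K)%N -> forall t (a : R[i]),
    normc (a - expi t) <= r ->
    exists v, fhat d b k (expi th) (Some a) = Some v /\
      normc (v - expi (hlift d b k th t)) <= (hder d b k th t + e) * normc (a - expi t).
Proof.
move=> e0; elim: K => [|K [r [r0 IH]]].
  have [r [r0 Hr]] := has_uderiv_lip (has_uderiv_fhat d b1 0 th) e0.
  by exists r; split => // k; rewrite leqn0 => /eqP ->.
have [r' [r0' Hr]] := has_uderiv_lip (has_uderiv_fhat d b1 K.+1 th) e0.
exists (Num.min r r'); split; first by rewrite lt_min r0.
move=> k; rewrite leq_eqVlt => /predU1P[->|kK] t a; rewrite le_min => /andP[h1 h2].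
  exact: Hr.
exact: IH.
Qed.

Lemma hliftnD w th n m t : hliftn d b w th (n + m) t =
  hliftn d b (fun i => w (n + i)%N) th m (hliftn d b w th n t).
Proof. by elim: m => [|m IH]; rewrite ?addn0 // addnS /= IH. Qed.

Lemma fhatnD w (lam : R[i]) n m z : fhatn d b w lam (n + m) z =
  fhatn d b (fun i => w (n + i)%N) lam m (fhatn d b w lam n z).
Proof. by elim: m => [|m IH]; rewrite ?addn0 // addnS /= IH. Qed.

(** The distance to the m-th point of the orbit of x, weighted by the Hilbert density there, decays
    geometrically: the density is bounded above and below along the orbit, so it absorbs the uniform
    linearization error. *)
Lemma trapped_disc S u v e th w x : u < v -> v - u < 2 * pi -> 0 < e ->
  trapped d b S u v e th -> (forall n, S (w n)) -> in_arc (u + e) (v - e) x ->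
  exists r C q, [/\ 0 < r, 0 < q < 1 & forall a : R[i], normc (a - expi x) <= r ->
    forall m, exists a', fhatn d b w (expi th) m (Some a) = Some a' /\
      normc (a' - expi (hliftn d b w th m x)) <= C * q ^+ m].
Proof.
move=> uv vu e0 T Sw ax.
have [q [/andP[q0 q1] Hq]] := hil_orbit d b1 uv vu e0.
have [A B] := Hq S th w x T Sw ax.
have w0 m : (0 < w m <= d)%N by have [] := T _ (Sw m).
set rho := fun m => hil u v (hliftn d b w th m x).
pose rmin := sin ((v - u) / 2); pose rmax := 2 / sin (e / 2).
have rmin0 : 0 < rmin by apply: sin_half_gt0; lra.
have hmin m : rmin <= rho m.
  have [j jA] := A m; rewrite /rho -(hilDint _ _ _ (- j)) mulrNz mulrN.
  by apply: hil_ge; lra.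
have hmax m : rho m <= rmax.
  have [j jA] := A m; rewrite /rho -(hilDint _ _ _ (- j)) mulrNz mulrN.
  by apply: hil_le.
have rmax0 : 0 < rmax by apply: lt_le_trans (hmax 0%N); apply: lt_le_trans (hmin 0%N).
pose q' := (1 + q) / 2; have q'1 : 0 < q' < 1 by rewrite /q'; lra.
(* The linearization error adds at most eps [rmax] = (1 - q) / 2 [rmin] to q times the density,
   which raises the factor from q to at most q'. *)
pose eps := (1 - q) / 2 * rmin / rmax.
have eps0 : 0 < eps by apply: divr_gt0 => //; apply: mulr_gt0 => //; lra.
have [r [r0 Hr]] := fhat_lip th d eps0.
have rho0 : 0 < rho 0%N by exact: lt_le_trans (hmin _).
(* The initial weighted distance is then at most [r * rmin], so all later distances are at most r,
   where [Hr] applies. *)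
exists (r * rmin / rho 0%N), r, q'; split => //.
  by apply: divr_gt0 => //; exact: mulr_gt0.
move=> a; rewrite ler_pdivlMr // => ha.
have step m (a1 a2 : R[i]) : normc (a2 - expi (hliftn d b w th m.+1 x)) <=
    (hder d b (w m) th (hliftn d b w th m x) + eps) * normc (a1 - expi (hliftn d b w th m x)) ->
    normc (a2 - expi (hliftn d b w th m.+1 x)) * rho m.+1 <=
    q' * (normc (a1 - expi (hliftn d b w th m x)) * rho m).
  move=> h; have r1 := lt_le_trans rmin0 (hmin m.+1).
  apply: (le_trans (ler_wpM2r (ltW r1) h)).
  have n0 := normc_ge0 (a1 - expi (hliftn d b w th m x)).
  rewrite mulrAC [leRHS](_ : _ = q' * rho m * normc (a1 - expi (hliftn d b w th m x)));
    last by ring.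
  apply: ler_wpM2r => //; rewrite mulrDl.
  have h1 := B m; rewrite -/(rho _) -/(rho _) in h1.
  have h2 : eps * rho m.+1 <= (1 - q) / 2 * rho m.
    apply: (@le_trans _ _ (eps * rmax)); first by rewrite ler_pM2l.
    rewrite /eps divfK ?gt_eqF //; apply: ler_wpM2l => //; lra.
  by rewrite /q'; move: h1 h2; rewrite /rho; lra.
have main m : exists a', fhatn d b w (expi th) m (Some a) = Some a' /\
    normc (a' - expi (hliftn d b w th m x)) * rho m <= q' ^+ m * (r * rmin).
  elim: m => [|m [a1 [E h]]]; first by exists a; rewrite expr0 mul1r.
  have h1 : normc (a1 - expi (hliftn d b w th m x)) <= r.
    rewrite -(ler_pM2r rmin0); apply: (@le_trans _ _ (q' ^+ m * (r * rmin))).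
      by apply: le_trans h; apply: ler_wpM2l; rewrite ?normc_ge0.
    by rewrite ler_piMl ?exprn_ile1 ?mulr_ge0 //; lra.
  have [a2 [E2 h2]] := Hr (w m) (andP (w0 m)).2 _ _ h1.
  exists a2; split; first by rewrite /= E E2.
  apply: (le_trans (step m a1 a2 h2)); rewrite exprS -mulrA ler_pM2l //; lra.
move=> m; have [a' [E h]] := main m; exists a'; split => //.
rewrite -(ler_pM2r rmin0); apply: (@le_trans _ _ (q' ^+ m * (r * rmin))).
  by apply: le_trans h; apply: ler_wpM2l; rewrite ?normc_ge0.
rewrite le_eqVlt; apply/orP; left; apply/eqP; ring.
Qed.

(** One more step brings the orbit into the shrunk arc, where [trapped_disc] applies. The
    composition of the first n + 1 maps sends a small disc around e^(i t) into the disc found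
    there. *)
Lemma fatou_trapped S u v e th w t n : u < v -> v - u < 2 * pi -> 0 < e ->
  trapped d b S u v e th -> (forall n, S (w n)) -> in_arc u v (hliftn d b w th n t) ->
  fatou (range (fhatn d b w (expi th))) (Some (expi t)).
Proof.
move=> uv vu e0 T Sw ax.
have ax' : in_arc (u + e) (v - e) (hliftn d b w th n.+1 t).
  exact: trapped_in_arc T (Sw n) ax.
pose w' i := w (n.+1 + i)%N.
have [r [C [q [r0 q01 H]]]] := @trapped_disc S u v e th w' _ uv vu e0 T (fun i => Sw _) ax'.
have [r1 [r10 H1]] := has_uderiv_lip (has_uderiv_fhatn d b1 w th n.+1) (@ltr01 R).
set x := hliftn d b w th n.+1 t in ax' H *.
have w0 m : (0 < w m)%N by have [/andP[]] := T _ (Sw m).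
have D0 := hdern_gt0 d b1 th n.+1 t w0.
pose r2 := Num.min r1 (r / (hdern d b w th n.+1 t + 1)).
exists [set Some a | a in [set a : R[i] | normc (a - expi t) < r2]]; split.
- exact: open_sphere_ball.
- exists (expi t) => //.
  rewrite /mkset subrr normc0 lt_min r10 divr_gt0 //; lra.
apply: (@normal_on_contract _ _ _ (fun n => hliftn d b w th n t)
  (fun m => 2 * C * q ^+ (m - n.+1)) n.+1); last first.
  rewrite -(mulr0 (2 * C)); apply: cvgM; first exact: cvg_cst.
  rewrite -(cvg_shiftn n.+1); under eq_fun do rewrite addnK.
  by apply: cvg_expr; rewrite gtr0_norm; lra.
move=> m z nm [a /= ha <-].
move: ha; rewrite lt_min ltr_pdivlMr; last lra.
move=> /andP[ha1 ha2].
have [a1 [E1 h1]] := H1 t a (ltW ha1).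
have h2 : normc (a1 - expi x) <= r by apply: (le_trans h1); rewrite mulrC ltW.
have [a2 [E2 h3]] := H a1 h2 (m - n.+1)%N.
have -> : fhatn d b w (expi th) m (Some a) = Some a2.
  by rewrite -(subnKC nm) fhatnD E1.
apply: (le_trans (chordal_le_normc _ (normc_expi _))).
rewrite -mulrA ler_pM2l //.
by rewrite -[in expi _](subnKC nm) hliftnD.
Qed.

(** Modulo whole turns s - x lies between e and 2 pi - e, so the chord is at least that of the angle
    e. *)
Lemma sin_sqr_gap u v e s x : 0 < e -> u + e <= v - e -> v - u < 2 * pi ->
  ~ in_arc u v s -> in_arc (u + e) (v - e) x ->
  sin (e / 2) ^+ 2 <= sin ((s - x) / 2) ^+ 2.
Proof.
move=> e0 uve vu Ns [j /andP[j1 j2]]; have p0 := @pi_gt0 R.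
set x' := x - 2 * pi * j%:~R in j1 j2.
pose i := Num.floor ((s - x') / (2 * pi)).
have := real_floor_itv (num_real ((s - x') / (2 * pi))).
rewrite -/i ler_pdivlMr ?ltr_pdivrMr; [|lra|lra]; rewrite intrD mulrDl mul1r => /andP[i1 i2].
have h1 : v < s - 2 * pi * i%:~R.
  by rewrite ltNge; apply/negP => h; apply: Ns; exists i; lra.
have h2 : s - 2 * pi * (i + 1)%:~R < u.
  rewrite ltNge; apply/negP => h; apply: Ns; exists (i + 1); rewrite h /=.
  by rewrite intrD mulrDr mulr1; lra.
rewrite intrD mulrDr mulr1 in h2.
set y := (s - x' - 2 * pi * i%:~R) / 2.
have -> : sin ((s - x) / 2) ^+ 2 = sin y ^+ 2.
  rewrite -(sin_halfDint_sqr (s - x) (j - i)); congr (sin _ ^+ 2).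
  by rewrite /y /x' intrB; field.
have y1 : e / 2 <= y by rewrite /y; lra.
have y2 : y <= pi - e / 2 by rewrite /y; lra.
have se : 0 < sin (e / 2) by apply: sin_half_gt0; lra.
apply: lerXn2r; rewrite ?nnegrE ?(ltW se) //.
  by apply: sin_ge0_pi; lra.
rewrite -subr_ge0.
have -> : sin y - sin (e / 2) =
   2 * cos ((y + e / 2) / 2) * sin ((y - e / 2) / 2).
  have -> : sin y = sin ((y + e / 2) / 2 + (y - e / 2) / 2) by apply: congr1; field.
  have -> : sin (e / 2) = sin ((y + e / 2) / 2 - (y - e / 2) / 2) by apply: congr1; field.
  by rewrite sinD sinB; ring.
rewrite mulr_ge0 ?mulr_ge0 //; first by apply: cos_ge0_pihalf; lra.
by apply: sin_ge0_pi; lra.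
Qed.

Lemma julia_circle S u v e th w z : u < v -> v - u < 2 * pi -> 0 < e ->
  trapped d b S u v e th -> (forall n, S (w n)) -> Jset d b w (expi th) z ->
  exists t, z = Some (expi t) /\ forall n, ~ in_arc u v (hliftn d b w th n t).
Proof.
move=> uv vu e0 T Sw Jz.
have [/andP[w0 _] [j hj]] := T _ (Sw 0%N).
have uve : u + e <= v - e by have := hj u ltac:(lra); lra.
have ax : in_arc (u + e) (v - e) ((u + v) / 2).
  by exists 0; rewrite mulr0 subr0; lra.
have [q [q01 Hq]] := hdern_orbit d b1 uv vu e0.
have [[t E]|N] := pselect (exists t, z = Some (expi t)).
  exists t; split => // n a; apply: Jz; rewrite E.
  exact: fatou_trapped T Sw a.
exfalso; apply: Jz; apply: fatou_off_circle q01 (Hq S th w _ T Sw ax) _ => //.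
  by move=> m; have [/andP[]] := T _ (Sw m).
by move=> t E; apply: N; exists t.
Qed.

(** The two-point inequality is applied to z and the midpoint of the arc, whose images stay apart by
    [sin_sqr_gap]. The threshold for N is fixed before S, th and w, which gives the uniformity. *)
Lemma julia_expand u v e kappa : u < v -> v - u < 2 * pi -> 0 < e ->
  \forall N \near \oo, forall S th w z, trapped d b S u v e th -> (forall n, S (w n)) ->
    Jset d b w (expi th) z ->
    kappa <= normc (sderiv (fhatn d b w (expi th) N) z).
Proof.
move=> uv vu e0; have [q [q01 Hq]] := hdern_orbit d b1 uv vu e0.
pose C := hil u v ((u + v) / 2) / sin ((v - u) / 2).
have K0 : 0 < `|kappa| + 1 by rewrite ltr_wpDl.
have C0 : 0 < C.
  by rewrite divr_gt0 ?hil_gt0 ?sin_half_gt0 //; lra.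
have se0 : 0 < sin (e / 2) ^+ 2 \/ 2 * pi <= e.
  have [h|h] := ltP e (2 * pi); last by right.
  by left; rewrite exprn_gt0 // sin_half_gt0.
case: se0 => [se0|ep]; last first.
  exists 0%N => // N _ S th w z T Sw Jz.
  have [_ [j hj]] := T _ (Sw 0%N).
  by have := hj u ltac:(lra); lra.
have E : (fun n => (`|kappa| + 1) * C * q ^+ n) @ \oo --> (0 : R).
  rewrite -(mulr0 ((`|kappa| + 1) * C)); apply: cvgM; first exact: cvg_cst.
  by apply: cvg_expr; rewrite gtr0_norm; lra.
move/cvgr0Pnorm_lt : E => /(_ _ se0); apply: filterS => N hN S th w z T Sw Jz.
have [t [-> Ht]] := julia_circle uv vu e0 T Sw Jz.
have [_ [j hj]] := T _ (Sw 0%N).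
have uve : u + e <= v - e by have := hj u ltac:(lra); lra.
have ax : in_arc (u + e) (v - e) ((u + v) / 2).
  by exists 0; rewrite mulr0 subr0; lra.
have w0 m : (0 < w m)%N by have [/andP[]] := T _ (Sw m).
rewrite normc_sderiv_fhatn //.
have [q' [_ Hq']] := hil_orbit d b1 uv vu e0.
have axN := (Hq' S th w _ T Sw ax).1 N.
have G := sin_sqr_gap e0 uve vu (Ht N) axN.
have := hliftn_chord d b1 th N t ((u + v) / 2) w0.
have D1 := hdern_gt0 d b1 th N t w0.
have D2 := hdern_gt0 d b1 th N ((u + v) / 2) w0.
set D := hdern d b w th N t in D1 *; set D' := hdern d b w th N _ in D2 * => H.
have h1 : sin ((t - (u + v) / 2) / 2) ^+ 2 <= 1.
  have := cos2Dsin2 ((t - (u + v) / 2) / 2).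
  by have := sqr_ge0 (cos ((t - (u + v) / 2) / 2)); lra.
have h2 : sin (e / 2) ^+ 2 <= D * D'.
  apply: (le_trans G); apply: (le_trans H); rewrite ler_piMr // mulr_ge0 // ltW //.
have h3 := Hq S th w _ T Sw ax N; rewrite -/D' -/C in h3.
rewrite leNgt; apply/negP => Dk.
have := le_lt_trans h2 (le_lt_trans (ler_wpM2l (ltW D1) h3) _).
move=> /(_ (sin (e / 2) ^+ 2)); rewrite ltxx => F; suff : false by []; apply: F.
apply: le_lt_trans hN; apply: le_trans (ler_norm _).
have qN : 0 <= q ^+ N by rewrite exprn_ge0 //; lra.
rewrite [q ^+ N * C]mulrC mulrA ler_wpM2r // ler_wpM2r ?(ltW C0) //.
by have := ler_norm kappa; lra.
Qed.

End Trapping.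

(** * The immediate basin of the attracting fixed point *)

Section Basin.
Variables (R : realType) (d : nat) (b : R).
Hypothesis b1 : 1 < b.
Hypothesis d2 : (2 <= d)%N.
Variables (th p : R).
Local Notation F := (flift b d th).
Hypothesis Fp : F p = p.
Hypothesis gp : d%:R * gder b p < 1.
Implicit Types (s t x y e r q : R) (z : sphere R).

Let d0 : (0 < d)%N. Proof. exact: ltnW. Qed.

(** The two-point inequality at t and p replaces the mean value theorem: near p the product of the
    two derivatives is below 1, and half-angle sines order the distances. *)
Lemma flift_near : exists2 r, 0 < r &
  forall t, t != p -> `|t - p| < r -> `|F t - p| < `|t - p|.
Proof.
have p0 := @pi_gt0 R.
have C1 : \forall t \near p, `|F t - p| < pi.
  have : F t @[t --> p] --> p by rewrite -[X in _ --> X]Fp; exact: continuous_flift.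
  by move/cvgr_distC_lt; apply.
have C2 : \forall t \near p, d%:R * gder b t < 1.
  have : d%:R * gder b t @[t --> p] --> d%:R * gder b p.
    by apply: cvgM; [exact: cvg_cst|exact: continuous_gder].
  by move/cvgr_lt; apply.
have [r /= r0 H] : \forall t \near p, `|F t - p| < pi /\ d%:R * gder b t < 1.
  by apply: filterS2 C1 C2.
exists (Num.min r pi); first by rewrite lt_min r0.
move=> t tp; rewrite lt_min => /andP[tr tpi].
have [h1 h2] := H t ltac:(by rewrite /= distrC).
have := flift_chord b1 d th t p; rewrite Fp => h3.
have h4 : 0 < sin ((t - p) / 2) ^+ 2.
  rewrite exprn_even_gt0 //=.
  have [tp0|tp0] := ltP 0 (t - p).
    by rewrite gt_eqF // sin_half_gt0 //; move: tpi; rewrite gtr0_norm //; lra.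
  have tp1 : t - p < 0 by rewrite lt_neqAle tp0 subr_eq0 tp.
  rewrite -oppr_eq0 -sinN gt_eqF // -mulNr sin_half_gt0 //; first lra.
  by move: tpi; rewrite ltr0_norm //; lra.
have g0 := gder_gt0 b1 t; have g0' := gder_gt0 b1 p.
have dp : 0 < d%:R :> R by rewrite ltr0n.
have h5 : sin ((F t - p) / 2) ^+ 2 < sin ((t - p) / 2) ^+ 2.
  apply: (le_lt_trans h3); rewrite gtr_pMl //.
  have a1 : 0 < d%:R * gder b t by exact: mulr_gt0.
  have a2 : 0 < d%:R * gder b p by exact: mulr_gt0.
  by apply: mulr_ilt1 => //; exact: ltW.
move: h5; rewrite !sin_half_sqr -(cos_norm (F t - p)) -(cos_norm (t - p)) => h5.
rewrite -ltr_cos ?in_itv /= ?normr_ge0 ?ltW //; lra.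
Qed.

Lemma flift2_near : exists2 r, 0 < r & forall t, p < t < p + r -> F (F t) < t.
Proof.
have [r r0 H] := flift_near; exists r => // t /andP[pt tr].
have h1 := H t (negbT (gt_eqF pt)) ltac:(rewrite gtr0_norm; lra).
rewrite [X in _ < X]gtr0_norm in h1; last lra.
have [->|ne] := eqVneq (F t) p; first by rewrite Fp.
have := H _ ne ltac:(lra); have := ler_norm (F (F t) - p); lra.
Qed.

Lemma flift2_mono : {mono (F \o F) : x y / x < y}.
Proof. by move=> x y /=; rewrite !(flift_lt b1 th d0). Qed.

Lemma continuous_flift2 : continuous (F \o F).
Proof.
move=> x; apply: (@continuous_comp _ _ _ F F); exact: continuous_flift.
Qed.

(** [be] is the infimum of the t > p with t <= F (F t). This set contains p + 2 pi, since F o F has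
    degree d^2, and stays away from p by attraction; continuity excludes both strict inequalities at
    [be]. *)
Lemma flift2_lower : exists be, [/\ p < be, F (F be) = be &
  forall t, p < t < be -> p < F (F t) < t].
Proof.
have p0 := @pi_gt0 R; have d1 : 1 <= d%:R ^+ 2 :> R by rewrite -natrX ler1n expn_gt0 d0.
pose S := [set t | p < t /\ t <= F (F t)].
have S0 : S (p + 2 * pi).
  split; first lra.
  have E : F (p + 2 * pi) = p + 2 * pi * (- d%:Z)%:~R.
    by have := fliftDint b d th p 1; rewrite [d%:Z * 1]mulr1 mulr1z mulr1 Fp.
  rewrite E fliftDint Fp lerD2l; set X := _%:~R.
  have -> : X = d%:R ^+ 2 by rewrite /X mulrN opprK intrM expr2.
  by rewrite ler_peMr //; lra.
have [r r0 H] := flift2_near.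
have lb : lbound S (p + r).
  move=> t [pt ht]; rewrite leNgt; apply/negP => tr.
  by have := H t ltac:(lra); lra.
have hS : has_inf S by split; [exists (p + 2 * pi)|exists (p + r)].
pose be := inf S.
have pbe : p + r <= be by apply: lb_le_inf => //; exists (p + 2 * pi).
have below t : p < t < be -> F (F t) < t.
  move=> /andP[pt tb]; rewrite ltNge; apply/negP => h.
  have : be <= t by apply: ge_inf => //; exists (p + r).
  lra.
have inc := flift2_mono.
exists be; split; [lra| |]; last first.
  move=> t tb; rewrite below // andbT; have := inc p t; rewrite /= !Fp => ->; lra.
apply/eqP; rewrite eq_le; apply/andP; split; rewrite leNgt; apply/negP => h.
  have : \forall t \near be, 0 < (F \o F) t - t.
    have : (F \o F) t - t @[t --> be] --> (F \o F) be - be.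
      by apply: cvgB; [exact: continuous_flift2|exact: cvg_id].
    by move/cvgr_gt; apply; rewrite /= subr_gt0.
  case=> r' /= r'0 H'; pose t := be - Num.min (r / 2) (r' / 2).
  have m1 : 0 < Num.min (r / 2) (r' / 2) by rewrite lt_min; lra.
  have m2 : Num.min (r / 2) (r' / 2) <= r / 2 by rewrite ge_min lexx.
  have m3 : Num.min (r / 2) (r' / 2) <= r' / 2 by rewrite ge_min lexx orbT.
  have := H' t ltac:(rewrite /= /t gtr0_norm; lra).
  have := below t ltac:(rewrite /t; lra); lra.
have : \forall t \near be, 0 < t - (F \o F) t.
  have : t - (F \o F) t @[t --> be] --> be - (F \o F) be.
    by apply: cvgB; [exact: cvg_id|exact: continuous_flift2].
  by move/cvgr_gt; apply; rewrite /= subr_gt0.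
case=> r' /= r'0 H'; have [t [pt ht] tb] := inf_adherent r'0 hS.
have tb' : be <= t by apply: ge_inf => //; exists (p + r).
have := H' t ltac:(rewrite /= ler0_norm; rewrite -/be in tb; lra); lra.
Qed.

Lemma basin : exists al be, [/\ al < p < be, be - al < 2 * pi, F be = al, F al = be &
  forall t, p < t < be -> p < F (F t) < t].
Proof.
have p0 := @pi_gt0 R; have [be [pb Fb H]] := flift2_lower.
exists (F be), be; split => //.
  by rewrite pb andbT -[X in _ < X]Fp flift_lt.
rewrite ltNge; apply/negP => h.
(* an interval of length at least 2 pi is stretched by F *)
set L := be - F be in h.
pose n := Num.truncn (L / (2 * pi)).
have : n%:R <= L / (2 * pi) < n.+1%:R.
  by apply: truncn_itv; rewrite divr_ge0 //; lra.
rewrite ler_pdivlMr ?ltr_pdivrMr; [|lra|lra] => /andP[h1 h2].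
have n0 : (0 < n)%N.
  rewrite lt0n; apply/eqP => n0; move: h2; rewrite n0 mul1r; lra.
(* As F decreases and F (F be) = be, this gives 2 pi d n <= L < 2 pi (n + 1), impossible for d >= 2
   and n >= 1. *)
have : F be <= F (F be + 2 * pi * n%:R) by rewrite leNgt flift_lt // -leNgt; move: h1; rewrite /L; lra.
have := fliftDint b d th (F be) n%:Z; rewrite Fb => ->.
rewrite mulrNz mulrN intrM => h3.
have : (n%:R * (2 * pi)) * 2 <= d%:R * (n%:R * (2 * pi)) :> R.
  by rewrite mulrC ler_wpM2r ?ler_nat // mulr_ge0 //; lra.
have : 2 * pi * (d%:R * n%:R) <= L by move: h3; rewrite /L /=; lra.
have n1 : 1 <= n%:R :> R by rewrite ler1n.
have : 2 * pi <= n%:R * (2 * pi) :> R by rewrite ler_peMl //; lra.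
rewrite -natr1 in h2; nra.
Qed.

Lemma iter_basin be t : F (F be) = be ->
  (forall t, p < t < be -> p < F (F t) < t) -> p < t < be ->
  (fun n => iter (2 * n) F t) @ \oo --> p.
Proof.
move=> Fb H tb; pose x n := iter (2 * n) F t.
have xS n : x n.+1 = F (F (x n)) by rewrite /x mulnS.
have xb n : p < x n < be.
  elim: n => [//|n IH]; rewrite xS; have := H _ IH; lra.
have xd : nonincreasing_seq x.
  by apply/nonincreasing_seqP => n; rewrite xS; have := H _ (xb n); lra.
have xc : x n @[n --> \oo] --> inf (range x).
  apply: nonincreasing_cvgn => //; exists p => _ [n _ <-].
  by have := xb n; lra.
set l := inf (range x) in xc.
have lp : p <= l.
  by apply: lb_le_inf; [exists (x 0%N), 0%N|move=> _ [n _ <-]; have := xb n; lra].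
have lt0 : l <= x 0%N.
  by apply: ge_inf; [exists p => _ [n _ <-]; have := xb n; lra|exists 0%N].
have Fl : (F \o F) l = l.
  have h1 : (F \o F) (x n) @[n --> \oo] --> (F \o F) l.
    by apply: continuous_cvg xc; exact: continuous_flift2.
  have h2 : x n.+1 @[n --> \oo] --> l by rewrite cvg_shiftS.
  have h3 : x n.+1 @[n --> \oo] --> (F \o F) l.
    by apply: cvg_trans h1; apply: near_eq_cvg; near=> n; rewrite xS.
  exact: cvg_unique h3 h2.
suff <- : l = p by [].
apply/eqP; rewrite eq_le lp andbT leNgt; apply/negP => pl.
by have := xb 0%N; have := H l ltac:(have := xb 0%N; lra); rewrite /= in Fl; lra.
Unshelve. all: by end_near. Qed.

End Basin.

Section SphereLimits.
Variable R : realType.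
Implicit Types (s t x y e r q : R) (z w : sphere R).

Lemma chordalC z w : chordal z w = chordal w z.
Proof.
by case: z w => [z|] [w|] //=; rewrite normc_distC [Num.sqrt _ * _]mulrC.
Qed.

(** Plays the role of the triangle inequality through any point z of the sphere. For e <= 1 / 2 such
    a z is finite with |z| <= 3, so each distance is at most sqrt 5 e, and sqrt 5 < 5 / 2. *)
Lemma chordal_lt_circle (y y' : R[i]) z e : normc y = 1 -> normc y' = 1 -> e <= 1 / 2 ->
  chordal (Some y) z < e -> chordal (Some y') z < e -> normc (y - y') <= 5 * e.
Proof.
move=> y1 y1' e2; rewrite chordalC (chordalC (Some y')); case: z => [a|]; last first.
  rewrite /chordal y1 expr1n => h; exfalso; move: h; apply/negP; rewrite -leNgt.
  apply: (le_trans e2); rewrite ler_pdivlMr ?sqrtr_gt0 //.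
  have : Num.sqrt (1 + 1 : R) <= 2.
    rewrite -(@ler_pXn2r _ 2) ?nnegrE ?sqrtr_ge0 // sqr_sqrtr //; lra.
  lra.
move=> h1 h2; have e0 : 0 < e by apply: le_lt_trans h1; exact: chordal_ge0.
have key u : normc u = 1 -> chordal (Some a) (Some u) < e ->
    2 * normc (a - u) ^+ 2 <= e ^+ 2 * (1 + normc a ^+ 2).
  move=> u1 h; rewrite -ler_pdivrMr ?ltr_wpDr ?sqr_ge0 //.
  rewrite -chordal_SomeE //; apply: ltW; apply: ltrXn2r => //; exact: chordal_ge0.
have k1 := key y y1 h1; have k2 := key y' y1' h2.
have a3 : normc a <= 3.
  have := normc_le_add a y; rewrite y1 => h; rewrite leNgt; apply/negP => a3.
  have e3 : e ^+ 2 <= (1 / 2) ^+ 2 by apply: lerXn2r => //; rewrite nnegrE; lra.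
  have : (normc a - 1) ^+ 2 <= normc (a - y) ^+ 2.
    by apply: lerXn2r; rewrite ?nnegrE ?normc_ge0 //; lra.
  have : e ^+ 2 * (1 + normc a ^+ 2) <= (1 / 2) ^+ 2 * (1 + normc a ^+ 2).
    by apply: ler_wpM2r => //; have := sqr_ge0 (normc a); lra.
  nra.
have a9 : normc a ^+ 2 <= 9.
  have -> : 9 = 3 ^+ 2 :> R by ring.
  by apply: lerXn2r => //; rewrite nnegrE ?normc_ge0.
have bound u : 2 * normc (a - u) ^+ 2 <= e ^+ 2 * (1 + normc a ^+ 2) ->
    normc (a - u) <= 5 / 2 * e.
  move=> h; rewrite -(@ler_pXn2r _ 2) ?nnegrE ?normc_ge0 //; last by apply: mulr_ge0; lra.
  have : e ^+ 2 * (1 + normc a ^+ 2) <= e ^+ 2 * 10.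
    by apply: ler_wpM2l; [exact: sqr_ge0|lra].
  by rewrite exprMn; have := sqr_ge0 e; lra.
have -> : y - y' = (a - y') - (a - y) by ring.
apply: (le_trans (le_normcD _ _)); rewrite normcN.
by have := bound _ k1; have := bound _ k2; lra.
Qed.

End SphereLimits.

(** * Fixed points of f_d and the Julia endpoints of the basin *)

Section FixedPoints.
Variables (R : realType) (d : nat) (b : R).
Hypothesis b1 : 1 < b.
Hypothesis d0 : (0 < d)%N.
Implicit Types (s t x y e r q th : R) (z w : sphere R).

Lemma iterates_fhatn th : iterates (fpow b d (expi th)) =
  range (fhatn d b (fun=> d) (expi th)).
Proof.
have E n : iter n (fpow b d (expi th)) = fhatn d b (fun=> d) (expi th) n.
  by apply/funext => z; elim: n => //= n ->; rewrite /fhat eqxx.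
by apply/seteqP; split => _ [n _ <-]; exists n.
Qed.

Lemma iter_fpow_expi th n t : iter n (fpow b d (expi th)) (Some (expi t)) =
  Some (expi (iter n (flift b d th) t)).
Proof. by elim: n => [//|n IH]; rewrite iterS IH fpow_expi. Qed.

(** By [mobius_sqr_normc] the map exchanges the open disc and the exterior of the closed one, so
    neither contains a fixed point. *)
Lemma fpow_fixed_circle th z : fpow b d (expi th) z = z -> exists t, z = Some (expi t).
Proof.
case: z => [a|] //; rewrite /fpow.
rewrite -[mobius b _]/(if b%:C * a + 1 == 0 then None
  else Some ((a + b%:C) / (b%:C * a + 1))).
case: eqP => // /eqP N [E].
have D0 : 0 < normc (b%:C * a + 1) by rewrite normc_gt0.
have B := b2m1_gt0 b1.
have I := mobius_sqr_normc b a.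
have : normc a = (normc (a + b%:C) / normc (b%:C * a + 1)) ^+ d.
  by rewrite -[in LHS]E normcM normc_expi mul1r normcX normcM normcV.
set A := normc (a + b%:C) in I *; set D := normc (b%:C * a + 1) in I D0 * => Ea.
have A0 : 0 <= A by exact: normc_ge0.
have a0 : 0 <= normc a by exact: normc_ge0.
suff a1 : normc a = 1 by have [t [_ ->]] := circle_expi a1; exists t.
apply/eqP; rewrite eq_le; apply/andP; split; rewrite leNgt; apply/negP => h.
  have : A < D.
    rewrite -(@ltr_pXn2r _ 2) ?nnegrE ?(ltW D0) // -subr_gt0 I mulr_gt0 //.
    by rewrite subr_gt0 expr_gt1.
  move=> AD; have : (A / D) ^+ d <= 1.
    by rewrite exprn_ile1 // ?divr_ge0 ?(ltW D0) // ler_pdivrMr // mul1r ltW.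
  by rewrite -Ea; lra.
have : D < A.
  rewrite -(@ltr_pXn2r _ 2) ?nnegrE ?(ltW D0) // -subr_lt0 I pmulr_rlt0 //.
  by rewrite subr_lt0 expr_lt1.
move=> AD; have : 1 <= (A / D) ^+ d.
  by rewrite exprn_ege1 // ler_pdivlMr // mul1r ltW.
by rewrite -Ea; lra.
Qed.

Lemma attracting_circle th z : attracting_fixed_point (fpow b d (expi th)) z ->
  exists t, [/\ z = Some (expi t), d%:R * gder b t < 1 &
    exists j : int, flift b d th t = t + 2 * pi * j%:~R].
Proof.
move=> [Fz Mz]; have [t Et] := fpow_fixed_circle Fz.
exists t; split => //.
  by move: Mz; rewrite Et /multiplier normc_sderiv_fpow.
by apply: expi_inj; apply: Some_inj; rewrite -fpow_expi // -Et.
Qed.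

(** Two distinct ones would contradict the two-point inequality, whose factor is the product of
    their multipliers. *)
Lemma attracting_uniq th p t : flift b d th p = p -> d%:R * gder b p < 1 ->
  (exists j : int, flift b d th t = t + 2 * pi * j%:~R) -> d%:R * gder b t < 1 ->
  expi t = expi p.
Proof.
move=> Fp gp [j Ft] gt1.
have := flift_chord b1 d th t p; rewrite Fp Ft.
have -> : t + 2 * pi * j%:~R - p = t - p + 2 * pi * j%:~R by ring.
rewrite sin_halfDint_sqr => h.
have dp : 0 < d%:R :> R by rewrite ltr0n.
have h1 : d%:R * gder b t * (d%:R * gder b p) < 1.
  by apply: mulr_ilt1 => //; apply: ltW; apply: mulr_gt0 => //; exact: gder_gt0.
apply/eqP; rewrite -subr_eq0 -normc_eq0 -sqrf_eq0 sqr_normc_expiB mulf_eq0 pnatr_eq0 /=.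
rewrite eq_le sqr_ge0 andbT leNgt; apply/negP => h2.
by move: h; rewrite leNgt gtr_pMl // h1.
Qed.

End FixedPoints.

Section ImmediateBasin.
Variables (R : realType) (d : nat) (b : R).
Hypothesis b1 : 1 < b.
Hypothesis d2 : (2 <= d)%N.
Variables (th p al be : R).
Local Notation F := (flift b d th).
Hypothesis Fp : F p = p.
Hypothesis gp : d%:R * gder b p < 1.
Hypothesis apb : al < p < be.
Hypothesis ab2 : be - al < 2 * pi.
Hypothesis Fbe : F be = al.
Hypothesis Fal : F al = be.
Hypothesis Hbe : forall t, p < t < be -> p < F (F t) < t.
Implicit Types (s t x y e r q : R) (z w : sphere R).

Let d0 : (0 < d)%N. Proof. exact: ltnW. Qed.

(* F reverses orientation and exchanges al and be; since F (F t) < t for t close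
   to be, slightly smaller arcs are mapped strictly into themselves. *)
Lemma trap_pair a c : al < a -> c < be -> exists u v : R,
  [/\ al < u, u < a, u < p, p < v & c < v /\ v < be] /\ u < F v /\ F u < v.
Proof.
move=> ala cbe.
have C : F t @[t --> be] --> al by rewrite -Fbe; exact: continuous_flift.
have : \forall t \near be, F t < a by move/cvgr_lt : C; apply.
case=> r /= r0 H.
(* v is beyond p and c, and so close to be that F v < a. Then u is taken slightly below F v, so that
   F u stays near F (F v) < v. *)
pose m := Num.max (Num.max p c) (be - r / 2).
have m1 : m < be by rewrite !gt_max cbe; case/andP: apb => _ ->; lra.
have m2 : [/\ p <= m, c <= m & be - r / 2 <= m] by split; rewrite !le_max lexx ?orbT.
pose v := (m + be) / 2.
have v1 : [/\ p < v, c < v, be - r < v & v < be] by case: m2 => *; split; rewrite /v; lra.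
have [v2 v3 v4 v5] := v1.
have Fv1 : F v < a by apply: H; rewrite /= gtr0_norm; lra.
have Fv2 : al < F v by rewrite -Fbe flift_lt.
have Fv3 : F v < p by rewrite -[X in _ < X]Fp flift_lt.
have /Hbe FFv : p < v < be by lra.
have : \forall t \near F v, F t < v.
  by have /cvgr_lt := @continuous_flift R b b1 d th (F v); apply; lra.
case=> r' /= r'0 H'.
pose k := Num.min (r' / 2) ((F v - al) / 2).
have k1 : [/\ 0 < k, k <= r' / 2 & k <= (F v - al) / 2].
  by split; rewrite ?lt_min ?ge_min ?lexx ?orbT //; lra.
have [k2 k3 k4] := k1.
exists (F v - k), v; split; first by split => //; lra.
split; first lra.
by apply: H'; rewrite /= gtr0_norm; lra.
Qed.

Lemma fatou_basin t : al < t < be ->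
  fatou (iterates (fpow b d (expi th))) (Some (expi t)).
Proof.
move=> /andP[at1 tb]; rewrite iterates_fhatn.
have [u [v [[u1 u2 u3 u4 [u5 u6]] [u7 u8]]]] := trap_pair at1 tb.
pose e := Num.min (F v - u) (v - F u).
have e0 : 0 < e by rewrite lt_min; lra.
have e1 : e <= F v - u by rewrite ge_min lexx.
have e2 : e <= v - F u by rewrite ge_min lexx orbT.
have uv2 : v - u < 2 * pi by apply: lt_trans ab2; lra.
apply: (@fatou_trapped _ _ _ b1 (fun k => k = d) u v e _ _ _ 0) => //; try lra.
  move=> k ->; split; first by rewrite d0 leqnn.
  exists 0 => s /andP[us sv]; rewrite mulr0 subr0 /hlift eqxx.
  have h1 : F v <= F s by rewrite leNgt flift_lt // -leNgt.
  have h2 : F s <= F u by rewrite leNgt flift_lt // -leNgt.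
  lra.
by exists 0; rewrite mulr0 subr0 /=; lra.
Qed.

(** A normal limit would be close to two even iterates of one point t near ga: an early one, still
    near ga, and a late one, already near p. *)
Lemma not_fatou_limit ga : (forall n, iter (2 * n) F ga = ga) -> expi ga <> expi p ->
  (forall r, 0 < r -> exists t, `|t - ga| < r /\ (fun n => iter (2 * n) F t) @ \oo --> p) ->
  ~ fatou (iterates (fpow b d (expi th))) (Some (expi ga)).
Proof.
move=> Fga ne H [U [oU Uga NU]].
have nU : nbhs (Some (expi ga) : sphere R) U by exact: open_nbhs_nbhs.
have [r /= r0 Hr] : \forall t \near ga, U (Some (expi t)).
  exact: (@continuous_Some_expi R ga U nU).
pose K := (fun t => Some (expi t) : sphere R) @` `[ga - r / 2, ga + r / 2].
have cK : compact K.
  apply: continuous_compact; last exact: segment_compact.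
  by apply: continuous_subspaceT; exact: continuous_Some_expi.
have KU : K `<=` U.
  move=> _ [t /= + <-]; rewrite in_itv /= => ht; apply: Hr.
  rewrite /= ltr_norml; lra.
have [phi [g [phi1 Hg]]] := NU (fun n => iter (2 * n) (fpow b d (expi th)))
   (fun n => ex_intro2 _ _ (2 * n)%N I erefl).
pose D := normc (expi ga - expi p).
have D0 : 0 < D by rewrite normc_gt0 subr_eq0; apply/eqP.
(* The final estimate is D < e + 5 e + e with 7 e <= 7 D / 8, the 5 coming from [chordal_lt_circle],
   which also requires e <= 1 / 2. *)
pose e := Num.min (1 / 2) (D / 8).
have e0 : 0 < e by rewrite lt_min; lra.
have e1 : e <= 1 / 2 by rewrite ge_min lexx.
have e2 : e <= D / 8 by rewrite ge_min lexx orbT.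
have [n0 Hn0] := Hg K cK KU e e0.
pose X n t := iter (2 * phi n) F t.
have cX n : continuous (X n).
  move=> t; rewrite /X; elim: (2 * phi n)%N t => [t|m IH t]; first exact: cvg_id.
  apply: (@continuous_comp _ _ _ (iter m F) F); first exact: IH.
  exact: continuous_flift.
have [r1 /= r10 Hr1] : \forall t \near ga, normc (expi (X n0 t) - expi ga) < e.
  have E : X n0 ga = ga by exact: Fga.
  have C : X n0 t @[t --> ga] --> ga by rewrite -[Y in _ --> Y]E; exact: cX.
  exact: (C _ (near_expi ga e0)).
have [t [tga tp]] := H (Num.min (r / 2) r1) ltac:(rewrite lt_min; lra).
move: tga; rewrite lt_min => /andP[t1 t2].
have Kt : K (Some (expi t)).
  by exists t => //=; rewrite in_itv /=; move: t1; rewrite ltr_norml; lra.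
have A1 : normc (expi (X n0 t) - expi ga) < e by apply: Hr1; rewrite /= distrC.
have [N _ HN] : \forall n \near \oo, normc (expi (iter (2 * n) F t) - expi p) < e.
  exact: tp (near_expi p e0).
pose n := maxn n0 N.
have phin : (n <= phi n)%N.
  by elim: (n) => // m IH; apply: leq_ltn_trans IH (phi1 _ _ _).
have A2 : normc (expi (X n t) - expi p) < e.
  by apply: HN; apply: leq_trans phin; exact: leq_maxr.
have A3 := Hn0 n (leq_maxl _ _) _ Kt; have A4 := Hn0 n0 (leqnn _) _ Kt.
rewrite iter_fpow_expi // in A3; rewrite iter_fpow_expi // in A4.
have A5 := chordal_lt_circle (normc_expi _) (normc_expi _) e1 A4 A3.
rewrite -/(X _ _) -/(X _ _) in A5.
have : D <= normc (expi ga - expi (X n0 t)) + (normc (expi (X n0 t) - expi (X n t)) +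
    normc (expi (X n t) - expi p)).
  rewrite /D.
  have -> : expi ga - expi p = (expi ga - expi (X n0 t)) +
    ((expi (X n0 t) - expi (X n t)) + (expi (X n t) - expi p)) by ring.
  apply: (le_trans (le_normcD _ _)); rewrite lerD2l; exact: le_normcD.
rewrite (normc_distC (expi ga) (expi (X n0 t))).
lra.
Qed.

Lemma expi_ne ga : al <= ga <= be -> ga != p -> expi ga <> expi p.
Proof.
have apb' := apb; have ab2' := ab2.
move=> gab gap /expi_inj[j E]; have p0 := @pi_gt0 R.
have P : 0 < 2 * pi :> R by lra.
have [j0|j0|j0] := ltgtP j 0.
- have j1 : j%:~R <= (- 1)%:~R :> R by rewrite ler_int -ltzD1.
  have := ler_wpM2l (ltW P) j1; rewrite mulrN1z mulrN1; lra.
- have j1 : 1%:~R <= j%:~R :> R by rewrite ler_int -gtz0_ge1.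
  have := ler_wpM2l (ltW P) j1; rewrite mulr1z mulr1; lra.
by move: gap; rewrite E j0 mulr0 addr0 eqxx.
Qed.

Lemma not_fatou_be : ~ fatou (iterates (fpow b d (expi th))) (Some (expi be)).
Proof.
have apb' := apb.
apply: not_fatou_limit.
- by elim=> // n IH; rewrite mulnS !addSn add0n !iterS IH Fbe Fal.
- by apply: expi_ne; [lra|rewrite gt_eqF //; lra].
move=> r r0; pose k := Num.min (r / 2) ((be - p) / 2).
have k1 : [/\ 0 < k, k <= r / 2 & k <= (be - p) / 2].
  by split; rewrite ?lt_min ?ge_min ?lexx ?orbT //; lra.
have [k2 k3 k4] := k1; exists (be - k); split.
  by rewrite ltr_norml; lra.
apply: (iter_basin b1 (be := be)) => //; [by rewrite Fbe|lra].
Qed.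

(** F carries points to the right of al to the left of be, where [iter_basin] applies; one further F
    restores an even number of iterations. *)
Lemma not_fatou_al : ~ fatou (iterates (fpow b d (expi th))) (Some (expi al)).
Proof.
have apb' := apb.
apply: not_fatou_limit.
- by elim=> // n IH; rewrite mulnS !addSn add0n !iterS IH Fal Fbe.
- by apply: expi_ne; [lra|rewrite lt_eqF //; lra].
move=> r r0; pose k := Num.min (r / 2) ((p - al) / 2).
have k1 : [/\ 0 < k, k <= r / 2 & k <= (p - al) / 2].
  by split; rewrite ?lt_min ?ge_min ?lexx ?orbT //; lra.
have [k2 k3 k4] := k1; exists (al + k); split.
  by rewrite ltr_norml; lra.
have h1 : F (al + k) < be by rewrite -Fal flift_lt //; lra.
have h2 : p < F (al + k) by rewrite -[X in X < _]Fp flift_lt //; lra.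
have C : (fun n => iter (2 * n) F (F (al + k))) @ \oo --> p.
  by apply: (iter_basin b1 (be := be)) => //; [by rewrite Fbe|lra].
have C2 : (fun n => F (iter (2 * n) F (F (al + k)))) @ \oo --> p.
  rewrite -[X in _ --> X]Fp; apply: continuous_cvg C; exact: continuous_flift.
rewrite -(cvg_shiftn 1); apply: cvg_trans C2; apply: near_eq_cvg.
by near=> n; rewrite /= -iterSr -iterS addn1 mulnS.
Unshelve. all: by end_near. Qed.

End ImmediateBasin.

Section CircleHeight.
Variable R : realType.
Implicit Types (s t x y e : R) (z : sphere R).

Lemma Re_le_normc (a : R[i]) : `|complex.Re a| <= normc a.
Proof.
rewrite -(@ler_pXn2r _ 2) ?nnegrE ?normc_ge0 // sqr_normcE real_normK ?num_real //.
by rewrite lerDl sqr_ge0.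
Qed.

(** The coordinate along e^(i mu). With mu the midpoint of an arc, one level meets the circle
    exactly at the two endpoints and separates the arc from the rest. *)
Definition height (mu : R) z := if z is Some a then complex.Re (a * expi (- mu)) else 0.

Lemma heightE mu t : height mu (Some (expi t)) = cos (t - mu).
Proof. by rewrite /height -expiD. Qed.

Lemma continuous_height mu (a : R[i]) : {for Some a, continuous (height mu)}.
Proof.
apply/cvgrPdist_lt => e e0; apply/sphere_nbhs; exists e => // u hu.
rewrite /height -[X in `|X|](_ : complex.Re ((a - u) * expi (- mu)) = _).
  apply: (le_lt_trans (Re_le_normc _)).
  by rewrite normcM normc_expi mulr1 normc_distC.
by rewrite mulrBl; case: (a * _) => ? ?; case: (u * _).
Qed.

Lemma cos_eq_expi s x : 0 < x < pi -> cos s = cos x -> expi s = expi x \/ expi s = expi (- x).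
Proof.
move=> x0 E; have [t [tpi Et]] := circle_expi (normc_expi s).
have Ec : cos t = cos x by have := congr1 (@complex.Re R) Et; rewrite /= => <-.
have h : `|t| = x.
  apply: cos_inj; rewrite ?in_itv /= ?normr_ge0 ?cos_norm // ?ler_norml; lra.
rewrite Et; have [t0|t0] := leP 0 t.
  by left; rewrite -h ger0_norm.
by right; rewrite -h ltr0_norm // opprK.
Qed.

Lemma uniform_pos (P : nat -> R -> Prop) n :
  (forall k x y, 0 < y -> y <= x -> P k x -> P k y) ->
  (forall k, (0 < k < n)%N -> exists2 x, 0 < x & P k x) ->
  exists2 x, 0 < x & forall k, (0 < k < n)%N -> P k x.
Proof.
move=> mon; elim: n => [|n IH] H; first by exists 1 => // k; rewrite ltn0 andbF.
have [k kn|x x0 Hx] := IH.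
  by apply: H; case/andP: kn => -> /ltnW.
have [->|n0] := posnP n; first by exists 1 => // -[|k]; rewrite ?ltnS //=.
have [y y0 Hy] := H n ltac:(by rewrite n0 /=).
exists (Num.min x y); first by rewrite lt_min x0.
have m0 : 0 < Num.min x y by rewrite lt_min x0.
move=> k /andP[k0]; rewrite ltnS leq_eqVlt => /predU1P[->|kn].
  by apply: mon Hy => //; rewrite ge_min lexx orbT.
by apply: mon (Hx k _) => //; rewrite ?ge_min ?lexx ?k0.
Qed.

End CircleHeight.

(** * I_lambda as an open arc, and the trapping arc inside it *)

Section ImmediateArc.
Variables (R : realType) (d : nat) (b : R).
Hypothesis b1 : 1 < b.
Hypothesis d2 : (2 <= d)%N.
Variables (th p al be : R).
Local Notation F := (flift b d th).
Hypothesis Fp : F p = p.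
Hypothesis gp : d%:R * gder b p < 1.
Hypothesis apb : al < p < be.
Hypothesis ab2 : be - al < 2 * pi.
Hypothesis Fbe : F be = al.
Hypothesis Fal : F al = be.
Hypothesis Hbe : forall t, p < t < be -> p < F (F t) < t.
Implicit Types (s t x y e r q : R) (z w : sphere R).

Let d0 : (0 < d)%N. Proof. exact: ltnW. Qed.

(** The heights of a connected set form an interval. They avoid the level of the two endpoints,
    which lie in the Julia set, and that of e^(i p) is above this level. *)
Lemma Iarc_sub z : Iarc d b (expi th) z -> exists t, al < t < be /\ z = Some (expi t).
Proof.
have apb' := apb; have ab2' := ab2.
move=> [z0 /(attracting_circle b1)[t0 [-> gt0 Ft0]]].
rewrite (attracting_uniq b1 d0 Fp gp Ft0 gt0) => -[C [Cp CF cC] Cz].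
pose mu := (al + be) / 2; pose x := (be - al) / 2.
have p0 := @pi_gt0 R.
have cq : connected (height mu @` C).
  apply: connected_continuous_connected => //.
  apply: continuous_in_subspaceT => y /set_mem Cy.
  by have [_ [a _ <-]] := CF y Cy; exact: continuous_height.
have Ccirc (y : sphere R) : C y -> exists s, mu - pi < s <= mu + pi /\ y = Some (expi s).
  move=> Cy; have [_ [a a1 <-]] := CF y Cy.
  have [|s [hs Es]] := @circle_expi _ (a * expi (- mu)).
    by rewrite normcM normc_expi mulr1.
  exists (s + mu); split; first lra.
  by rewrite expiD -Es -mulrA -expiD addNr expi0 mulr1.
have NB : ~ fatou (iterates (fpow b d (expi th))) (Some (expi be)).
  by eapply not_fatou_be; eassumption.
have NA : ~ fatou (iterates (fpow b d (expi th))) (Some (expi al)).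
  by eapply not_fatou_al; eassumption.
have noh (y : sphere R) : C y -> height mu y <> cos x.
  move=> Cy; have [s [_ Es]] := Ccirc y Cy; rewrite Es heightE => E.
  have [Fy _] := CF y Cy.
  have [|h|h] := cos_eq_expi _ E; first by rewrite /x; lra.
    apply: NB.
    suff <- : expi s = expi be by rewrite -Es.
    by rewrite -[s](subrK mu) expiD h -expiD; apply: congr1; rewrite /x /mu; field.
  apply: NA.
  suff <- : expi s = expi al by rewrite -Es.
  by rewrite -[s](subrK mu) expiD h -expiD; apply: congr1; rewrite /x /mu; field.
have hp : cos x < height mu (Some (expi p)).
  rewrite heightE -[cos (p - mu)]cos_norm ltr_cos ?in_itv /= ?normr_ge0 ?ltr_norml
    ?ler_norml /x /mu; lra.
have [s [hs Es]] := Ccirc z Cz.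
have hz : cos x < height mu z.
  rewrite ltNge; apply/negP => hz.
  have [y Cy Ey] : (height mu @` C) (cos x).
    move/connected_intervalP : cq => /(_ (height mu z) (height mu (Some (expi p)))).
    by apply; [exists z|exists (Some (expi p))|rewrite hz ltW].
  exact: noh Ey.
exists s; split => //; move: hz; rewrite Es heightE -[cos (s - mu)]cos_norm.
rewrite ltr_cos ?in_itv /= ?normr_ge0 ?ltr_norml ?ler_norml /x; rewrite /mu in hs *; lra.
Qed.

Lemma Iarc_sup t : al < t < be -> Iarc d b (expi th) (Some (expi t)).
Proof.
move=> tab; exists (Some (expi p)).
  split; first by rewrite fpow_expi // Fp.
  by rewrite /multiplier normc_sderiv_fpow.
pose C := (fun t => Some (expi t) : sphere R) @` `]al, be[.
exists C; last by exists t => //=; rewrite in_itv.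
split.
- by exists p => //=; rewrite in_itv.
- move=> _ [s /= hs <-]; rewrite in_itv /= in hs; split.
    exact: (@fatou_basin _ _ _ b1 d2 th p al be).
  by exists (expi s) => //; exact: normc_expi.
apply: connected_continuous_connected.
  by apply/connected_intervalP; exact: interval_is_interval.
by apply: continuous_subspaceT; exact: continuous_Some_expi.
Qed.

Lemma hlift_mono k : (0 < k)%N -> k != d -> {mono hlift d b k th : x y / x < y}.
Proof.
by move=> k0 kd x y; rewrite /hlift (negPf kd) !(flift_lt b1).
Qed.

(** Each t of the closed arc has its own integer. It cannot decrease by monotonicity, nor increase:
    the lift would then take the value be + 2 pi j, which is in no lift of the open arc since be -
    al < 2 pi. *)
Lemma trapping_lift k : (0 < k)%N -> (k < d)%N ->
  closure ((fpow b 1 (expi th) \o fpow b k (expi th)) @` Iarc d b (expi th))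
    `<=` Iarc d b (expi th) ->
  exists j : int, forall t, al <= t <= be ->
    al < hlift d b k th t - 2 * pi * j%:~R < be.
Proof.
have apb' := apb; have ab2' := ab2.
move=> k0 kd T; have p0 := @pi_gt0 R.
have kd' : k != d by rewrite ltn_eqF.
pose H := hlift d b k th.
have cH : continuous H by exact: continuous_hlift.
have pt t : al <= t <= be -> exists j : int, al < H t - 2 * pi * j%:~R < be.
  move=> tab.
  have : Iarc d b (expi th) (Some (expi (H t))).
    apply: T => B /= NB.
    have : \forall s \near t, B (Some (expi (H s))).
      apply: (@continuous_comp _ _ _ H (fun t => Some (expi t) : sphere R)) NB.
        exact: cH.
      exact: continuous_Some_expi.
    case=> r /= r0 Hr.
    have [s [s1 s2]] : exists s, al < s < be /\ `|t - s| < r.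
      have [tp|tp] := leP t p.
        pose m := Num.min (r / 2) ((be - p) / 2).
        have [m1 m2 m3] : [/\ 0 < m, m <= r / 2 & m <= (be - p) / 2].
          by split; rewrite ?lt_min ?ge_min ?lexx ?orbT //; lra.
        exists (t + m); split; first lra.
        by rewrite ltr_norml; lra.
      pose m := Num.min (r / 2) ((p - al) / 2).
      have [m1 m2 m3] : [/\ 0 < m, m <= r / 2 & m <= (p - al) / 2].
        by split; rewrite ?lt_min ?ge_min ?lexx ?orbT //; lra.
      exists (t - m); split; first lra.
      by rewrite ltr_norml; lra.
    exists (Some (expi (H s))); split; last exact: Hr.
    exists (Some (expi s)); first exact: Iarc_sup.
    by rewrite /= !fpow_expi // /H /hlift (negPf kd').
  move=> /Iarc_sub[s [hs /Some_inj/expi_inj[j E]]].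
  by exists j; rewrite E addrK.
have [j hj] := pt al ltac:(lra).
exists j => t tab; have [i hi] := pt t tab.
suff -> : j = i by [].
have ival a : al <= a <= be -> forall y, (H al <= y <= H a) ->
    exists2 s, al <= s <= be & H s = y.
  move=> aab y hy; have [||s] := @IVT _ H al a y ltac:(lra).
  - by apply: continuous_subspaceT.
  - by rewrite ge_min le_max; case/andP: hy => -> ->; rewrite orbT.
  by rewrite in_itv /= => hs <-; exists s => //; lra.
have Hle : H al <= H t by rewrite leNgt hlift_mono // -leNgt; lra.
apply/eqP; rewrite eq_le; apply/andP; split; rewrite leNgt; apply/negP => ij.
  have : (i + 1)%:~R <= j%:~R :> R by rewrite ler_int lezD1.
  rewrite intrD => h.
  have : 2 * pi * (i%:~R + 1) <= 2 * pi * j%:~R :> R by rewrite ler_pM2l //; lra.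
  lra.
have ji : (j + 1)%:~R <= i%:~R :> R by rewrite ler_int lezD1.
rewrite intrD in ji.
have ji' : 2 * pi * (j%:~R + 1) <= 2 * pi * i%:~R :> R by rewrite ler_pM2l //; lra.
have [s sab Es] := ival t tab (be + 2 * pi * j%:~R) ltac:(lra).
have [l hl] := pt s sab; rewrite Es in hl.
have P : 0 < 2 * pi :> R by lra.
have [lj|lj] := leP l j.
  have lj' : l%:~R <= j%:~R :> R by rewrite ler_int.
  by have := ler_wpM2l (ltW P) lj'; lra.
have lj' : (j + 1)%:~R <= l%:~R :> R by rewrite ler_int lezD1.
by have := ler_wpM2l (ltW P) lj'; rewrite intrD mulrDr mulr1; lra.
Qed.

Lemma trapped_of_trapping :
  (forall k, (1 <= k <= d.-1)%N ->
    closure ((fpow b 1 (expi th) \o fpow b k (expi th)) @` Iarc d b (expi th))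
      `<=` Iarc d b (expi th)) ->
  exists u v e, [/\ u < v, v - u < 2 * pi, 0 < e &
    trapped d b (fun k => (1 <= k <= d)%N) u v e th].
Proof.
have apb' := apb; have ab2' := ab2.
move=> T.
pose P k e := exists j : int, forall t, al <= t <= be ->
    al + e <= hlift d b k th t - 2 * pi * j%:~R <= be - e.
have [||e e0 He] := @uniform_pos R P d.
- by move=> k x y y0 yx [j H]; exists j => t /H; lra.
- move=> k /andP[k0 kd].
  have [|j Hj] := @trapping_lift k k0 kd; first by apply: T; rewrite k0 -ltnS prednK.
  have hA := Hj al ltac:(lra); have hB := Hj be ltac:(lra).
  pose x := Num.min (hlift d b k th al - 2 * pi * j%:~R - al)
                    (be - (hlift d b k th be - 2 * pi * j%:~R)).
  have [x0 x1 x2] : [/\ 0 < x, x <= hlift d b k th al - 2 * pi * j%:~R - al &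
      x <= be - (hlift d b k th be - 2 * pi * j%:~R)].
    by split; rewrite ?lt_min ?ge_min ?lexx ?orbT //; lra.
  exists x => //; exists j => t tab.
  have h1 : hlift d b k th al <= hlift d b k th t.
    by rewrite leNgt hlift_mono // ?ltn_eqF // -leNgt; lra.
  have h2 : hlift d b k th t <= hlift d b k th be.
    by rewrite leNgt hlift_mono // ?ltn_eqF // -leNgt; lra.
  lra.
(* e is a margin common to all k < d. With u below al + e and v above be - e, the images for k < d
   fall inside (u, v), and [trap_pair] takes care of k = d. *)
have [||u [v [[u1 u2 u3 u4 [u5 u6]] [u7 u8]]]] :=
    @trap_pair _ _ _ b1 d2 th p al be Fp apb Fbe Hbe (al + e) (be - e); [lra|lra|].
pose x := Num.min (Num.min (al + e - u) (v - (be - e))) (Num.min (F v - u) (v - F u)).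
have [x0 x1 x2 [x3 x4]] : [/\ 0 < x, x <= al + e - u, x <= v - (be - e) &
    x <= F v - u /\ x <= v - F u].
  by split; last split; rewrite ?lt_min ?ge_min ?lexx ?orbT //; lra.
exists u, v, x; split => //; try lra.
move=> k /andP[k0 kd]; split; first by rewrite k0.
move: kd; rewrite leq_eqVlt => /predU1P[->|kd].
  exists 0 => t tuv; rewrite mulr0 subr0 /hlift eqxx.
  have h1 : F v <= F t by rewrite leNgt flift_lt // -leNgt; lra.
  have h2 : F t <= F u by rewrite leNgt flift_lt // -leNgt; lra.
  lra.
have [|j Hj] := He k; first by rewrite k0.
by exists j => t tuv; have := Hj t ltac:(lra); lra.
Qed.

End ImmediateArc.

(** * Stability in the parameter and compactness *)

Section Stability.
Variables (R : realType) (d : nat) (b : R).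
Hypothesis b1 : 1 < b.
Implicit Types (s t x y e r q th : R).

Lemma near_forall_le (T : Type) (G : set_system T) (FG : Filter G)
    (Q : nat -> T -> Prop) n :
  (forall k, \forall x \near G, Q k x) -> \forall x \near G, forall k, (k <= n)%N -> Q k x.
Proof.
move=> H; elim: n => [|n IH].
  by apply: filterS (H 0%N) => x hx k; rewrite leqn0 => /eqP ->.
apply: filterS2 (H n.+1) IH => x h1 h2 k.
by rewrite leq_eqVlt => /predU1P[->//|]; exact: h2.
Qed.

Lemma continuous_hlift_param k t th : (fun th => hlift d b k th t) @ th --> hlift d b k th t.
Proof.
have C m : (fun th => flift b m th t) @ th --> flift b m th t.
  by apply: cvgB; [exact: cvg_id|exact: cvg_cst].
rewrite /hlift; case: eqP => _; first exact: C.
apply: cvgB; first exact: cvg_id.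
apply: cvgM; first exact: cvg_cst.
apply: (@continuous_cvg _ _ _ _ _ _ (phi b)); first exact: continuous_phi.
exact: C.
Qed.

(** The lifts are monotone, so trapping only concerns the images of two endpoints under finitely
    many maps, an open condition once half of the margin is given up. *)
Lemma trapped_near u v e th : u < v -> 0 < e ->
  trapped d b (fun k => (1 <= k <= d)%N) u v e th ->
  \forall th' \near th, trapped d b (fun k => (1 <= k <= d)%N) u v (e / 2) th'.
Proof.
move=> uv e0 T.
have : \forall th' \near th, forall k, (k <= d)%N ->
    `|hlift d b k th u - hlift d b k th' u| < e / 2 /\
    `|hlift d b k th v - hlift d b k th' v| < e / 2.
  apply: (@near_forall_le _ (nbhs th) _ (fun k th' =>
    `|hlift d b k th u - hlift d b k th' u| < e / 2 /\
    `|hlift d b k th v - hlift d b k th' v| < e / 2)) => k.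
  have C t : \forall th' \near th, `|hlift d b k th t - hlift d b k th' t| < e / 2.
    have /cvgr_dist_lt := @continuous_hlift_param k t th; apply; lra.
  by apply: filterS2 (C u) (C v).
apply: filterS => th' H k kd; have [_ [j Hj]] := T k kd; split => //.
have [k0 kd'] := andP kd.
have [] := H k kd'; rewrite !ltr_norml => hu hv.
have Hu := Hj u ltac:(lra); have Hv := Hj v ltac:(lra).
exists j => t tuv; have [kd2|kd2] := eqVneq k d.
  move: hu hv Hu Hv; rewrite /hlift kd2 eqxx => hu hv Hu Hv.
  have d0 : (0 < d)%N by rewrite -kd2.
  have h1 : flift b d th' v <= flift b d th' t by rewrite leNgt flift_lt // -leNgt; lra.
  have h2 : flift b d th' t <= flift b d th' u by rewrite leNgt flift_lt // -leNgt; lra.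
  lra.
have h1 : hlift d b k th' u <= hlift d b k th' t by rewrite leNgt hlift_mono // -leNgt; lra.
have h2 : hlift d b k th' t <= hlift d b k th' v by rewrite leNgt hlift_mono // -leNgt; lra.
lra.
Qed.

Lemma julia_expand_segment a c kappa :
  (forall th, a <= th <= c -> exists u v e, [/\ u < v, v - u < 2 * pi, 0 < e &
    trapped d b (fun k => (1 <= k <= d)%N) u v e th]) ->
  exists N : nat, (0 < N)%N /\ forall th, a <= th <= c ->
    forall w, Omega d w -> forall z, Jset d b w (expi th) z ->
    kappa <= normc (sderiv (fhatn d b w (expi th) N) z).
Proof.
move=> H.
pose P (N : nat) th := (0 < N)%N /\ forall w, Omega d w -> forall z,
  Jset d b w (expi th) z -> kappa <= normc (sderiv (fhatn d b w (expi th) N) z).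
(* Near each th the estimate holds for all large N; this form of compactness yields large N valid on
   the whole segment. *)
have /compact_near_coveringP/(_ nat \oo P) := @segment_compact R a c.
case=> [|N0 _ HN0].
  move=> th /=; rewrite in_itv /= => /H[u [v [e [uv vu e0 T]]]].
  have e20 : 0 < e / 2 by lra.
  have A := trapped_near uv e0 T.
  have B := julia_expand d b1 kappa uv vu e20.
  have B' : \forall N \near \oo, (0 < N)%N by exists 1%N.
  exists ([set th' | trapped d b (fun k => (1 <= k <= d)%N) u v (e / 2) th'],
    [set N | (0 < N)%N /\ forall S th' w z, trapped d b S u v (e / 2) th' ->
     (forall n, S (w n)) -> Jset d b w (expi th') z ->
     kappa <= normc (sderiv (fhatn d b w (expi th') N) z)]).
    by split => //=; apply: filterS2 B' B => N; split.
  move=> [th' N] [/= h1 [N0 h2]]; split => // w Ow z.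
  exact: h2 h1 Ow.
exists (maxn 1 N0).
have HP := HN0 (maxn 1 N0) (leq_maxr _ _).
split; first exact: leq_maxl.
by move=> th hth; apply: (HP th _).2; rewrite /= in_itv.
Qed.

End Stability.

(** * The parameters lambda_0 and lambda_1 *)

Section SpecialParams.
Variables (R : realType) (d : nat) (b : R).
Hypothesis d2 : (2 <= d)%N.
Hypothesis hb : 1 < b < (d%:R + 1) / (d%:R - 1).
Implicit Types (s t x y e r q th : R).

Let b1 : 1 < b. Proof. by case/andP: hb. Qed.
Let d0 : (0 < d)%N. Proof. exact: ltnW. Qed.
Let dR2 : 2 <= d%:R :> R. Proof. by rewrite ler_nat. Qed.

(* e^(i t) is a fixed point of f_(d, lambda) for lambda = e^(i Lam t). *)
Definition Lam t := t + d%:R * phi b t.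

Lemma continuous_Lam : continuous Lam.
Proof.
move=> x; apply: cvgD; first exact: cvg_id.
by apply: cvgM; [exact: cvg_cst|exact: continuous_phi].
Qed.

Lemma Lam_lt : {mono Lam : x y / x < y}.
Proof.
have H x y : x < y -> Lam x < Lam y.
  move=> xy; apply: ltrD => //; rewrite ltr_pM2l ?ltr0n //; by rewrite phi_lt.
move=> x y; apply/idP/idP; last exact: H.
by apply: contraLR; rewrite -!leNgt le_eqVlt => /predU1P[->//|/H/ltW].
Qed.

Lemma Lam0 : Lam 0 = 0.
Proof. by rewrite /Lam phi0 mulr0 addr0. Qed.

Lemma flift_Lam t : flift b d (Lam t) t = t.
Proof. by rewrite /flift /Lam addrK. Qed.

(** The upper bound on b enters here: the left side is d (b - 1) / (b + 1). *)
Lemma gder0_lt : d%:R * gder b 0 < 1.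
Proof.
have B := b1; have D := dR2; case/andP: hb => _.
rewrite ltr_pdivlMr; last lra.
move=> h; rewrite /gder mulrA ltr_pdivrMr ?nrm2_gt0 // mul1r /nrm2 cos0 -subr_gt0.
rewrite [ltRHS](_ : _ = (b + 1) * (d%:R + 1 - b * (d%:R - 1))); last by ring.
by apply: mulr_gt0; lra.
Qed.

Lemma gderpi_gt : 1 < d%:R * gder b pi.
Proof.
have B := b1; have D := dR2.
rewrite /gder mulrA ltr_pdivlMr ?nrm2_gt0 // mul1r /nrm2 cospi -subr_gt0.
rewrite [ltRHS](_ : _ = (b - 1) * (d%:R * (b + 1) - (b - 1))); last by ring.
have : 2 * (b + 1) <= d%:R * (b + 1) by rewrite ler_pM2r //; lra.
by move=> h; apply: mulr_gt0; lra.
Qed.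

Lemma phi_bounds t : 0 < t < pi -> 0 < phi b t < pi.
Proof.
move=> /andP[t0 tpi]; have := phi_lt b1 0 t; have := phi_lt b1 t pi.
by rewrite phi0 phipi t0 tpi => -> ->.
Qed.

Lemma sin_phi t : sin (phi b t) = gder b t * sin t.
Proof.
have := sin_half_phi b1 t (- t); rewrite phiN.
have -> : (phi b t - - phi b t) / 2 = phi b t by field.
have -> : (t - - t) / 2 = t by field.
have -> : nrm b (- t) = nrm b t by rewrite /nrm /nrm2 cosN.
by move=> ->; rewrite -expr2 sqr_nrm.
Qed.

Lemma gder_le_tau ta t : 0 <= ta <= pi -> d%:R * gder b ta = 1 -> 0 <= t < ta ->
  d%:R * gder b t < 1.
Proof.
move=> h1 E h2; rewrite -[ltRHS]E ltr_pM2l ?ltr0n // (gder_lt b1) ltr_cos ?in_itv /=; lra.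
Qed.

(** Otherwise Lam t = pi for some t in (0, ta], so that sin (d phi t) = sin t. But sin (d phi t) < d
    sin (phi t) = d gder t sin t <= sin t. *)
Lemma Lam_tau_lt_pi ta : 0 < ta < pi -> d%:R * gder b ta = 1 -> Lam ta < pi.
Proof.
move=> ta0 gta; rewrite ltNge; apply/negP => h; have p0 := @pi_gt0 R.
have [||t] := @IVT _ Lam 0 ta pi ltac:(lra).
- by apply: continuous_subspaceT; exact: continuous_Lam.
- by rewrite ge_min le_max Lam0 h (ltW p0) !orbT.
rewrite in_itv /= => tta Et.
have t0 : t != 0 by apply/eqP => E; move: Et; rewrite E Lam0; lra.
have t00 : 0 < t by rewrite lt_neqAle eq_sym t0; lra.
have gt : d%:R * gder b t <= 1.
  have [->|tn] := eqVneq t ta; first by rewrite gta.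
  by apply: ltW; apply: gder_le_tau gta _; [lra|rewrite lt_neqAle tn; lra].
have ph : 0 < phi b t < pi by apply: phi_bounds; lra.
have := sin_mul_lt d2 ph; rewrite sin_phi.
have -> : d%:R * phi b t = pi - t by move: Et; rewrite /Lam; lra.
rewrite sinB sinpi cospi mul0r sub0r mulN1r opprK mulrA.
have st : 0 < sin t by apply: sin_gt0_pi; lra.
by rewrite ltNge ler_piMl // ltW.
Qed.

Lemma Arg_expi (z : R[i]) : normc z = 1 -> z = expi (Arg z).
Proof.
move=> z1; have [t [ht Et]] := circle_expi z1.
have [_] : [set t : R | - pi < t <= pi /\ z = (normc z)%:C * expi t] (Arg z).
  by apply: getPex; exists t; split => //; rewrite z1 mul1r.
by rewrite z1 mul1r.
Qed.

(** The multiplier is a root of unity, so its modulus d gder t is 1. [gder] is even and [Lam] odd,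
    and a negative t would put lam1 in the lower half plane. *)
Lemma lambda1P lam1 : is_lambda1 d b lam1 -> exists ta : R,
  [/\ 0 < ta < pi, d%:R * gder b ta = 1, Lam ta < pi & lam1 = expi (Lam ta)].
Proof.
move=> [n1 Arg1 [z [Fz [q q0 Mq]]]]; have p0 := @pi_gt0 R.
have E1 := Arg_expi n1; set th := Arg lam1 in Arg1 E1.
rewrite E1 in Fz Mq.
have [t' Et'] := fpow_fixed_circle b1 Fz.
have [t [tpi Et]] := circle_expi (normc_expi t').
rewrite Et in Et'; rewrite Et' in Fz Mq.
have gt : d%:R * gder b t = 1.
  apply/eqP; rewrite -(@pexpr_eq1 _ _ q) //; last first.
    by apply: mulr_ge0 => //; exact: ltW (gder_gt0 b1 _).
  rewrite -(normc_sderiv_fpow b1 d th t) -normcX.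
  by rewrite (_ : sderiv _ _ ^+ q = 1) ?normc1.
have [j Ej] : exists j : int, flift b d th t = t + 2 * pi * j%:~R.
  by apply: expi_inj; apply: Some_inj; rewrite -fpow_expi.
have Eth : expi th = expi (Lam t).
  by rewrite -(expiDint (Lam t) j); apply: congr1; move: Ej; rewrite /Lam /flift; lra.
have g0 := gder0_lt; have gpi := gderpi_gt.
have t0 : t != 0 by apply/eqP => E; rewrite E in gt; lra.
have tnpi : t != pi by apply/eqP => E; rewrite E in gt; lra.
have Ta : 0 < `|t| < pi.
  rewrite normr_gt0 t0 /= ltr_norml; case/andP: tpi => -> h /=.
  by rewrite lt_neqAle tnpi.
have gT : d%:R * gder b `|t| = 1.
  by have [h|h] := leP 0 t; [rewrite ger0_norm|rewrite ltr0_norm // gderN].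
have LT := Lam_tau_lt_pi Ta gT.
exists `|t|; split => //; rewrite E1 Eth.
have [h|h] := leP 0 t; first by rewrite ger0_norm.
exfalso; have LN : Lam t = - Lam `|t|.
  by rewrite ltr0_norm // /Lam phiN; ring.
have := congr1 (@complex.Im R) Eth; rewrite LN /= sinN.
have : 0 < sin th by apply: sin_gt0_pi.
have : 0 < sin (Lam `|t|).
  by apply: sin_gt0_pi; rewrite LT -Lam0 Lam_lt; case/andP: Ta => ->.
lra.
Qed.

Lemma phi_small : exists2 r, 0 < r & forall t, 0 < t < r -> 0 < t - d%:R * phi b t.
Proof.
have p0 := @pi_gt0 R.
have C1 : \forall t \near (0 : R), d%:R * phi b t < pi.
  have : d%:R * phi b t @[t --> 0] --> d%:R * phi b 0.
    by apply: cvgM; [exact: cvg_cst|exact: continuous_phi].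
  by rewrite phi0 mulr0; move/cvgr_lt; apply.
have C2 : \forall t \near (0 : R), d%:R * gder b t < 1.
  have : d%:R * gder b t @[t --> 0] --> d%:R * gder b 0.
    by apply: cvgM; [exact: cvg_cst|exact: continuous_gder].
  by move/cvgr_lt; apply; exact: gder0_lt.
have [r /= r0 H] : \forall t \near (0 : R), d%:R * phi b t < pi /\ d%:R * gder b t < 1.
  exact: filterS2 C1 C2.
exists (Num.min r pi); first by rewrite lt_min r0.
move=> t /andP[t0]; rewrite lt_min => /andP[tr tpi].
have [h1 h2] := H t ltac:(rewrite /= ltr_norml; lra).
have g0 := gder_gt0 b1 0; have g1 := gder_gt0 b1 t.
have dp : 0 < d%:R :> R by rewrite ltr0n.
have ph : 0 < phi b t < pi by apply: phi_bounds; lra.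
have dph : 0 < d%:R * phi b t by apply: mulr_gt0 => //; lra.
have := flift_chord b1 d 0 t 0; rewrite /flift phi0 !mulr0 !sub0r oppr0 !subr0 addr0.
rewrite mulNr sinN sqrrN => h3.
have s1 : 0 < sin (t / 2) by apply: sin_half_gt0; lra.
have s2 : 0 < sin (d%:R * phi b t / 2) by apply: sin_half_gt0; lra.
have h4 : sin (d%:R * phi b t / 2) ^+ 2 < sin (t / 2) ^+ 2.
  apply: (le_lt_trans h3); rewrite gtr_pMl ?exprn_gt0 //.
  apply: mulr_ilt1 => //; [| |exact: gder0_lt]; by apply: ltW; apply: mulr_gt0.
rewrite ltr_pXn2r ?nnegrE ?(ltW s1) ?(ltW s2) // in h4.
by move: h4; rewrite ltr_sin ?in_itv /=; lra.
Qed.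

(** With G t = t - d phi t, the condition on lambda_0 says that G th0 is a multiple of 2 pi, and th0
    turns out to be the first positive zero of G. The lift then exchanges 0 and th0, hence fixes a
    point in between. *)
Lemma lambda0P lam0 : is_lambda0 d b lam0 -> exists th0 t0 : R,
  [/\ lam0 = expi th0, 0 < t0 < pi, Lam t0 = th0 & d%:R * gder b t0 < 1].
Proof.
move=> [th0 [-> th00 E0 min0]]; have p0 := @pi_gt0 R.
pose G t := t - d%:R * phi b t.
have cG : continuous G.
  move=> x; apply: cvgB; first exact: cvg_id.
  by apply: cvgM; [exact: cvg_cst|exact: continuous_phi].
have Gmin t : 0 < t -> G t = 0 -> th0 <= t.
  by move=> t0 Gt; apply: min0 => //; rewrite fpow_expi // /flift -/(G t) Gt expi0.
have [r r0 Hr] := phi_small.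
pose s := Num.min (r / 2) (Num.min (th0 / 2) (pi / 2)).
have [s0 s1 s2 s3] : [/\ 0 < s, s <= r / 2, s <= th0 / 2 & s <= pi / 2].
  by split; rewrite ?lt_min ?ge_min ?lexx ?orbT //; lra.
have sth : s < th0 by lra.
have Gs : 0 < G s by apply: Hr; lra.
have D := dR2.
have Gpi : G pi < 0.
  by rewrite /G phipi; have : 2 * pi <= d%:R * pi :> R by [rewrite ler_pM2r]; lra.
(* G is positive at s, so it vanishes between s and c, and th0 is at most that zero. *)
have zero c : s < c -> G c < 0 -> th0 < c.
  move=> sc Gc; have [||t] := @IVT _ G s c 0 (ltW sc).
  - by apply: continuous_subspaceT.
  - by rewrite ge_min le_max (ltW Gs) (ltW Gc) orbT.
  rewrite in_itv /= => ht Gt.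
  have tc : t != c by apply/eqP => E; rewrite E in Gt; lra.
  have := Gmin t ltac:(lra) Gt.
  by have : t < c by [rewrite lt_neqAle tc; lra]; lra.
have th0pi : th0 < pi by apply: zero => //; lra.
have Gth : G th0 = 0.
  have [j] : exists j : int, flift b d th0 th0 = 0 + 2 * pi * j%:~R.
    by apply: expi_inj; apply: Some_inj; rewrite -fpow_expi // E0 expi0.
  rewrite add0r => Gj'; have {Gj'}Gj : G th0 = 2 * pi * j%:~R by [].
  have ph : 0 < phi b th0 < pi by apply: phi_bounds; lra.
  have Glt : G th0 < pi.
    by have : 0 < d%:R * phi b th0 by [apply: mulr_gt0; [lra|case/andP: ph]]; rewrite /G; lra.
  have [j0|j0|j0] := ltgtP j 0; last by rewrite Gj j0 mulr0.
    have : G th0 < 0.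
      by rewrite Gj pmulr_rlt0 ?ltrz0 //; lra.
    by move/(zero th0 sth); rewrite ltxx.
  have j1 : 1%:~R <= j%:~R :> R by rewrite ler_int -gtz0_ge1.
  have : 2 * pi * 1%:~R <= 2 * pi * j%:~R :> R by rewrite ler_pM2l //; lra.
  by rewrite mulr1z mulr1; lra.
pose F := flift b d th0.
have F0 : F 0 = th0 by rewrite /F /flift phi0 mulr0 subr0.
have Fth : F th0 = 0 by [].
have [||t] := @IVT _ (fun t => t - F t) 0 th0 0 (ltW th00).
- apply: continuous_subspaceT => x; apply: cvgB; first exact: cvg_id.
  exact: continuous_flift.
- by rewrite ge_min le_max F0 Fth; apply/andP; split; apply/orP; [left|right]; lra.
rewrite in_itv /= => ht /eqP; rewrite subr_eq0 => /eqP Ft.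
have t0 : t != 0 by apply/eqP => E; move: Ft; rewrite E F0; lra.
have tth : t != th0 by apply/eqP => E; move: Ft; rewrite E Fth; lra.
have t00 : 0 < t by rewrite lt_neqAle eq_sym t0; lra.
have tth0 : t < th0 by rewrite lt_neqAle tth; lra.
exists th0, t; split => //; first lra.
  by move: Ft; rewrite /F /flift /Lam; lra.
(* The arc (0, th0) is its own image and t is fixed, so the two densities cancel in the strict
   contraction and d gder t < 1 remains. *)
have := (@hil_flift R b b1 d th0 0 th0 t d0 t00 tth0 _).2.
rewrite -/F F0 Fth -Ft => /(_ ltac:(lra) d2).
by rewrite gtr_pMr // hil_gt0 //; lra.
Qed.

Lemma expi_inj_2pi s t : 0 <= s < 2 * pi -> 0 <= t < 2 * pi -> expi s = expi t -> s = t.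
Proof.
move=> hs ht /expi_inj[j E]; have p0 := @pi_gt0 R.
have P : 0 < 2 * pi :> R by lra.
have [j0|j0|j0] := ltgtP j 0.
- have j1 : j%:~R <= (- 1)%:~R :> R by rewrite ler_int -ltzD1.
  have := ler_wpM2l (ltW P) j1; rewrite mulrN1z mulrN1; lra.
- have j1 : 1%:~R <= j%:~R :> R by rewrite ler_int -gtz0_ge1.
  have := ler_wpM2l (ltW P) j1; rewrite mulr1z mulr1; lra.
by rewrite E j0 mulr0 addr0.
Qed.

End SpecialParams.

Theorem proposition5p13 (R : realType) (d : nat) (b : R)
    (lam0 lam1 lam2 lam' : R[i]) (kappa : R)
    (hd : (2 <= d)%N)
    (hb : 1 < b < (d%:R + 1) / (d%:R - 1))
    (hlam0 : is_lambda0 d b lam0)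
    (hlam1 : is_lambda1 d b lam1)
    (hlam2 : is_lambda2 d b lam0 lam1 lam2)
    (hlam' : arc_co lam0 lam2 lam')
    (hkappa : 1 < kappa) :
  exists N : nat, (0 < N)%N /\
    forall lam : R[i], arc_cc lam0 lam' lam ->
    forall w : nat -> nat, Omega d w ->
    forall z : sphere R, Jset d b w lam z ->
      kappa <= normc (sderiv (fhatn d b w lam N) z).
Proof.
have p0 := @pi_gt0 R; have b1 : 1 < b by case/andP: hb.
have [ta [ta0 gta Lta E1]] := lambda1P hd hb hlam1.
have [th0 [t0 [E0 t00 Lt0 gt0]]] := lambda0P hd hb hlam0.
have t0ta : t0 < ta.
  by move: gt0; rewrite -[ltRHS]gta ltr_pM2l ?ltr0n ?(ltnW hd) // (gder_lt b1) ltr_cos ?in_itv /=; lra.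
have th0L : th0 < Lam d b ta by rewrite -Lt0 Lam_lt.
have th00 : 0 < th0.
  by rewrite -Lt0 -(Lam0 d b) Lam_lt //; case/andP: t00.
have lam0n0 : lam0 != 0 by rewrite E0 expi_neq0.
have [[s3 [t3 [h3 h3' E3 E3']]] trap _] := hlam2.
have [s2 [t2 [h2 h2' E2 E2']]] := hlam'.
have T3 : Lam d b ta - th0 = t3.
  apply: expi_inj_2pi; [lra|lra|apply: (mulfI lam0n0)].
  by rewrite -E3' E1 E0 -expiD addrC subrK.
have T2 : t2 = s3.
  apply: expi_inj_2pi; [lra|lra|apply: (mulfI lam0n0)].
  by rewrite -E2' E3.
have [th Hth|N [N0 HN]] := @julia_expand_segment R d b b1 th0 (th0 + s2) kappa.
  (* th lies below th0 + t3 = Lam ta, so the fixed point p found here satisfies p < ta and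
     attracts. *)
  have [||p] := @IVT _ (Lam d b) 0 ta th ltac:(lra).
  - by apply: continuous_subspaceT; exact: continuous_Lam.
  - by rewrite ge_min le_max Lam0; apply/andP; split; apply/orP; [left|right]; lra.
  rewrite in_itv /= => pta Ep.
  have pn : p != ta by apply/eqP => E; rewrite E in Ep; lra.
  have gp : d%:R * gder b p < 1.
    by apply: gder_le_tau gta _ => //; [lra|rewrite lt_neqAle pn; lra].
  have Fp : flift b d th p = p by rewrite -Ep flift_Lam.
  have [al [be [apb ab2 Fbe Fal Hbe]]] := basin b1 hd Fp gp.
  apply: (trapped_of_trapping b1 hd Fp gp apb ab2 Fbe Fal Hbe) => k.
  (* Angles are counted from lambda_0: th - th0 <= s2 < t2, and t2 is the angle of lambda_2. *)
  apply: trap; exists (th - th0), t2; split; [lra|lra| |by []].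
  by rewrite E0 -expiD addrC subrK.
exists N; split => // lam [s [t [hs ht Es Et]]] w Ow z.
have T : t = s2.
  apply: expi_inj_2pi; [lra|lra|apply: (mulfI lam0n0)].
  by rewrite -Et E2.
rewrite Es E0 -expiD; apply: HN => //; lra.
Qed.
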